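(* Let $N\ge 2$ and $k\in\{0,1,\ldots,N\}$ be integers, let $\lambda\in(-\infty,\lambda_{N,k}]$, and let $m_\lambda=\sqrt{\lambda_{N,k}-\lambda}$. For any $u\in C_c^\infty(\mathbb{R}^{N,k}_+)$ it holds $$\int_{\mathbb{R}^{N,k}_+}\left(|\nabla u|^2-\lambda\frac{|u|^2}{|x|^2}+\frac{|x|^2}{16}|u|^2\right)dx\;\ge\;\frac{1+m_\lambda}{2}\int_{\mathbb{R}^{N,k}_+}|u|^2\,dx .$$ Moreover, the constant $\frac{1+m_\lambda}{2}$ is sharp (it cannot be replaced by any larger constant), and it is achieved by the function $\alpha_{k,\lambda}$, in the sense that the inequality extends to $l_\lambda[u]\ge\frac{1+m_\lambda}{2}\|u\|_{L^2(\mathbb{R}^{N,k}_+)}^2$ for all $u\in H_\lambda$, and $\alpha_{k,\lambda}\in H_\lambda$ satisfies equality.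
   Context: For integers $N\ge2$ and $0\le k\le N$, $\mathbb{R}^{N,k}_+:=\mathbb{R}^{N-k}\times(0,\infty)^k=\{x\in\mathbb{R}^N: x_{N-k+j}>0 \text{ for } 1\le j\le k\}$ (so $\mathbb{R}^{N,0}_+=\mathbb{R}^N$), and $|x|$ is the Euclidean norm. Set $\lambda_{N,k}:=\left(\frac{N-2}{2}+k\right)^2$; this is the optimal constant in the Hardy inequality $\int_{\mathbb{R}^{N,k}_+}|\nabla u|^2dx\ge\lambda_{N,k}\int_{\mathbb{R}^{N,k}_+}\frac{u^2}{|x|^2}dx$, $u\in C_c^\infty(\mathbb{R}^{N,k}_+)$. The function $\alpha_{k,\lambda}$ is defined on $\mathbb{R}^{N,k}_+$ by $$\alpha_{k,\lambda}(x)=e^{-\frac{|x|^2}{8}}\,|x|^{m_\lambda-\frac{N-2}{2}}\,\frac{x_{N-k+1}x_{N-k+2}\cdots x_N}{|x|^k}$$ (for $k=0$ the last fraction is $1$). For $u\in C_c^\infty(\mathbb{R}^{N,k}_+)$ put $l_\lambda[u]=\int_{\mathbb{R}^{N,k}_+}\left(|\nabla u|^2-\frac{\lambda}{|x|^2}|u|^2+\frac{|x|^2}{16}|u|^2\right)dx$ and $\|u\|_{l_\lambda}=\sqrt{l_\lambda[u]}$. The space $H_\lambda$ is the closure (completion) of $C_c^\infty(\mathbb{R}^{N,k}_+)$ in the norm $\|\cdot\|_{l_\lambda}$, realized as the set of $u\in L^2(\mathbb{R}^{N,k}_+)$ for which there is a sequence $(u_n)\subset C_c^\infty(\mathbb{R}^{N,k}_+)$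 that is Cauchy in $\|\cdot\|_{l_\lambda}$ and converges to $u$ in $L^2$; the form is extended to $H_\lambda$ by continuity, $l_\lambda[u]=\lim_n l_\lambda[u_n]$. *)

(* Defs.v *)
From HB Require Import structures.
From mathcomp Require Import all_boot all_order all_algebra.
From mathcomp Require Import all_classical all_reals all_analysis.
Set Implicit Arguments.
Unset Strict Implicit.
Unset Printing Implicit Defensive.
Import Order.TTheory GRing.Theory Num.Theory.
Import numFieldNormedType.Exports.
Local Open Scope classical_set_scope.
Local Open Scope ring_scope.

(* As for tuples in MathComp-Analysis, 'rV[R]_n carries the sigma-algebra
   generated by the coordinates, i.e. the Borel sigma-algebra of R^n. *)
Section measurable_rV.
Variables (R : realType) (n : nat).

Definition rV_coord (i : 'I_n) (v : 'rV[R]_n) : R := v ord0 i.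

Let rV_set0 : g_sigma_preimage rV_coord set0.
Proof. exact: sigma_algebra0. Qed.

Let rV_setC A : g_sigma_preimage rV_coord A -> g_sigma_preimage rV_coord (~` A).
Proof. exact: sigma_algebraC. Qed.

Let rV_bigcup (F : (set 'rV[R]_n)^nat) :
  (forall i, g_sigma_preimage rV_coord (F i)) ->
  g_sigma_preimage rV_coord (\bigcup_i (F i)).
Proof. exact: sigma_algebra_bigcup. Qed.

HB.instance Definition _ := @isMeasurable.Build default_measure_display
  'rV[R]_n (g_sigma_preimage rV_coord) rV_set0 rV_setC rV_bigcup.

Lemma measurable_rV_coord i : measurable_fun setT (rV_coord i).
Proof.
move=> _ Y mY; rewrite setTI; apply: sub_sigma_algebra => /=.
rewrite -bigcup_seq/=; exists i => /=; first by rewrite mem_index_enum.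
by exists Y => //; rewrite setTI.
Qed.

Lemma measurable_fun_rVP d (T : measurableType d) (f : T -> 'rV[R]_n) :
  measurable_fun setT f <-> forall i, measurable_fun setT (rV_coord i \o f).
Proof.
split=> [mf i|mf]; first exact: measurableT_comp (measurable_rV_coord i) mf.
have pre : g_sigma_preimage (fun i => rV_coord i \o f) `<=` measurable.
  apply: smallest_sub; first exact: sigma_algebra_measurable.
  by rewrite -bigcup_seq; apply: bigcup_sub => i _ A [B mB <-]; exact: mf.
move=> _ A mA; rewrite setTI; apply: pre.
rewrite g_sigma_preimage_comp; exists A => //; by rewrite setTI.
Qed.

End measurable_rV.

Section lebesgue_step.
Variables (R : realType) (n : nat).
Variable mu : {sigma_finite_measure set 'rV[R]_n -> \bar R}.
Local Open Scope ereal_scope.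

Definition rV_cons (p : measurableTypeR R * 'rV[R]_n) : 'rV[R]_n.+1 :=
  row_mx (p.1%:M : 'M[R]_1) p.2.

Definition rV_uncons (v : 'rV[R]_n.+1) : measurableTypeR R * 'rV[R]_n :=
  (lsubmx (v : 'rV[R]_(1 + n)) ord0 ord0, rsubmx (v : 'rV[R]_(1 + n))).

Lemma rV_consK : cancel rV_cons rV_uncons.
Proof. by move=> [x v]; rewrite /rV_uncons row_mxKl row_mxKr mxE eqxx mulr1n. Qed.

Lemma rV_unconsK : cancel rV_uncons rV_cons.
Proof. by move=> v; rewrite /rV_cons/= -mx11_scalar hsubmxK. Qed.

Lemma measurable_rV_cons : measurable_fun setT rV_cons.
Proof.
apply/measurable_fun_rVP => i.
have [j ->|j ->] := split_ordP (i : 'I_(1 + n)).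
  rewrite (_ : _ \o _ = fst); first exact: measurable_fst.
  apply/funext => p; rewrite /rV_coord /comp /rV_cons.
  by rewrite (row_mxEl (_ : 'M[R]_1)) mxE (ord1 j) eqxx mulr1n.
rewrite (_ : _ \o _ = rV_coord j \o snd).
  exact: measurableT_comp (measurable_rV_coord j) measurable_snd.
apply/funext => p; rewrite /rV_coord /comp /rV_cons.
by rewrite (row_mxEr (_ : 'M[R]_1)).
Qed.

Lemma measurable_rV_uncons : measurable_fun setT rV_uncons.
Proof.
apply: measurable_fun_pair.
  rewrite (_ : (fun _ => _) = rV_coord (lshift n ord0 : 'I_(1 + n))).
    exact: measurable_rV_coord.
  by apply/funext => v; rewrite mxE.
apply/measurable_fun_rVP => i.
rewrite (_ : _ \o _ = rV_coord (rshift 1 i : 'I_(1 + n))).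
  exact: measurable_rV_coord.
by apply/funext => v; rewrite /rV_coord /comp mxE.
Qed.

Definition lebesgue_step := pushforward (@lebesgue_measure R \x mu) rV_cons.

Let mpre A : measurable A -> measurable (rV_cons @^-1` A).
Proof.
by move=> mA; rewrite -[X in measurable X]setTI; exact: measurable_rV_cons.
Qed.

Let step0 : lebesgue_step set0 = 0.
Proof. by rewrite /lebesgue_step /pushforward preimage_set0 measure0. Qed.

Let step_ge0 A : 0 <= lebesgue_step A.
Proof. exact: (measure_ge0 (@lebesgue_measure R \x mu)). Qed.

Let step_sigma_additive : semi_sigma_additive lebesgue_step.
Proof.
move=> F mF tF mUF; rewrite /lebesgue_step /pushforward preimage_bigcup.
apply: measure_semi_sigma_additive => [k||].
- exact: mpre.
- apply/trivIsetP => /= i j _ _ ij; rewrite -preimage_setI.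
  by move/trivIsetP : tF => /(_ _ _ _ _ ij) ->//; rewrite preimage_set0.
- by rewrite -preimage_bigcup; exact: mpre.
Qed.

HB.instance Definition _ := isMeasure.Build _ _ _
  lebesgue_step step0 step_ge0 step_sigma_additive.

Let step_sigma_finite : sigma_finite setT lebesgue_step.
Proof.
have /sigma_finiteP[F [FT ndF mF]] := sigma_finiteT (@lebesgue_measure R).
have /sigma_finiteP[G [GT ndG mG]] := sigma_finiteT mu.
exists (fun k => rV_uncons @^-1` (F k `*` G k)).
  rewrite -preimage_bigcup (_ : \bigcup_k _ = setT) ?preimage_setT//.
  apply/seteqP; split=> // -[x v] _.
  have [a _ Fa] : (\bigcup_k F k) x by rewrite -FT.
  have [b _ Gb] : (\bigcup_k G k) v by rewrite -GT.
  exists (maxn a b) => //; split=> /=.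
  - by move: Fa; exact/subsetPset/ndF/leq_maxl.
  - by move: Gb; exact/subsetPset/ndG/leq_maxr.
move=> k; have [mFk Fkoo] := mF k; have [mGk Gkoo] := mG k; split.
  rewrite -[X in measurable X]setTI; apply: measurable_rV_uncons => //.
  exact: measurableX.
rewrite /lebesgue_step /pushforward -comp_preimage.
rewrite (_ : _ \o _ = id); last by apply/funext => p; exact: rV_consK.
by rewrite preimage_id product_measure1E// lte_mul_pinfty// ge0_fin_numE.
Qed.

HB.instance Definition _ := Measure_isSigmaFinite.Build _ _ _
  lebesgue_step step_sigma_finite.

End lebesgue_step.

(* Lebesgue measure on R^n, as the n-fold product of the one-dimensional one. *)
Fixpoint lebesgue_rV (R : realType) (n : nat) :
    {sigma_finite_measure set 'rV[R]_n -> \bar R} :=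
  match n with
  | 0 => \d_(0 : 'rV[R]_0)
  | n'.+1 => lebesgue_step (lebesgue_rV R n')
  end.

Lemma lebesgue_rV_box (R : realType) (n : nat) (A : 'I_n -> set R) :
  (forall i, measurable (A i)) ->
  lebesgue_rV R n [set v | forall i, A i (v ord0 i)] =
  (\prod_(i < n) lebesgue_measure (A i))%E.
Proof.
elim: n A => [|n IHn] A mA.
  by rewrite big_ord0 /= diracE mem_set// => -[].
pose B := [set v : 'rV[R]_n | forall i, A (lift ord0 i) (v ord0 i)].
have mB : measurable B.
  rewrite (_ : B =
      \bigcap_(i in [set: 'I_n]) (rV_coord i @^-1` A (lift ord0 i))).
    apply: fin_bigcap_measurable => // i _.
    rewrite -[X in measurable X]setTI.
    exact: (@measurable_rV_coord R n i measurableT _ (mA _)).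
  by apply/seteqP; split=> v /= Av i; [move=> _|]; exact: Av.
rewrite big_ord_recl -(IHn (fun i => A (lift ord0 i)))// -/B.
rewrite -product_measure1E//=; last exact: mA.
rewrite /lebesgue_step /pushforward.
have l0 : ord0 = (lshift n (ord0 : 'I_1) : 'I_(1 + n)) :> 'I_n.+1 by exact: val_inj.
have lS (i : 'I_n) : lift ord0 i = (rshift 1 i : 'I_(1 + n)) :> 'I_n.+1 by exact: val_inj.
have cons0 (x : R) (v : 'rV[R]_n) : rV_cons (x, v) ord0 ord0 = x.
  rewrite (_ : rV_cons _ _ _ =
    row_mx (x%:M : 'M[R]_1) v ord0 (lshift n (ord0 : 'I_1))); last by rewrite -l0.
  by rewrite (row_mxEl (_ : 'M[R]_1)) mxE eqxx mulr1n.
have consS (x : R) (v : 'rV[R]_n) i : rV_cons (x, v) ord0 (lift ord0 i) = v ord0 i.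
  rewrite (_ : rV_cons _ _ _ =
    row_mx (x%:M : 'M[R]_1) v ord0 (rshift 1 i)); last by rewrite -lS.
  by rewrite (row_mxEr (_ : 'M[R]_1)).
congr (_ _); apply/seteqP; split=> -[x v] /=.
  move=> Av; split; first by have := Av ord0; rewrite cons0.
  by move=> i; have := Av (lift ord0 i); rewrite consS.
move=> [Ax Av] i; have [j ->|->] := unliftP ord0 i; last by rewrite cons0.
by rewrite consS; exact: Av.
Qed.

Section notions.
Variables (R : realType) (N : nat).
Implicit Types (u v : 'rV[R]_N -> R) (x : 'rV[R]_N).

(* The norm `|x| of 'rV[R]_N is the sup norm, hence this definition. *)
Definition enorm x : R := Num.sqrt (\sum_(i < N) x ord0 i ^+ 2).

Definition partial (i : 'I_N) u : 'rV[R]_N -> R :=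
  fun x => 'D_(delta_mx ord0 i) u x.

Definition grad_sq u x : R := \sum_(i < N) partial i u x ^+ 2.

Definition smooth u := forall s : seq 'I_N,
  continuous (foldr partial u s) /\
  forall i x, derivable (foldr partial u s) x (delta_mx ord0 i).

(* C_c^oo(Om): a function on Om with compact support in Om is identified with
   its extension by 0 to the whole space. *)
Definition test_fun (Om : set 'rV[R]_N) u :=
  [/\ smooth u,
      compact (closure [set x | u x != 0]) &
      closure [set x | u x != 0] `<=` Om].

Variables (k : nat) (lam : R).

(* x_{N-k+1}, ..., x_N are the coordinates of 0-based index >= N - k. *)
Definition orthant : set 'rV[R]_N :=
  [set x | forall i : 'I_N, (N - k <= i)%N -> 0 < x ord0 i].

Definition hardy_const : R := ((N%:R - 2) / 2 + k%:R) ^+ 2.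

Definition m_lam : R := Num.sqrt (hardy_const - lam).

Definition alpha x : R :=
  expR (- (enorm x ^+ 2 / 8)) * enorm x `^ (m_lam - (N%:R - 2) / 2) *
  ((\prod_(i < N | (N - k <= i)%N) x ord0 i) / enorm x ^+ k).

Local Open Scope ereal_scope.

Definition L2normsq u : \bar R :=
  \int[lebesgue_rV R N]_(x in orthant) (u x ^+ 2)%:E.

Definition in_L2 u := measurable_fun orthant u /\ L2normsq u < +oo.

(* Extended-real valued: the integral is +oo when N = 2, k = 0, lam < 0 and
   u(0) <> 0, since then 1/|x|^2 is not integrable at 0. *)
Definition hardy_form u : \bar R :=
  \int[lebesgue_rV R N]_(x in orthant)
    (grad_sq u x - lam * (u x ^+ 2 / enorm x ^+ 2)
     + enorm x ^+ 2 / 16 * u x ^+ 2)%:E.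

Definition form_norm u : \bar R := sqrte (hardy_form u).

(* Membership of u_n in the normed space (C_c^oo, ||.||_l) requires
   ||u_n||_l < +oo, which is only a restriction in the case above. *)
Definition approx (w : ('rV[R]_N -> R)^nat) u :=
  [/\ forall n, test_fun orthant (w n) /\ form_norm (w n) < +oo,
      forall e : R, (0 < e)%R -> exists n0, forall m n,
        (n0 <= m)%N -> (n0 <= n)%N ->
        form_norm (fun x => w m x - w n x)%R < e%:E &
      L2normsq (fun x => w n x - u x)%R @[n --> \oo] --> 0].

Definition in_H u := in_L2 u /\ exists w, approx w u.

(* The value of the form at u in H: the common limit of hardy_form (w n) along
   all approximating sequences. *)
Definition form_ext u : \bar R :=
  get [set l | exists w, approx w u /\ hardy_form (w n) @[n --> \oo] --> l].

End notions.

(* Main.v *)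
(* Let F be the logarithmic gradient of alpha. Expanding |grad u - F u|^2 and
   integrating by parts gives the ground state representation

     l[u] = c int u^2 + int |grad u - F u|^2,   c = (1 + m) / 2,

   for test functions u of finite energy, because div F + |F|^2 equals
   |x|^2 / 16 - lam / |x|^2 - c. To cope with the origin when k = 0, |x|^2 is
   replaced by |x|^2 + e in F and e tends to 0; the same computation with m = 0
   gives Hardy's inequality, hence the integrability of u^2 / |x|^2.
   The inequality is immediate. The form is closable, since grad - F is a
   closable operator, so the value of the form at alpha can be computed along
   one sequence: smooth logarithmic cut-offs of alpha, for which
   int |grad u - F u|^2 tends to 0. Sharpness follows from equality for alpha. *)

(* The constant comes from completing a square. With h = (N - 2) / 2 + k, the exponent of |x| in
   alpha, once the product of the x_j is split off, is a = m - h. In div F + |F|^2 the coefficient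
   of |x|^-2 is a^2 + 2 a h = m^2 - h^2 = - lam, and the Gaussian contributes, through its
   divergence and the cross terms, - (N + 2 k + 2 a) / 4 = - (1 + m) / 2. Working with grad - F
   suits the critical case m = 0: there alpha^2 / |x|^2 behaves like |x|^-N at the origin and is not
   integrable, so the terms of the form cannot be treated separately at alpha, whereas grad alpha -
   F alpha is 0. The delicate case is N = 2, k = 0: then h = 0 and Hardy's inequality gives no
   control of u^2 / |x|^2. Integrability is therefore carried along for a u^2 / |x|^2 with its
   factor a, which in this case is m and is controlled by the form. Finally, [form_ext] selects a
   limit along some unspecified approximating sequence, so the limit at alpha has to be computed for
   every such sequence; this is where closability enters. *)
Require Import Defs.
From mathcomp Require Import all_boot all_order all_algebra.
From mathcomp Require Import all_classical all_reals all_analysis.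
From mathcomp Require Import measurable_realfun.
From mathcomp Require Import ring lra zify.
Set Implicit Arguments.
Unset Strict Implicit.
Unset Printing Implicit Defensive.
Import Order.TTheory GRing.Theory Num.Theory.
Import numFieldNormedType.Exports.
Local Open Scope classical_set_scope.
Local Open Scope ring_scope.

(** * Integration of derivatives over R^n *)

Section rV_measurability.
Variables (R : realType) (n : nat).
Implicit Types (x y : 'rV[R]_n).

Lemma measurable_rV_rect (A : 'I_n -> set R) :
  (forall i, measurable (A i)) ->
  measurable [set x : 'rV[R]_n | forall i, A i (x ord0 i)].
Proof.
move=> mA; rewrite (_ : [set _ | _] = \bigcap_(i in [set: 'I_n]) (@rV_coord R n i @^-1` A i)).
  apply: fin_bigcap_measurable => // i _.
  rewrite -[X in measurable X]setTI.
  exact: (@measurable_rV_coord R n i measurableT _ (mA _)).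
by apply/seteqP; split=> v /= Av i; [move=> _|]; exact: Av.
Qed.

(** The sigma-algebra is generated by the coordinates, so an open set has to be rebuilt from
    countably many boxes: balls of the sup norm are cubes, and the rational cubes inside U cover
    U. *)
Lemma open_measurable_rV (U : set 'rV[R]_n) : open U -> measurable U.
Proof.
move=> oU.
pose B (p : 'rV[rat]_n * rat) := [set x : 'rV[R]_n | forall i,
  x ord0 i \in `](ratr (p.1 ord0 i) - ratr p.2), (ratr (p.1 ord0 i) + ratr p.2)[].
pose F p := if `[< B p `<=` U >] then B p else set0.
suff -> : U = \bigcup_p F p.
  apply: countable_bigcupT_measurable; first exact: countableP.
  move=> p; rewrite /F; case: ifP => // _.
  exact: (@measurable_rV_rect (fun i => [set` `](ratr (p.1 ord0 i) - ratr p.2), (ratr (p.1 ord0 i) + ratr p.2)[])).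
apply/seteqP; split; last first.
  by move=> x [p _]; rewrite /F; case: ifPn => // /asboolP; exact.
move=> x Ux.
have [e /= e0 eU] : nbhs_ball x U by apply/nbhs_ballP; exact: open_nbhs_nbhs.
have e20 : 0 < e / 2 by rewrite divr_gt0.
have [r] := rat_in_itvoo e20; rewrite in_itv/= => /andP[r0 re].
have /choice[q qP] : forall i : 'I_n, exists q : rat, x ord0 i \in `](ratr q - ratr r), (ratr q + ratr r)[.
  move=> i; have : x ord0 i - ratr r < x ord0 i + ratr r.
    by rewrite ltrD2l; lra.
  move=> /rat_in_itvoo[q]; rewrite in_itv/= => /andP[q1 q2].
  by exists q; rewrite in_itv/=; lra.
exists ((\row_i q i), r) => //.
rewrite /F; case: ifPn => [_|].
  by move=> i /=; rewrite mxE; exact: qP.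
move=> /asboolPn[] y By; apply: eU.
rewrite mx_norm_ball /ball_/= [X in X < _]mx_normrE.
apply: bigmax_lt => // -[i j] _ /=; rewrite ord1.
have := By j; have := qP j; rewrite !in_itv/= !mxE/= => /andP[a b] /andP[c d].
by rewrite ltr_norml; apply/andP; split; lra.
Qed.

Lemma continuous_measurable_rV (f : 'rV[R]_n -> R) :
  continuous f -> measurable_fun setT f.
Proof.
move=> cf; apply: (measurability _ (RGenOpens.measurableE R)).
move=> _ [_ [a [b ->]] <-]; rewrite setTI; apply: open_measurable_rV.
by apply: open_comp => //; move=> x _; exact: cf.
Qed.

End rV_measurability.

Section rV_consE.
Variables (R : realType) (n : nat).
Implicit Types (x t : R) (v : 'rV[R]_n).

Lemma rV_cons0 x v : rV_cons (x, v) ord0 ord0 = x.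
Proof.
rewrite (_ : rV_cons _ _ _ = row_mx (x%:M : 'M[R]_1) v ord0 (lshift n (ord0 : 'I_1))).
  by rewrite (row_mxEl (_ : 'M[R]_1)) mxE eqxx mulr1n.
by rewrite /rV_cons; congr (row_mx _ _ _ _); exact: val_inj.
Qed.

Lemma rV_consS x v i : rV_cons (x, v) ord0 (lift ord0 i) = v ord0 i.
Proof.
rewrite (_ : rV_cons _ _ _ = row_mx (x%:M : 'M[R]_1) v ord0 (rshift 1 i)).
  by rewrite (row_mxEr (_ : 'M[R]_1)).
by rewrite /rV_cons; congr (row_mx _ _ _ _); exact: val_inj.
Qed.

Lemma rV_cons_line0 x t v :
  rV_cons (x, v) + t *: delta_mx ord0 ord0 = rV_cons (x + t, v).
Proof.
apply/rowP => i; rewrite [LHS]mxE [X in _ + X = _]mxE [X in _ + _ * X = _]mxE.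
case: (unliftP ord0 i) => [j ->|->]; rewrite !(rV_consS, rV_cons0) ?eqxx/=.
  by rewrite mulr0 addr0.
by rewrite mulr1.
Qed.

Lemma rV_cons_lineS x t v j :
  rV_cons (x, v) + t *: delta_mx ord0 (lift ord0 j) =
  rV_cons (x, v + t *: delta_mx ord0 j).
Proof.
apply/rowP => i; rewrite [LHS]mxE [X in _ + X = _]mxE [X in _ + _ * X = _]mxE.
case: (unliftP ord0 i) => [l ->|->]; rewrite !(rV_consS, rV_cons0) ?eqxx/=.
  by rewrite (inj_eq lift_inj) !mxE.
by rewrite mulr0 addr0.
Qed.

End rV_consE.

(** Gives access to one-variable calculus: the difference quotients of the two derivatives are the
    same function. *)
Lemma is_derive_lineP (R : realType) (V W : normedModType R) (f : V -> W) x v d :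
  is_derive (0 : R) 1 (fun t : R => f (x + t *: v)) d <-> is_derive x v f d.
Proof.
have E : (fun h : R => h^-1 *: (((fun t : R => f (x + t *: v)) \o shift 0) (h *: 1) - f (x + 0 *: v))) =
  (fun h : R => h^-1 *: ((f \o shift x) (h *: v) - f x)).
  by apply/funext => h /=; rewrite scale0r !addr0 [h *: 1]mulr1 [x + _]addrC.
by split => -[D1 D2]; split; move: D1 D2; rewrite /derivable /derive E.
Qed.

Section integral_derivative.
Variable R : realType.
Local Notation mu := (lebesgue_rV R).

Definition cube n (M : R) : set 'rV[R]_n :=
  [set x | forall i, x ord0 i \in `[- M, M]].
Arguments cube : clear implicits.

Lemma measurable_cube n (M : R) : measurable (cube n M).
Proof. exact: (@measurable_rV_rect R n (fun=> [set` `[- M, M]])). Qed.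

Lemma lebesgue_rV_cube n (M : R) : 0 <= M -> mu n (cube n M) = ((2 * M) ^+ n)%:E.
Proof.
move=> M0.
have := @lebesgue_rV_box R n (fun=> [set` `[- M, M]]) (fun i => measurable_itv _).
rewrite -[X in mu n X]/(cube n M) => ->.
rewrite lebesgue_measure_itv/= lte_fin.
rewrite (_ : (if _ then _ else _) = (2 * M)%:E); last first.
  case: ltrP => h; first by rewrite -EFinB; congr EFin; lra.
  by congr EFin; lra.
by rewrite prodEFin big_const_ord iter_mulr_1.
Qed.

Lemma integrable_bounded_support n (g : 'rV[R]_n -> R) (M C : R) :
  measurable_fun setT g -> (forall x, `|g x| <= C) ->
  (forall (x : 'rV[R]_n) i, M < `|x ord0 i| -> g x = 0) ->
  (mu n).-integrable setT (EFin \o g).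
Proof.
move=> mg gC g0.
(* The sign of [M] is unknown, hence the cube of half-side [|M|]. *)
have -> : EFin \o g = (EFin \o g) \_ (cube n `|M|).
  apply/funext => x; rewrite patchE; case: ifPn => //=.
  rewrite notin_setE /cube/= => /existsNP[i] /negP xi; rewrite (g0 x i)//.
  move: xi; rewrite in_itv/= -ler_norml -ltNge.
  by apply: le_lt_trans; exact: ler_norm.
have mB := @measurable_cube n `|M|.
apply/(integrable_mkcond _ mB).
apply: measurable_bounded_integrable => //.
- by rewrite /= lebesgue_rV_cube// ltry.
- exact: measurable_funTS.
- exists C; split; first exact: num_real.
  by move=> y Cy x _; exact: le_trans (gC x) (ltW Cy).
Qed.

(** Fubini splits off the first coordinate. If the axis [i] is another one, the inner integral
    vanishes by induction on the slice; if it is the first, the inner integral is a one-dimensional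
    integral of a derivative. Regularity is assumed along the lines of direction [i] only, so that
    it passes to slices. *)
Lemma integral_line_derivative n i (G g : 'rV[R]_n -> R) (M C : R) :
  measurable_fun setT g -> (forall x, `|g x| <= C) ->
  (forall (x : 'rV[R]_n) j, M < `|x ord0 j| -> G x = 0) ->
  (forall (x : 'rV[R]_n) j, M < `|x ord0 j| -> g x = 0) ->
  (forall x, is_derive (0 : R) 1 (fun t : R => G (x + t *: delta_mx ord0 i)) (g x)) ->
  (forall x, continuous (fun t : R => g (x + t *: delta_mx ord0 i))) ->
  (\int[mu n]_x (g x)%:E = 0)%E.
Proof.
elim: n i G g => [[]//|n IHn] i G g mg gC G0 g0 dG cg.
have gint := integrable_bounded_support mg gC g0.
have mgc : measurable_fun setT (g \o @rV_cons R n).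
  exact: measurableT_comp mg (@measurable_rV_cons R n).
have gcint : (@lebesgue_measure R \x mu n)%E.-integrable setT ((EFin \o g) \o @rV_cons R n).
  apply/integrableP; split; first exact/measurable_EFinP.
  have /integrableP[_] := gint.
  rewrite [integral _ _ _](_ : _ = (\int[pushforward (@lebesgue_measure R \x mu n) (@rV_cons R n)]_x `|(g x)%:E|)%E)//.
  rewrite ge0_integral_pushforward//; first exact: measurable_rV_cons.
  by apply: measurableT_comp => //; exact/measurable_EFinP.
rewrite [LHS](_ : _ = (\int[pushforward (@lebesgue_measure R \x mu n) (@rV_cons R n)]_x (g x)%:E)%E)//.
rewrite integral_pushforward//; last 2 first.
- exact: measurable_rV_cons.
- exact/measurable_EFinP.
rewrite preimage_setT.
case: (unliftP ord0 i) => [j|] iE; subst i.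
  apply: etrans (esym (integral12_prod_meas1 gcint)) _.
  apply: integral0_eq => x _.
  apply: (IHn j (fun v => G (rV_cons (x, v))) (fun v => g (rV_cons (x, v)))).
  - by apply: (measurableT_comp mgc); exact: measurable_fun_pair.
  - by move=> v; exact: gC.
  - by move=> v l Ml; apply: (G0 _ (lift ord0 l)); rewrite rV_consS.
  - by move=> v l Ml; apply: (g0 _ (lift ord0 l)); rewrite rV_consS.
  - by move=> v; under eq_fun do rewrite -rV_cons_lineS; exact: dG.
  - by move=> v; under eq_fun do rewrite -rV_cons_lineS; exact: cg.
apply: etrans (esym (integral21_prod_meas1 gcint)) _.
apply: integral0_eq => v _; rewrite /fubini_G/=.
(* K exceeds M strictly, so G vanishes at both endpoints - K and K. *)
pose K := `|M| + 1.
have MK : M < K by rewrite /K; have := ler_norm M; lra.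
have K0 : 0 < K by rewrite /K; have := normr_ge0 M; lra.
have NK x : x \notin `[(- K), K] -> M < `|x|.
  by rewrite in_itv/= -ler_norml -ltNge => /(lt_trans MK).
rewrite (_ : (fun x : R => (g (rV_cons (x, v)))%:E) =
    (fun x => (g (rV_cons (x, v)))%:E) \_ `[(- K), K]%classic); last first.
  apply/funext => x; rewrite patchE; case: ifPn => //.
  rewrite notin_setE/= => /negP /NK Mx.
  by rewrite (g0 _ ord0)// rV_cons0.
rewrite -integral_mkcond.
have cgv : continuous (fun x : R => g (rV_cons (x, v))).
  move=> x; have := cg (rV_cons (0, v)).
  by under eq_fun do rewrite rV_cons_line0 add0r; exact.
have dGv x : is_derive (x : R) 1 (fun x => G (rV_cons (x, v))) (g (rV_cons (x, v))).
  apply/is_derive_lineP; have := dG (rV_cons (x, v)).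
  by under eq_fun do rewrite rV_cons_line0 -[X in x + X](mulr1).
rewrite (@continuous_FTC2 _ _ (fun x => G (rV_cons (x, v)))).
- rewrite (G0 _ ord0); last by rewrite rV_cons0 gtr0_norm.
  by rewrite (G0 _ ord0) ?subee// rV_cons0 normrN gtr0_norm.
- lra.
- exact: continuous_subspaceT.
- have cG : continuous (fun x : R => G (rV_cons (x, v))).
    move=> x; apply: differentiable_continuous; apply/derivable1_diffP.
    by have [] := dGv x.
  split.
  + by move=> x _; have [] := dGv x.
  + exact: cvg_at_right_filter (cG _).
  + exact: cvg_at_left_filter (cG _).
- by move=> x _; rewrite derive1E; have [_ ->] := dGv x.
Qed.

End integral_derivative.

(** * Real-valued integrals: linearity, dominated convergence, Fatou *)

Section real_integrals.
Context d (T : measurableType d) (R : realType).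
Variables (mu : {measure set T -> \bar R}) (D : set T).
Hypothesis mD : measurable D.
Implicit Types f g h : T -> R.

(** The real integral is [fine] of the extended one, hence 0 when the latter is infinite; statements
    about integrals are therefore accompanied by integrability. *)
Definition summable_on f := mu.-integrable D (EFin \o f).
Local Notation I f := (\int[mu]_(x in D) f x).

Lemma summable_measurable f : summable_on f -> measurable_fun D f.
Proof. by move=> /integrableP[/measurable_EFinP]. Qed.

Lemma eq_summable f g : (forall x, D x -> f x = g x) -> summable_on f -> summable_on g.
Proof.
by move=> fg; apply: eq_integrable => // x; rewrite inE => Dx /=; rewrite fg.
Qed.

Lemma eq_int f g : (forall x, D x -> f x = g x) -> I f = I g.
Proof. by move=> fg; apply: eq_Rintegral => x; rewrite inE; exact: fg. Qed.

Lemma summable_le f g : measurable_fun D f ->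
  (forall x, D x -> `|f x| <= g x) -> summable_on g -> summable_on f.
Proof.
move=> mf fg; apply: le_integrable => //; first exact/measurable_EFinP.
move=> x Dx /=; rewrite lee_fin (le_trans (fg _ Dx))//; exact: ler_norm.
Qed.

Lemma summableD f g : summable_on f -> summable_on g ->
  summable_on (fun x => f x + g x).
Proof. exact: integrableD. Qed.

Lemma summableZ (a : R) f : summable_on f -> summable_on (fun x => a * f x).
Proof. exact: integrableZl. Qed.

Lemma summableB f g : summable_on f -> summable_on g ->
  summable_on (fun x => f x - g x).
Proof. exact: integrableB. Qed.

Lemma summable_sum n (f : 'I_n -> T -> R) : (forall i, summable_on (f i)) ->
  summable_on (fun x => \sum_(i < n) f i x).
Proof.
move=> sf; rewrite /summable_on.
rewrite (_ : _ \o _ = fun x => (\sum_(i < n) (EFin \o f i) x)%E).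
  by apply: integrable_sum => // i _; exact: sf.
by apply/funext => x /=; rewrite sumEFin.
Qed.

Lemma summable0 : summable_on (fun=> 0).
Proof. exact: integrable0. Qed.

Lemma EFin_int f : summable_on f -> (I f)%:E = (\int[mu]_(x in D) (f x)%:E)%E.
Proof. by move=> sf; rewrite /Rintegral fineK//; exact: integrable_fin_num. Qed.

Lemma intD f g : summable_on f -> summable_on g ->
  I (fun x => f x + g x) = I f + I g.
Proof. exact: RintegralD. Qed.

Lemma intB f g : summable_on f -> summable_on g ->
  I (fun x => f x - g x) = I f - I g.
Proof. exact: RintegralB. Qed.

Lemma intZ a f : summable_on f -> I (fun x => a * f x) = a * I f.
Proof. by move=> sf; exact: RintegralZl. Qed.

Lemma int_sum n (f : 'I_n -> T -> R) : (forall i, summable_on (f i)) ->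
  I (fun x => \sum_(i < n) f i x) = \sum_(i < n) I (f i).
Proof.
move=> sf; apply: EFin_inj; rewrite EFin_int; last exact: summable_sum.
rewrite -sumEFin; under [RHS]eq_bigr do rewrite EFin_int//.
rewrite -(@integral_sum _ _ _ mu _ mD _ (fun i => EFin \o f i) sf).
by apply: eq_integral => x _; rewrite sumEFin.
Qed.

Lemma le_int f g : summable_on f -> summable_on g ->
  (forall x, D x -> f x <= g x) -> I f <= I g.
Proof. exact: le_Rintegral. Qed.

Lemma int_ge0 f : (forall x, D x -> 0 <= f x) -> 0 <= I f.
Proof. exact: Rintegral_ge0. Qed.

Lemma summable_ge0 f : measurable_fun D f -> (forall x, D x -> 0 <= f x) ->
  (\int[mu]_(x in D) (f x)%:E < +oo)%E -> summable_on f.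
Proof.
move=> mf f0 foo; apply/integrableP; split; first exact/measurable_EFinP.
rewrite (eq_integral (EFin \o f))// => x; rewrite inE => Dx /=.
by rewrite ger0_norm ?f0.
Qed.

Lemma dominated_int (f_ : nat -> T -> R) f g :
  (forall n, measurable_fun D (f_ n)) ->
  (forall x, D x -> f_ n x @[n --> \oo] --> f x) ->
  summable_on g -> (forall n x, D x -> `|f_ n x| <= g x) ->
  summable_on f /\ I (f_ n) @[n --> \oo] --> I f.
Proof.
move=> mf_ ff sg fg; have mf := measurable_fun_cvg mf_ ff.
have sf_ n : summable_on (f_ n) by apply: summable_le sg => //; exact: fg.
have [||||| sf _ cv] := @dominated_convergence _ _ _ mu _ mD
    (fun n => EFin \o f_ n) (EFin \o f) (EFin \o g).
- by move=> n; exact/measurable_EFinP.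
- exact/measurable_EFinP.
- by apply/aeW => x Dx; apply: cvg_EFin; [near=> n|exact: ff].
- exact: sg.
- by apply/aeW => x n Dx; rewrite /= lee_fin fg.
split => //; apply: fine_cvg; rewrite -/(Rintegral _ _ _) EFin_int//.
Unshelve. all: by end_near. Qed.

(** Fatou's lemma in the form used to remove a regularization when no dominating function is at
    hand: a uniform bound yields the integrability of the limit as well. *)
Lemma fatou_int (f_ : nat -> T -> R) f (B : R) :
  (forall n, summable_on (f_ n)) ->
  (forall x, D x -> f_ n x @[n --> \oo] --> f x) ->
  (forall n x, D x -> 0 <= f_ n x) -> (forall n, I (f_ n) <= B) ->
  summable_on f /\ I f <= B.
Proof.
move=> sf_ ff f0 fB.
have mf := measurable_fun_cvg (fun n => summable_measurable (sf_ n)) ff.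
have f0' x : D x -> 0 <= f x.
  move=> Dx; have := ff x Dx; move=> /[dup] /cvgP cf /cvg_lim <- //.
  by apply: limr_ge => //; near=> n; exact: f0.
have H : (\int[mu]_(x in D) (f x)%:E <= B%:E)%E.
  have mEf n : measurable_fun D (EFin \o f_ n).
    exact/measurable_EFinP/summable_measurable.
  have f0E n x : D x -> (0 <= (EFin \o f_ n) x)%E by move=> Dx; rewrite lee_fin f0.
  have := fatou mu mD mEf f0E; move=> /le_trans H.
  rewrite (eq_integral (fun x => limn_einf (fun n => (f_ n x)%:E))); last first.
    move=> x; rewrite inE => Dx; apply/esym.
    by apply: (cvg_limn_einf_sup _).1; apply: cvg_EFin; [near=> n|exact: ff].
  apply: H.
  rewrite limn_einf_lim; apply: lime_le; first exact: is_cvg_einfs.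
  near=> n; apply: (@le_trans _ _ (\int[mu]_(x in D) (f_ n x)%:E)%E).
    by apply: ereal_inf_lbound; exists n => /=.
  by rewrite -EFin_int// lee_fin fB.
have sf : summable_on f by apply: summable_ge0 => //; exact: le_lt_trans H (ltry _).
by split => //; rewrite -lee_fin EFin_int.
Unshelve. all: by end_near. Qed.

End real_integrals.

(** * Partial derivatives, and integrals of derivatives with compact support *)

Section calculus.
Variables (R : realType) (N : nat).
Implicit Types (f g : 'rV[R]_N -> R) (x : 'rV[R]_N) (Om K : set 'rV[R]_N) (i j : 'I_N).
Local Notation "''e_' i" := (delta_mx ord0 i : 'rV[R]_N) (at level 8, format "''e_' i").

Lemma continuous_coord j : continuous (fun x : 'rV[R]_N => x ord0 j).
Proof. by move=> x; exact: coord_continuous. Qed.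

Lemma is_derive_coord x i j : is_derive x 'e_i (fun y : 'rV[R]_N => y ord0 j) (i == j)%:R.
Proof.
apply/is_derive_lineP.
rewrite (_ : (fun _ => _) = (cst (x ord0 j) + id * cst (i == j)%:R : R -> R)).
  apply: is_derive_eq.
  by rewrite add0r scaler0 add0r [_ *: 1]mulr1.
by apply/funext => t; rewrite !mxE eqxx/= eq_sym.
Qed.

Lemma is_derive_comp_line x v f (F : R -> R) d d' :
  is_derive x v f d -> is_derive (f x) 1 F d' -> is_derive x v (F \o f) (d' * d).
Proof.
move=> /is_derive_lineP df dF; apply/is_derive_lineP.
apply: (@is_derive1_comp _ F (fun t : R => f (x + t *: v))) => //.
by rewrite scale0r addr0.
Qed.

(* [df] is a continuous derivative of [f] along the [i]-th axis on [Om]. *)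
Definition C1_along Om i f df := forall x, Om x ->
  [/\ {for x, continuous f}, is_derive x 'e_i f (df x) & {for x, continuous df}].

Lemma C1_along_cst Om i (c : R) : C1_along Om i (fun=> c) (fun=> 0).
Proof. by move=> x _; split; [exact: cst_continuous|exact: is_derive_cst|exact: cst_continuous]. Qed.

Lemma C1_along_coord Om i j : C1_along Om i (fun x => x ord0 j) (fun=> (i == j)%:R).
Proof.
move=> x _; split; [exact: continuous_coord| exact: is_derive_coord|exact: cst_continuous].
Qed.

Lemma C1_along_add Om i f df g dg : C1_along Om i f df -> C1_along Om i g dg ->
  C1_along Om i (fun x => f x + g x) (fun x => df x + dg x).
Proof.
move=> F G x Ox; have [cf df' cdf] := F x Ox; have [cg dg' cdg] := G x Ox.
by split; [exact: continuousD|exact: (is_deriveD (f := f) (g := g))|exact: continuousD].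
Qed.

Lemma C1_along_mul Om i f df g dg : C1_along Om i f df -> C1_along Om i g dg ->
  C1_along Om i (fun x => f x * g x) (fun x => df x * g x + f x * dg x).
Proof.
move=> F G x Ox; have [cf df' cdf] := F x Ox; have [cg dg' cdg] := G x Ox.
split; first exact: continuousM.
- have := @is_deriveM _ _ f g x 'e_i _ _ df' dg'; rewrite (_ : _ + _ = df x * g x + f x * dg x)//.
  by rewrite addrC [_ *: _]mulrC.
- by apply: continuousD; exact: continuousM.
Qed.

Lemma C1_along_comp Om i f df (F F' : R -> R) : C1_along Om i f df ->
  (forall x, Om x -> is_derive (f x) 1 F (F' (f x)) /\ {for f x, continuous F'}) ->
  C1_along Om i (fun x => F (f x)) (fun x => F' (f x) * df x).
Proof.
move=> f1 F1 x Ox; have [cf df' cdf] := f1 x Ox; have [dF cF'] := F1 x Ox.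
split.
- apply: continuous_comp => //; apply: differentiable_continuous.
  by apply/derivable1_diffP; case: dF.
- exact: is_derive_comp_line.
- by apply: continuousM => //; apply: continuous_comp.
Qed.

Lemma C1_along_inv Om i f df : C1_along Om i f df -> (forall x, Om x -> f x != 0) ->
  C1_along Om i (fun x => (f x)^-1) (fun x => - (f x ^+ 2)^-1 * df x).
Proof.
move=> f1 f0; apply: (@C1_along_comp _ _ _ _ _ (fun y : R => - (y ^+ 2)^-1)) => // x /f0 fx0.
split.
  apply: is_derive_eq; first exact: (@is_deriveV R id).
  by rewrite [_ *: _]mulr1.
apply: continuousN; apply: continuousV; first by rewrite expf_neq0.
exact: exprn_continuous.
Qed.

Lemma C1_along_sum Om i (J : Type) (r : seq J) (f df : J -> 'rV[R]_N -> R) :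
  (forall k, C1_along Om i (f k) (df k)) ->
  C1_along Om i (fun x => \sum_(k <- r) f k x) (fun x => \sum_(k <- r) df k x).
Proof.
move=> f1; elim: r => [|k r IH].
  by have := @C1_along_cst Om i 0; congr C1_along; apply/funext => x; rewrite big_nil.
by have := C1_along_add (f1 k) IH; congr C1_along; apply/funext => x; rewrite big_cons.
Qed.

Definition sqn x := \sum_(i < N) x ord0 i ^+ 2.

Lemma sqn_ge0 x : 0 <= sqn x.
Proof. by apply: sumr_ge0 => i _; exact: sqr_ge0. Qed.

Lemma enorm_sq x : enorm x ^+ 2 = sqn x.
Proof. by rewrite sqr_sqrtr ?sqn_ge0. Qed.

Lemma sqn_eq0 x : (sqn x == 0) = (x == 0).
Proof.
apply/eqP/eqP => [|->]; last by rewrite /sqn big1// => i _; rewrite mxE expr0n.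
move=> /psumr_eq0P H; apply/rowP => i; rewrite mxE; apply/eqP.
by rewrite -sqrf_eq0 H// => j _; exact: sqr_ge0.
Qed.

Lemma sqn_gt0 x : (0 < sqn x) = (x != 0).
Proof. by rewrite lt_neqAle sqn_ge0 andbT eq_sym sqn_eq0. Qed.

Lemma C1_along_sqn Om i : C1_along Om i sqn (fun x => 2 * x ord0 i).
Proof.
have := @C1_along_sum Om i _ (index_enum 'I_N) (fun j x => x ord0 j * x ord0 j)
  (fun j x => (i == j)%:R * x ord0 j + x ord0 j * (i == j)%:R)
  (fun j => C1_along_mul (@C1_along_coord _ _ _) (@C1_along_coord _ _ _)).
congr C1_along; apply/funext => x.
rewrite (bigD1 i)//= eqxx big1 ?addr0 ?mul1r ?mulr1 ?mulr2n ?mulrDl ?mul1r// => j /negbTE.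
by rewrite eq_sym => ->; rewrite mul0r mulr0 addr0.
Qed.

Lemma continuous_sqn : continuous sqn.
Proof.
rewrite /sqn; elim: (index_enum _) => [|j r IH].
  by under eq_fun do rewrite big_nil; exact: cst_continuous.
under eq_fun do rewrite big_cons.
move=> x; apply: (@continuousD _ _ _ (fun x : 'rV[R]_N => x ord0 j ^+ 2)); last exact: IH.
by apply: (@continuous_comp _ _ _ (fun x : 'rV[R]_N => x ord0 j) (fun y : R => y ^+ 2));
  [exact: continuous_coord|exact: exprn_continuous].
Qed.

Section compact_support.
Variables (Om K : set 'rV[R]_N).
Hypotheses (cK : compact K) (KOm : K `<=` Om).

Lemma near_off x : ~ K x -> \forall y \near x, ~ K y.
Proof.
move=> Kx; have : open (~` K).
  by apply: closed_openC; apply: compact_closed => //; exact: norm_hausdorff.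
by move=> oK; exact: open_nbhs_nbhs.
Qed.

(** The drift is singular on the faces of the orthant, so continuity is known on Om only; outside K
    the function is locally 0, and Om together with the complement of K is the whole space. *)
Lemma continuous_off f : (forall x, Om x -> {for x, continuous f}) ->
  (forall x, ~ K x -> f x = 0) -> continuous f.
Proof.
move=> cf f0 x; have [/KOm/cf//|Kx] := pselect (K x).
rewrite /continuous_at f0//; apply: cvg_near_cst; first exact: (nbhs_filter x).
by apply: filterS (near_off Kx) => y /f0 ->.
Qed.

Lemma compact_support_bounded f : continuous f -> (forall x, ~ K x -> f x = 0) ->
  exists2 C, 0 <= C & forall x, `|f x| <= C.
Proof.
move=> cf f0.
have /compact_bounded [M [_ MP]] := continuous_compact (continuous_subspaceT cf) cK.
exists (`|M| + 1); first by rewrite addr_ge0.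
move=> x; have [Kx|Kx] := pselect (K x); last by rewrite f0// normr0 addr_ge0.
by apply: (MP (`|M| + 1)); [rewrite (le_lt_trans (ler_norm _))// ltrDl|exists x].
Qed.

Lemma compact_in_cube : exists M : R, forall x i, M < `|x ord0 i| -> ~ K x.
Proof.
have /compact_bounded [M [_ MP]] := cK.
exists (`|M| + 1) => x i Mx Kx.
have : `|x| <= `|M| + 1 by apply: MP Kx; rewrite (le_lt_trans (ler_norm _))// ltrDl.
apply/negP; rewrite -ltNge; apply: (lt_le_trans Mx).
rewrite [leRHS]mx_normrE; exact: (le_bigmax _ (fun k : 'I_1 * 'I_N => `|x k.1 k.2|) (ord0, i)).
Qed.

Lemma integrable_compact_support f : continuous f -> (forall x, ~ K x -> f x = 0) ->
  (lebesgue_rV R N).-integrable setT (EFin \o f).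
Proof.
move=> cf f0; have [C _ fC] := compact_support_bounded cf f0.
have [M MP] := compact_in_cube.
apply: (integrable_bounded_support (M := M) _ fC); first exact: continuous_measurable_rV.
by move=> x i /MP/f0.
Qed.

Lemma integral_derivative0 i f df : C1_along Om i f df ->
  (forall x, ~ K x -> f x = 0) -> (forall x, ~ K x -> df x = 0) ->
  (\int[lebesgue_rV R N]_x (df x)%:E = 0)%E.
Proof.
move=> f1 f0 df0.
have cdf : continuous df by apply: continuous_off => // x /f1[].
have [C _ fC] := compact_support_bounded cdf df0.
have [M MP] := compact_in_cube.
apply: (@integral_line_derivative R N i f df M C) => //.
- exact: continuous_measurable_rV.
- by move=> x j /MP/f0.
- by move=> x j /MP/df0.
- move=> x; apply/is_derive_lineP.
  have [/KOm/f1[]//|Kx] := pselect (K x); rewrite df0//.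
  apply: (@near_eq_is_derive _ _ _ (cst 0)).
  by apply: filterS (near_off Kx) => y /f0 ->.
- move=> x t.
  apply: (@continuous_comp _ _ _ (fun t : R => x + t *: 'e_i)); last exact: cdf.
  apply: continuousD; first exact: cst_continuous.
  exact: scalel_continuous.
Qed.

End compact_support.
End calculus.

(** * The orthant without the origin *)

Section orthant.
Variables (R : realType) (N k : nat).
Hypotheses (hN : (2 <= N)%N) (hk : (k <= N)%N).
Implicit Types (u f g : 'rV[R]_N -> R) (x : 'rV[R]_N) (i j : 'I_N).
Local Notation "''e_' i" := (delta_mx ord0 i : 'rV[R]_N) (at level 8, format "''e_' i").
Local Notation mu := (lebesgue_rV R N).
Local Notation Om := (@orthant R N k).

Lemma measurable_orthant : measurable Om.
Proof.
have := @measurable_rV_rect R N (fun i => if (N - k <= i)%N then `]0, +oo[%classic else setT).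
rewrite (_ : [set x | _] = Om).
  by apply => i; case: ifP => _.
apply/seteqP; split => x H i.
  by move=> Ni; have := H i; rewrite Ni set_itvE.
by case: ifP => // /H; rewrite set_itvE.
Qed.

Lemma rV_set0E : [set 0 : 'rV[R]_N] = [set x : 'rV[R]_N | forall i, [set 0 : R] (x ord0 i)].
Proof.
by apply/seteqP; split => x /= => [-> i|H]; [rewrite mxE|apply/rowP => i; rewrite H mxE].
Qed.

Lemma measurable_rV_set0 : measurable [set 0 : 'rV[R]_N].
Proof.
by rewrite rV_set0E; apply: (@measurable_rV_rect R N (fun=> [set 0])) => i; exact: measurable_set1.
Qed.

Lemma lebesgue_rV_set0 : mu [set 0] = 0%E.
Proof.
rewrite rV_set0E; apply: etrans (@lebesgue_rV_box R N (fun=> [set 0]) _) _.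
  by move=> i; exact: measurable_set1.
by rewrite (bigD1 (Ordinal (ltnW hN)))//= lebesgue_measure_set1 mul0e.
Qed.

(* The origin is a null set; removing it makes 1/|x|^2 meaningful pointwise. *)
Definition punctured : set 'rV[R]_N := Om `\` [set 0].

Lemma measurable_punctured : measurable punctured.
Proof. by apply: measurableD; [exact: measurable_orthant|exact: measurable_rV_set0]. Qed.

Lemma integral_orthant f : measurable_fun Om f ->
  (\int[mu]_(x in Om) (f x)%:E = \int[mu]_(x in punctured) (f x)%:E)%E.
Proof.
move=> mf; rewrite [RHS]integral_mkcond [LHS]integral_mkcond.
apply: ae_eq_integral => //.
- by apply/(measurable_restrictT _ _).1 => //; [exact: measurable_orthant|exact/measurable_EFinP].
- apply/(measurable_restrictT _ _).1 => //; first exact: measurable_punctured.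
  by apply/measurable_EFinP; apply: measurable_funS mf => //; [exact: measurable_orthant|exact: subIsetl].
- exists [set 0]; split; [exact: measurable_rV_set0|exact: lebesgue_rV_set0|].
  move=> x /= /not_implyP[_]; apply: contra_notP => x0.
  by rewrite !patchE /punctured in_setD (@memNset _ [set 0] x x0) andbT.
Qed.

Lemma integral_setT_punctured f : measurable_fun setT f ->
  (forall x, ~ Om x -> f x = 0) ->
  (\int[mu]_x (f x)%:E = \int[mu]_(x in punctured) (f x)%:E)%E.
Proof.
move=> mf f0; rewrite -integral_orthant; last exact: measurable_funTS.
rewrite [RHS]integral_mkcond; apply: eq_integral => x _.
rewrite patchE; case: ifPn => //; rewrite notin_setE => /f0 ->//.
Qed.

Local Notation sm := (summable_on mu punctured).
Local Notation I f := (\int[mu]_(x in punctured) f x).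

Section support.
Variable (K : set 'rV[R]_N).
Hypotheses (cK : compact K) (KOm : K `<=` Om).

Lemma summable_compact_support f : (forall x, Om x -> {for x, continuous f}) ->
  (forall x, ~ K x -> f x = 0) -> sm f.
Proof.
move=> cf f0; apply: (@integrableS _ _ _ _ setT) => //; first exact: measurable_punctured.
by apply: (integrable_compact_support cK) => //; exact: continuous_off cK KOm _ cf f0.
Qed.

Lemma int_derivative0 i f df : C1_along Om i f df ->
  (forall x, ~ K x -> f x = 0) -> (forall x, ~ K x -> df x = 0) ->
  I df = 0.
Proof.
move=> f1 f0 df0; have cdf : continuous df by apply: continuous_off cK KOm _ _ df0 => x /f1[].
have := integral_derivative0 cK KOm f1 f0 df0.
rewrite integral_setT_punctured; first by rewrite /Rintegral => ->.
- exact: continuous_measurable_rV.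
- by move=> x Ox; apply: df0; apply: contra_not Ox; exact: KOm.
Qed.

Lemma partial_off f x i : (forall x, ~ K x -> f x = 0) -> ~ K x -> partial i f x = 0.
Proof.
move=> f0 Kx; have d0 := is_derive_cst (0 : R) x 'e_i.
have : is_derive x 'e_i f 0.
  apply: (near_eq_is_derive _ d0).
  by apply: filterS (near_off cK Kx) => y /f0 ->.
by move=> /@derive_val.
Qed.

End support.

(** The class in which the integrations by parts take place. K is any compact set outside which u
    vanishes, not the exact support, so that a difference of two members belongs to the class with
    the union of their sets. *)
Definition C1_compact K u := [/\ compact K, K `<=` Om, forall x, ~ K x -> u x = 0 &
  forall i, C1_along setT i u (partial i u)].

Lemma test_C1_compact u : test_fun Om u -> C1_compact (closure [set x | u x != 0]) u.
Proof.
move=> [su cu uOm]; split => //.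
  move=> x /(contra_not (@subset_closure _ _ x)) /= /negP.
  by rewrite negbK => /eqP.
move=> i x _; split; first exact: (su [::]).1.
- by apply: DeriveDef; [exact: (su [::]).2|].
- exact: (su [:: i]).1.
Qed.

End orthant.

Section continuity.
Variables (R : realType) (T : topologicalType) (Om : set T).
Implicit Types f g : T -> R.

Definition cont_on f := forall x, Om x -> {for x, continuous f}.

Lemma cont_on_cst (c : R) : cont_on (fun=> c).
Proof. by move=> x _; exact: cst_continuous. Qed.

Lemma cont_onD f g : cont_on f -> cont_on g -> cont_on (fun x => f x + g x).
Proof. by move=> cf cg x Ox; apply: continuousD; [exact: cf|exact: cg]. Qed.

Lemma cont_onM f g : cont_on f -> cont_on g -> cont_on (fun x => f x * g x).
Proof. by move=> cf cg x Ox; apply: continuousM; [exact: cf|exact: cg]. Qed.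

Lemma cont_onN f : cont_on f -> cont_on (fun x => - f x).
Proof. by move=> cf x Ox; apply: continuousN; exact: cf. Qed.

Lemma cont_onX f n : cont_on f -> cont_on (fun x => f x ^+ n).
Proof.
move=> cf; elim: n => [|n IH]; first exact: cont_on_cst.
by under eq_fun do rewrite exprS; exact: cont_onM.
Qed.

Lemma cont_onV f : cont_on f -> (forall x, Om x -> f x != 0) -> cont_on (fun x => (f x)^-1).
Proof. by move=> cf f0 x Ox; apply: continuousV; [exact: f0|exact: cf]. Qed.

Lemma cont_on_sum (J : Type) (r : seq J) (f : J -> T -> R) :
  (forall j, cont_on (f j)) -> cont_on (fun x => \sum_(j <- r) f j x).
Proof.
move=> cf; elim: r => [|j r IH].
  by under eq_fun do rewrite big_nil; exact: cont_on_cst.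
by under eq_fun do rewrite big_cons; exact: cont_onD.
Qed.

End continuity.

Section continuity_rV.
Variables (R : realType) (N : nat) (Om : set 'rV[R]_N).

Lemma cont_on_coord i : cont_on Om (fun x => x ord0 i).
Proof. by move=> x _; exact: continuous_coord. Qed.

Lemma cont_on_sqn : cont_on Om (@sqn R N).
Proof. by move=> x _; exact: continuous_sqn. Qed.

End continuity_rV.

(** * Ground state representation *)

Section ground_state.
Variables (R : realType) (N k : nat).
Hypotheses (hN : (2 <= N)%N) (hk : (k <= N)%N).
Implicit Types (u f g : 'rV[R]_N -> R) (x : 'rV[R]_N) (i j : 'I_N) (a e : R).
Local Notation mu := (lebesgue_rV R N).
Local Notation Om := (@orthant R N k).
Local Notation D := (@punctured R N k).
Local Notation sm := (summable_on mu D).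
Local Notation I f := (\int[mu]_(x in D) f x).

(** A weight 0 or 1 which lets one formula for the drift serve all coordinates: the term in 1 / x_i
    is present only where x_i > 0 on the orthant. *)
Definition edge i : R := (N - k <= i)%N%:R.

Lemma sum_edge : \sum_(i < N) edge i = k%:R.
Proof.
rewrite -natr_sum; congr (_%:R).
rewrite -(big_mkord xpredT (fun n : nat => (N - k <= n)%N : nat)).
rewrite (@big_cat_nat _ _ _ (N - k)) ?leq_subr//= big_nat_cond big1; last first.
  by move=> i; rewrite andbT => /andP[_]; rewrite ltnNge => /negbTE ->.
rewrite add0n big_nat_cond (eq_bigr (fun=> 1%N)).
  by rewrite -big_nat_cond sum_nat_const_nat muln1 subKn.
by move=> i /andP[/andP[-> _] _].
Qed.

(* The logarithmic gradient of [alpha], with |x|^2 replaced by |x|^2 + e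
   and with a free exponent [a] of |x| *)
Definition drift a e i x : R :=
  - (4^-1 * x ord0 i) + a * (x ord0 i * (sqn x + e)^-1) + edge i * (x ord0 i)^-1.

Definition ddrift a e i x : R :=
  - 4^-1 + a * ((sqn x + e)^-1 - 2 * x ord0 i ^+ 2 * (sqn x + e)^-1 ^+ 2)
  - edge i * (x ord0 i)^-1 ^+ 2.

(* The divergence of [drift a e] plus its squared norm, see [drift_potential]. *)
Definition potential a e x : R :=
  sqn x / 16 - N%:R / 4 - k%:R / 2 + a * (N%:R + 2 * k%:R) * (sqn x + e)^-1
  + (a ^+ 2 - 2 * a) * (sqn x * (sqn x + e)^-1 ^+ 2)
  - a / 2 * (sqn x * (sqn x + e)^-1).

Lemma edge_neq0 x i : Om x -> edge i != 0 -> x ord0 i != 0.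
Proof.
move=> Ox; rewrite /edge; case: leqP => [h _|]; last by rewrite eqxx.
by rewrite gt_eqF//; exact: Ox.
Qed.

(** Since [edge i] is its own square, the square of [edge i / x_i] in [drift ^+ 2] cancels the last
    term of [ddrift], and the cross terms with 1 / x_i are no longer singular. What remains is
    affine in x_i^2 and [edge i], whose sums are |x|^2 and k. *)
Lemma drift_potential a e x : Om x -> sqn x + e != 0 ->
  \sum_(i < N) (ddrift a e i x + drift a e i x ^+ 2) = potential a e x.
Proof.
move=> Ox e0; set q := (sqn x + e)^-1.
have E i : ddrift a e i x + drift a e i x ^+ 2 =
    (- 4^-1 + a * q) + (- 2 * a * q ^+ 2 + 16^-1 + a ^+ 2 * q ^+ 2 - a / 2 * q) * x ord0 i ^+ 2
    + (- 2^-1 + 2 * a * q) * edge i.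
  rewrite /ddrift /drift -/q.
  have := @edge_neq0 x i Ox; rewrite /edge; case: leqP => [h /(_ (oner_neq0 _)) xi|_ _].
    by rewrite -[(nat_of_bool true)%:R]/(1 : R); field; rewrite ?xi//.
  by rewrite -[(nat_of_bool false)%:R]/(0 : R) !mul0r; field.
under eq_bigr do rewrite E.
rewrite !big_split/= -!mulr_sumr sum_edge -/(sqn x) !sumr_const !card_ord.
rewrite /potential -/q -(mulr_natr (- _) N) -(mulr_natr q N).
move: (N%:R : R) (k%:R : R) (sqn x) q {E e0} => n l s q; by field.
Qed.

Lemma C1_along_drift a e i : 0 < e -> C1_along Om i (drift a e i) (ddrift a e i).
Proof.
move=> e0.
have se0 x : sqn x + e != 0 by rewrite gt_eqF// ltr_wpDl// sqn_ge0.
have h1 := @C1_along_coord R N Om i i.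
have h2 := C1_along_inv (C1_along_add (@C1_along_sqn R N Om i) (@C1_along_cst R N Om i e)) (fun x _ => se0 x).
have h3 := C1_along_mul (@C1_along_cst R N Om i a) (C1_along_mul h1 h2).
have h4 := C1_along_add (C1_along_mul (@C1_along_cst R N Om i (- 4^-1)) h1) h3.
have h5 : C1_along Om i (fun x => edge i * (x ord0 i)^-1) (fun x => - (edge i * (x ord0 i)^-1 ^+ 2)).
  have [h|h] := eqVneq (edge i) 0.
    have := @C1_along_cst R N Om i 0.
    by congr C1_along; apply/funext => x; rewrite h mul0r ?oppr0.
  have := C1_along_mul (@C1_along_cst R N Om i (edge i)) (C1_along_inv h1 (fun x Ox => edge_neq0 Ox h)).
  by congr C1_along; apply/funext => x; rewrite eqxx mul0r add0r mulr1 mulrN exprVn.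
have := C1_along_add h4 h5; congr C1_along; apply/funext => x.
  by rewrite /drift mulNr.
rewrite /ddrift eqxx /=; set q := _^-1.
rewrite -exprVn -/q; ring.
Qed.

(** |grad u - F u|^2. For e = 0 and the exponent of alpha this is alpha^2 |grad (u / alpha)|^2 on
    the orthant without the origin. *)
Definition twist_sq a e u x := \sum_(i < N) (partial i u x - drift a e i x * u x) ^+ 2.

Lemma cont_on_partial K u i : C1_compact k K u -> cont_on Om (partial i u).
Proof. by move=> [_ _ _ h] x Ox; have [] := h i x Logic.I. Qed.

Lemma cont_on_C1_compact K u : C1_compact k K u -> cont_on Om u.
Proof. by move=> [_ _ _ h] x Ox; have [] := h (Ordinal (ltnW hN)) x Logic.I. Qed.

Lemma C1_compact_partial_off K u x i : C1_compact k K u -> ~ K x -> partial i u x = 0.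
Proof. by move=> [cK _ u0 _]; exact: (partial_off cK). Qed.

Lemma grad_sq_summable K u : C1_compact k K u -> sm (grad_sq u).
Proof.
move=> hu; have [cK KO u0 _] := hu.
apply: (summable_compact_support cK KO).
  by apply: cont_on_sum => i; apply: cont_onX; exact: cont_on_partial hu.
by move=> x Kx; rewrite /grad_sq big1// => i _; rewrite (C1_compact_partial_off _ hu)// expr0n.
Qed.

Lemma summable_mulsq K u g : C1_compact k K u -> cont_on Om g -> sm (fun x => g x * u x ^+ 2).
Proof.
move=> hu cg; have [cK KO u0 _] := hu.
apply: (summable_compact_support cK KO).
  by apply: cont_onM => //; apply: cont_onX; exact: cont_on_C1_compact hu.
by move=> x Kx; rewrite u0// expr0n mulr0.
Qed.

Lemma cont_on_potential a e : 0 < e -> cont_on Om (potential a e).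
Proof.
move=> e0.
have cq : cont_on Om (fun x => (sqn x + e)^-1).
  apply: cont_onV; first by apply: cont_onD; [exact: cont_on_sqn|exact: cont_on_cst].
  by move=> x _; rewrite gt_eqF// ltr_wpDl// sqn_ge0.
have cs := @cont_on_sqn R N Om.
have cc := @cont_on_cst R _ Om.
exact: (cont_onD (cont_onD (cont_onD (cont_onD (cont_onD (cont_onM cs (cc 16^-1)) (cc (- (N%:R / 4))))
  (cc (- (k%:R / 2)))) (cont_onM (cc (a * (N%:R + 2 * k%:R))) cq)) (cont_onM (cc (a ^+ 2 - 2 * a)) (cont_onM cs (cont_onX (n := 2) cq))))
  (cont_onN (cont_onM (cc (a / 2)) (cont_onM cs cq)))).
Qed.

Lemma regularized_ground_state a e K u : 0 < e -> C1_compact k K u ->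
  sm (twist_sq a e u) /\
  I (twist_sq a e u) = I (fun x => grad_sq u x + potential a e x * u x ^+ 2).
Proof.
move=> e0 hu; have [cK KO u0 u1] := hu.
have uOm i : C1_along Om i u (partial i u) by move=> x _; exact: u1.
(* The field F u^2: as e > 0 it is C^1 on all of Om, even at the origin, and has compact support, so
   its divergence, the sum of the dG i, integrates to 0. *)
pose G i x := drift a e i x * (u x * u x).
pose dG i x := ddrift a e i x * (u x * u x) +
   drift a e i x * (partial i u x * u x + u x * partial i u x).
have G1 i : C1_along Om i (G i) (dG i).
  exact: (C1_along_mul (C1_along_drift a i e0) (C1_along_mul (uOm i) (uOm i))).
have G0 i x : ~ K x -> G i x = 0 by move=> /u0 ux; rewrite /G ux !mulr0.
have dG0 i x : ~ K x -> dG i x = 0.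
  by move=> /u0 ux; rewrite /dG ux !(mulr0, mul0r, addr0).
have sdG i : sm (dG i).
  by apply: (summable_compact_support cK KO); [move=> x Ox; have [] := G1 i x Ox|exact: dG0].
have sgrad := grad_sq_summable hu.
have spot := summable_mulsq hu (@cont_on_potential a e e0).
have mD := @measurable_punctured R N k.
have H x : D x -> twist_sq a e u x =
   grad_sq u x + potential a e x * u x ^+ 2 - \sum_(i < N) dG i x.
  move=> [Ox _]; rewrite -drift_potential//; last first.
    by rewrite gt_eqF// ltr_wpDl// sqn_ge0.
  rewrite mulr_suml /grad_sq -big_split/= -sumrB; apply: eq_bigr => i _.
  by rewrite /dG; ring.
have s1 : sm (fun x => grad_sq u x + potential a e x * u x ^+ 2) by exact: summableD.
have s2 : sm (fun x => \sum_(i < N) dG i x) by exact: summable_sum.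
split.
  apply: (eq_summable mD (f := fun x => grad_sq u x + potential a e x * u x ^+ 2 - \sum_(i < N) dG i x)).
    by move=> x Dx; rewrite H.
  exact: (summableB mD s1 s2).
rewrite (eq_int _ H) intB// int_sum//.
rewrite big1 ?subr0// => i _; exact: (int_derivative0 hN cK KO (G1 i) (G0 i) (dG0 i)).
Qed.

End ground_state.

(** * Removal of the regularization e *)

Section ground_state_limit.
Variables (R : realType) (N k : nat).
Hypotheses (hN : (2 <= N)%N) (hk : (k <= N)%N).
Implicit Types (u f g : 'rV[R]_N -> R) (x : 'rV[R]_N) (i j : 'I_N) (a e : R).
Local Notation mu := (lebesgue_rV R N).
Local Notation Om := (@orthant R N k).
Local Notation D := (@punctured R N k).
Local Notation sm := (summable_on mu D).
Local Notation I f := (\int[mu]_(x in D) f x).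
Local Notation mD := (@measurable_punctured R N k).

Lemma punctured_sqn_gt0 x : D x -> 0 < sqn x.
Proof. by move=> [_ x0]; rewrite sqn_gt0; apply/eqP. Qed.

(** The limit is written with [+ 0] to match [drift] and [potential] at e = 0. *)
Lemma cvg_inv_sqn x : D x ->
  (sqn x + harmonic n)^-1 @[n --> \oo] --> (sqn x + 0)^-1.
Proof.
move=> /punctured_sqn_gt0 s0; apply: cvgV; first by rewrite addr0 gt_eqF.
by apply: cvgD; [exact: cvg_cst|exact: cvg_harmonic].
Qed.

Lemma cont_on_id : cont_on setT (@id R).
Proof. by move=> x _; exact: cvg_id. Qed.

Lemma cvg_gsq a u x : D x -> twist_sq k a (harmonic n) u x @[n --> \oo] --> twist_sq k a 0 u x.
Proof.
move=> Dx.
(* For fixed x the parameter e enters only through q = (|x|^2 + e)^-1, and the expression is a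
   polynomial in q. *)
pose P (q : R) := \sum_(i < N) (partial i u x -
  (- (4^-1 * x ord0 i) + a * (x ord0 i * q) + edge R k i * (x ord0 i)^-1) * u x) ^+ 2.
have cP : cont_on setT P.
  have cc := @cont_on_cst R _ [set: R].
  apply: cont_on_sum => i; apply: cont_onX; apply: cont_onD => //; apply: cont_onN; apply: cont_onM => //.
  apply: cont_onD => //; apply: cont_onD => //; apply: cont_onM => //; apply: cont_onM => //.
  exact: cont_on_id.
by apply: (@continuous_cvg _ _ _ _ _ _ P _ (cP _ Logic.I) (cvg_inv_sqn Dx)).
Qed.

Lemma cvg_potential a x : D x -> potential k a (harmonic n) x @[n --> \oo] --> potential k a 0 x.
Proof.
move=> Dx.
pose P (q : R) := sqn x / 16 - N%:R / 4 - k%:R / 2 + a * (N%:R + 2 * k%:R) * q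
  + (a ^+ 2 - 2 * a) * (sqn x * q ^+ 2) - a / 2 * (sqn x * q).
have cP : cont_on setT P.
  have cc := @cont_on_cst R _ [set: R]; have ci := cont_on_id.
  apply: cont_onD; last by apply: cont_onN; apply: cont_onM => //; apply: cont_onM.
  apply: cont_onD; last by apply: cont_onM => //; apply: cont_onM => //; apply: cont_onX.
  by apply: cont_onD => //; apply: cont_onM.
by apply: (@continuous_cvg _ _ _ _ _ _ P _ (cP _ Logic.I) (cvg_inv_sqn Dx)).
Qed.

Lemma inv_sqn_bounds e x : 0 < e -> D x ->
  [/\ 0 <= (sqn x + e)^-1, (sqn x + e)^-1 <= (sqn x)^-1 & sqn x * (sqn x + e)^-1 <= 1].
Proof.
move=> e0 /punctured_sqn_gt0 s0; have se : 0 < sqn x + e by lra.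
split; first by rewrite invr_ge0 ltW.
- by rewrite lef_pV2 ?posrE// lerDl ltW.
- by rewrite ler_pdivrMr// mul1r lerDl ltW.
Qed.

(** A bound uniform in e, for dominated convergence. The factor [|a|] is kept in front of |x|^-2
    because only a u^2 / |x|^2 will be known to be integrable. *)
Lemma potential_bound a e x : 0 < e -> D x ->
  `|potential k a e x| <= sqn x / 16 + (N%:R / 4 + k%:R / 2 + `|a|)
     + `|a| * (N%:R + 2 * k%:R + (`|a| + 2)) * (sqn x)^-1.
Proof.
move=> e0 Dx; have [q0 qs sq] := inv_sqn_bounds e0 Dx.
have s0 := punctured_sqn_gt0 Dx; rewrite /potential; set q := (_ + e)^-1 in q0 qs sq *.
have N0 : 0 <= N%:R :> R by []. have k0 : 0 <= k%:R :> R by [].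
have a0 := normr_ge0 a.
have b1 : `|a * (N%:R + 2 * k%:R) * q| <= `|a| * (N%:R + 2 * k%:R) * (sqn x)^-1.
  rewrite !normrM (ger0_norm q0) [`|_ + _|]ger0_norm; last by lra.
  by apply: ler_wpM2l => //; apply: mulr_ge0 => //; lra.
have b2 : `|(a ^+ 2 - 2 * a) * (sqn x * q ^+ 2)| <= `|a| * (`|a| + 2) * (sqn x)^-1.
  rewrite (_ : a ^+ 2 - 2 * a = a * (a - 2)); last by ring.
  have sq2 : 0 <= sqn x * q ^+ 2 by rewrite mulr_ge0 ?sqr_ge0// ltW.
  rewrite 2!normrM (ger0_norm sq2) -!mulrA.
  apply: ler_wpM2l => //; apply: ler_pM => //.
  - by rewrite (le_trans (ler_normB _ _))// lerD2l ger0_norm.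
  - by rewrite expr2 mulrA (le_trans _ qs)// ler_piMl.
have b3 : `|a / 2 * (sqn x * q)| <= `|a|.
  rewrite !normrM (ger0_norm (ltW s0)) (ger0_norm q0) [`|2^-1|]ger0_norm//.
  rewrite -mulrA ler_piMr// mulr_ile1 ?mulr_ge0 ?(ltW s0)//.
  by rewrite invf_le1// ler1n.
move: b1 b2 b3; rewrite !ler_norml => /andP[? ?] /andP[? ?] /andP[? ?].
have : 0 <= sqn x / 16 by apply: divr_ge0 => //; exact: ltW.
by move=> ?; apply/andP; split; lra.
Qed.

Lemma twist_sq_bound a e u x : 0 < e -> D x ->
  twist_sq k a e u x <= 2 * grad_sq u x
    + (6 * (sqn x / 16 + \sum_(i < N) (edge R k i * (x ord0 i)^-1) ^+ 2)) * u x ^+ 2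
    + 6 * `|a| * (`|a| * (u x ^+ 2 / sqn x)).
Proof.
move=> e0 Dx; have [q0 qs sq] := inv_sqn_bounds e0 Dx.
have s0 := punctured_sqn_gt0 Dx.
apply: (@le_trans _ _ (\sum_(i < N) (2 * partial i u x ^+ 2 +
   (6 * (x ord0 i ^+ 2 / 16 + (edge R k i * (x ord0 i)^-1) ^+ 2)) * u x ^+ 2 +
   6 * `|a| * (`|a| * (u x ^+ 2 * (sqn x)^-1 ^+ 2)) * x ord0 i ^+ 2))).
  apply: ler_sum => i _; rewrite /drift; set q := (_ + e)^-1 in q0 qs sq *.
  set t := edge _ _ _ * _; set p := partial _ _ _.
  have : q ^+ 2 <= (sqn x)^-1 ^+ 2 by rewrite ler_sqr ?nnegrE// invr_ge0 ltW.
  set r := (sqn x)^-1 ^+ 2 => qr.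
  have aq : a ^+ 2 * (x ord0 i ^+ 2 * q ^+ 2) * u x ^+ 2 <= a ^+ 2 * (x ord0 i ^+ 2 * r) * u x ^+ 2.
    by apply: ler_wpM2r; rewrite ?sqr_ge0//; apply: ler_wpM2l; rewrite ?sqr_ge0//; apply: ler_wpM2l; rewrite ?sqr_ge0.
  have -> : 6 * `|a| * (`|a| * (u x ^+ 2 * r)) * x ord0 i ^+ 2 = 6 * (a ^+ 2 * (x ord0 i ^+ 2 * r) * u x ^+ 2).
    by rewrite -(real_normK (num_real a)); ring.
  (* With S the sum of the three terms of the drift: (p - S u)^2 <= 2 p^2 + 2 S^2 u^2, and S^2 is at
     most three times the sum of the squares of the terms. The squares in [s1] to [s4] are what
     these two inequalities lose. *)
  have s1 := sqr_ge0 (p + (- (4^-1 * x ord0 i) + a * (x ord0 i * q) + t) * u x).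
  have s2 := sqr_ge0 ((4^-1 * x ord0 i + a * (x ord0 i * q)) * u x).
  have s3 := sqr_ge0 ((4^-1 * x ord0 i + t) * u x).
  have s4 := sqr_ge0 ((a * (x ord0 i * q) - t) * u x).
  have E : 2 * p ^+ 2 + (6 * (x ord0 i ^+ 2 / 16 + t ^+ 2)) * u x ^+ 2
     + 6 * (a ^+ 2 * (x ord0 i ^+ 2 * q ^+ 2) * u x ^+ 2) -
     (p - (- (4^-1 * x ord0 i) + a * (x ord0 i * q) + t) * u x) ^+ 2 =
     (p + (- (4^-1 * x ord0 i) + a * (x ord0 i * q) + t) * u x) ^+ 2 +
     2 * ((4^-1 * x ord0 i + a * (x ord0 i * q)) * u x) ^+ 2 +
     2 * ((4^-1 * x ord0 i + t) * u x) ^+ 2 +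
     2 * ((a * (x ord0 i * q) - t) * u x) ^+ 2 by field.
  lra.
rewrite !big_split/= -!mulr_sumr -/(sqn x) -!mulr_suml -!mulr_sumr big_split/= -mulr_suml -/(sqn x).
rewrite le_eqVlt; apply/orP; left; apply/eqP.
rewrite /grad_sq; congr (_ + _ + _).
by field; rewrite gt_eqF.
Qed.

Lemma cont_on_edge i : cont_on Om (fun x => edge R k i * (x ord0 i)^-1).
Proof.
have [->|h] := eqVneq (edge R k i) 0.
  by under eq_fun do rewrite mul0r; exact: cont_on_cst.
apply: cont_onM; first exact: cont_on_cst.
by apply: cont_onV; [exact: cont_on_coord|move=> x Ox; exact: edge_neq0 h].
Qed.

Lemma summable_norml a f : sm (fun x => a * f x) -> sm (fun x => `|a| * f x).
Proof.
move=> /(summableZ mD (Num.sg a)); apply: eq_summable => //; first exact: mD.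
by move=> x _; rewrite mulrA -normrEsg.
Qed.

Lemma ground_state_representation a K u : C1_compact k K u ->
  sm (fun x => a * (u x ^+ 2 / sqn x)) ->
  [/\ sm (twist_sq k a 0 u), sm (fun x => grad_sq u x + potential k a 0 x * u x ^+ 2) &
   I (twist_sq k a 0 u) = I (fun x => grad_sq u x + potential k a 0 x * u x ^+ 2)].
Proof.
move=> hu sa; have sa' := summable_norml sa.
have sg := grad_sq_summable hu.
have cc := @cont_on_cst R _ Om; have cs := @cont_on_sqn R N Om.
have e0 n : 0 < harmonic n :> R by rewrite invr_gt0.
have reg n := regularized_ground_state hN hk a (e0 n) hu.
have [s1 l1] : sm (twist_sq k a 0 u) /\ I (twist_sq k a (harmonic n) u) @[n --> \oo] --> I (twist_sq k a 0 u).
  apply: (dominated_int mD (g := fun x => 2 * grad_sq u x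
    + (6 * (sqn x / 16 + \sum_(i < N) (edge R k i * (x ord0 i)^-1) ^+ 2)) * u x ^+ 2
    + 6 * `|a| * (`|a| * (u x ^+ 2 / sqn x)))).
  - by move=> n; apply: summable_measurable; exact: (reg n).1.
  - by move=> x Dx; exact: cvg_gsq.
  - apply: summableD; [exact: mD| |by apply: summableZ => //; exact: mD].
    apply: summableD; [exact: mD|by apply: summableZ => //; exact: mD|].
    apply: (summable_mulsq hN hu); apply: cont_onM => //; apply: cont_onD; first exact: cont_onM.
    by apply: cont_on_sum => i; apply: cont_onX; exact: cont_on_edge.
  - move=> n x Dx; rewrite ger0_norm; first exact: twist_sq_bound.
    by apply: sumr_ge0 => i _; exact: sqr_ge0.
have [s2 l2] : sm (fun x => grad_sq u x + potential k a 0 x * u x ^+ 2) /\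
   I (fun x => grad_sq u x + potential k a (harmonic n) x * u x ^+ 2) @[n --> \oo] -->
   I (fun x => grad_sq u x + potential k a 0 x * u x ^+ 2).
  apply: (dominated_int mD (g := fun x => grad_sq u x +
    ((sqn x / 16 + (N%:R / 4 + k%:R / 2 + `|a|)) * u x ^+ 2
     + (N%:R + 2 * k%:R + (`|a| + 2)) * (`|a| * (u x ^+ 2 / sqn x))))).
  - move=> n; apply: (@summable_measurable _ _ _ mu).
    exact: (summableD mD sg (summable_mulsq hN hu (@cont_on_potential _ _ _ a _ (e0 n)))).
  - move=> x Dx; apply: cvgD; first exact: cvg_cst.
    by apply: cvgM; [exact: cvg_potential|exact: cvg_cst].
  - apply: summableD => //; first exact: mD.
    apply: summableD; [exact: mD| |by apply: summableZ => //; exact: mD].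
    by apply: (summable_mulsq hN hu); apply: cont_onD => //; exact: cont_onM.
  - move=> n x Dx; apply: (le_trans (ler_normD _ _)); apply: lerD.
      by rewrite ger0_norm//; apply: sumr_ge0 => i _; exact: sqr_ge0.
    rewrite normrM (ger0_norm (sqr_ge0 _)).
    apply: (le_trans (ler_wpM2r (sqr_ge0 _) (potential_bound a (e0 n) Dx))).
    by rewrite le_eqVlt; apply/orP; left; apply/eqP; ring.
split => //; apply: cvg_unique l1 _ => //.
by move: l2; under eq_fun do rewrite -(reg _).2.
Qed.

End ground_state_limit.

(** * The Hardy form on test functions *)

Section hardy_form_theory.
Variables (R : realType) (N k : nat) (lam : R).
Hypotheses (hN : (2 <= N)%N) (hk : (k <= N)%N) (hlam : lam <= hardy_const R N k).
Implicit Types (u f g : 'rV[R]_N -> R) (x : 'rV[R]_N) (i j : 'I_N).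
Local Notation mu := (lebesgue_rV R N).
Local Notation Om := (@orthant R N k).
Local Notation D := (@punctured R N k).
Local Notation sm := (summable_on mu D).
Local Notation I f := (\int[mu]_(x in D) f x).
Local Notation mD := (@measurable_punctured R N k).

(** The nonnegative square root of [hardy_const]; it vanishes only for N = 2 and k = 0. *)
Definition hardy_root : R := (N%:R - 2) / 2 + k%:R.
Local Notation m := (m_lam N k lam).
(** The total exponent of |x| in alpha: m - (N - 2) / 2 from the power, and - k from the
    normalization of the product of the x_j. *)
Definition alpha_exp : R := m - hardy_root.

Lemma hardy_root_ge0 : 0 <= hardy_root.
Proof.
by rewrite addr_ge0// divr_ge0// subr_ge0 ler_nat.
Qed.

Lemma m_ge0 : 0 <= m. Proof. exact: sqrtr_ge0. Qed.

Lemma m_sq : m ^+ 2 = hardy_root ^+ 2 - lam.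
Proof. by rewrite sqr_sqrtr// subr_ge0. Qed.

Lemma potential_alpha_exp x : D x ->
  potential k alpha_exp 0 x = sqn x / 16 - lam / sqn x - (1 + m) / 2.
Proof.
move=> /punctured_sqn_gt0 s0; rewrite /potential addr0.
rewrite /alpha_exp; have := m_sq; move: m => m' E.
have -> : lam = hardy_root ^+ 2 - m' ^+ 2 by rewrite E; ring.
rewrite /hardy_root; move: (N%:R : R) (k%:R : R) => n l {E}.
by field; rewrite gt_eqF.
Qed.

(** The exponent - h minimizes a^2 + 2 a h, the coefficient of |x|^-2 in the potential, with value -
    h^2. For e > 0 the potential stays below |x|^2 / 16 + h / 2 - h^2 |x|^2 / (|x|^2 + e)^2, so
    nonnegativity of the twisted square bounds the integral of the last term times u^2 independently
    of e; Fatou gives the limit, and h > 0 allows division by h^2. *)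
Lemma hardy_summable K u : C1_compact k K u -> 0 < hardy_root -> sm (fun x => u x ^+ 2 / sqn x).
Proof.
move=> hu h0; have e0 n : 0 < harmonic n :> R by rewrite invr_gt0.
have sg := grad_sq_summable hu.
have cc := @cont_on_cst R _ Om; have cs := @cont_on_sqn R N Om.
have sA : sm (fun x => grad_sq u x + (sqn x / 16 + hardy_root / 2) * u x ^+ 2).
  apply: (summableD mD sg); apply: (summable_mulsq hN hu).
  by apply: cont_onD => //; apply: cont_onM.
have sq n : sm (fun x => hardy_root ^+ 2 * (sqn x * (sqn x + harmonic n)^-1 ^+ 2) * u x ^+ 2).
  apply: (summable_mulsq hN hu); apply: cont_onM => //; apply: cont_onM => //; apply: cont_onX.
  apply: cont_onV; first exact: cont_onD.
  by move=> x _; rewrite gt_eqF// ltr_wpDl// sqn_ge0.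
have sp n := summable_mulsq hN hu (@cont_on_potential _ _ _ (- hardy_root) _ (e0 n)).
suff [+ _] : sm (fun x => hardy_root ^+ 2 * (sqn x * (sqn x + 0)^-1 ^+ 2) * u x ^+ 2) /\
    I (fun x => hardy_root ^+ 2 * (sqn x * (sqn x + 0)^-1 ^+ 2) * u x ^+ 2) <=
    I (fun x => grad_sq u x + (sqn x / 16 + hardy_root / 2) * u x ^+ 2).
  move=> /(summableZ mD (hardy_root ^+ 2)^-1); apply: (eq_summable mD) => x.
  move=> /punctured_sqn_gt0 s0; rewrite addr0; field.
  by rewrite !gt_eqF.
apply: (fatou_int mD sq).
- move=> x Dx; apply: cvgM; last exact: cvg_cst.
  apply: cvgM; first exact: cvg_cst.
  apply: cvgM; first exact: cvg_cst.
  by apply: (@continuous_cvg _ _ _ _ _ _ (fun q : R => q ^+ 2));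
    [exact: exprn_continuous|exact: cvg_inv_sqn Dx].
- move=> n x _; rewrite mulr_ge0 ?sqr_ge0// mulr_ge0 ?sqr_ge0//.
  by rewrite mulr_ge0 ?sqr_ge0 ?sqn_ge0.
move=> n; have [sG IG] := regularized_ground_state hN hk (- hardy_root) (e0 n) hu.
have G0 : 0 <= I (twist_sq k (- hardy_root) (harmonic n) u).
  by apply: int_ge0 => x _; apply: sumr_ge0 => i _; exact: sqr_ge0.
rewrite -subr_ge0 -(intB mD sA (sq n)); apply: (le_trans G0); rewrite IG.
apply: (le_int mD (summableD mD sg (sp n)) (summableB mD sA (sq n))) => x Dx.
rewrite -addrA lerD2l -mulrBl ler_wpM2r ?sqr_ge0//.
have [q0 _ s1] := inv_sqn_bounds (e0 n) Dx; rewrite /potential; set q := (_ + _)^-1 in q0 s1 *.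
(* Thus N + 2 k = 2 h + 2, and the gap between the two sides becomes a sum of terms that are
   nonnegative because |x|^2 q <= 1. *)
have E : N%:R = 2 * hardy_root + 2 - 2 * k%:R :> R by rewrite /hardy_root; field.
have k0 : 0 <= k%:R :> R by []. have N0 : 0 <= N%:R :> R by [].
have h1 : hardy_root * (sqn x * q) <= hardy_root by rewrite ler_piMr// ltW.
have h2 : hardy_root * (2 * hardy_root + 2) * q * (sqn x * q) <= hardy_root * (2 * hardy_root + 2) * q.
  by rewrite ler_piMr// !mulr_ge0// ?ltW//; lra.
rewrite -subr_ge0.
have -> : sqn x / 16 + hardy_root / 2 - hardy_root ^+ 2 * (sqn x * q ^+ 2) -
   (sqn x / 16 - N%:R / 4 - k%:R / 2 + - hardy_root * (N%:R + 2 * k%:R) * q +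
    ((- hardy_root) ^+ 2 - 2 * - hardy_root) * (sqn x * q ^+ 2) - - hardy_root / 2 * (sqn x * q)) =
   N%:R / 4 + k%:R / 2 + (hardy_root - hardy_root * (sqn x * q)) / 2 +
   (hardy_root * (2 * hardy_root + 2) * q - hardy_root * (2 * hardy_root + 2) * q * (sqn x * q)).
  by rewrite [X in _ * (X + 2 * _) * q]E; clearbody q; by field.
lra.
Qed.

Lemma measurable_sqn A : measurable_fun A (@sqn R N).
Proof. by apply: measurable_funTS; apply: continuous_measurable_rV; exact: continuous_sqn. Qed.

Lemma measurable_inv_sqn A : measurable_fun A (fun x => (sqn x)^-1).
Proof.
apply: measurable_funTS.
rewrite (_ : (fun x => _) = (@powR R ^~ (-1)) \o (@sqn R N)).
  by apply: measurableT_comp; [exact: measurable_powR|exact: measurable_sqn].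
by apply/funext => x /=; rewrite powR_inv1// sqn_ge0.
Qed.

Lemma C1_compact_measurable A K u : C1_compact k K u -> measurable_fun A u.
Proof.
move=> [_ _ _ h]; apply: measurable_funTS; apply: continuous_measurable_rV => x.
by have [] := h (Ordinal (ltnW hN)) x Logic.I.
Qed.

Lemma grad_sq_measurable A K u : C1_compact k K u -> measurable_fun A (grad_sq u).
Proof.
move=> [_ _ _ h]; apply: measurable_sum => i; apply: measurable_funX.
apply: measurable_funTS; apply: continuous_measurable_rV => x.
by have [] := h i x Logic.I.
Qed.

Definition hardy_integrand u x : R :=
  grad_sq u x - lam * (u x ^+ 2 / sqn x) + sqn x / 16 * u x ^+ 2.

Lemma hardy_integrand_measurable A K u : C1_compact k K u -> measurable_fun A (hardy_integrand u).
Proof.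
move=> hu; have mu := C1_compact_measurable (A := A) hu.
apply: measurable_funD; last first.
  apply: measurable_funM; last exact: measurable_funX.
  by apply: measurable_funM; [exact: measurable_sqn|exact: measurable_cst].
apply: measurable_funB; first exact: grad_sq_measurable hu.
apply: measurable_funM; first exact: measurable_cst.
by apply: measurable_funM; [exact: measurable_funX|exact: measurable_inv_sqn].
Qed.

Lemma hardy_formE K u : C1_compact k K u ->
  hardy_form k lam u = (\int[mu]_(x in D) (hardy_integrand u x)%:E)%E.
Proof.
move=> hu; rewrite -integral_orthant//; last exact: hardy_integrand_measurable hu.
by apply: eq_integral => x _; rewrite /hardy_integrand enorm_sq.
Qed.

Lemma L2normsqE u : measurable_fun Om u ->
  L2normsq k u = (\int[mu]_(x in D) (u x ^+ 2)%:E)%E.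
Proof. by move=> mu; rewrite /L2normsq integral_orthant//; exact: measurable_funX. Qed.

Lemma C1_compact_summable_sq K u : C1_compact k K u -> sm (fun x => u x ^+ 2).
Proof.
move=> hu; apply: (eq_summable mD (f := fun x => 1 * u x ^+ 2)) => [x _|]; first by rewrite mul1r.
exact: (summable_mulsq hN hu (@cont_on_cst R _ Om 1)).
Qed.

Lemma L2normsq_C1_compact K u : C1_compact k K u -> L2normsq k u = (I (fun x => u x ^+ 2))%:E.
Proof.
move=> hu; rewrite L2normsqE; last exact: C1_compact_measurable hu.
by rewrite EFin_int//; [exact: mD|exact: C1_compact_summable_sq hu].
Qed.

(* [u ^ 2 / |x| ^ 2] need not be integrable if N = 2 and k = 0; the factor
   [alpha_exp] covers that case, as it vanishes there only for lam = 0. *)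
Lemma form_finite K u : C1_compact k K u -> (hardy_form k lam u < +oo)%E ->
  sm (fun x => alpha_exp * (u x ^+ 2 / sqn x)).
Proof.
move=> hu Qoo; have := hardy_root_ge0; rewrite le_eqVlt => /predU1P[h0|h0]; last first.
  by apply: summableZ; [exact: mD|exact: hardy_summable hu h0].
(* Here h = 0, so lam = - m^2 <= 0: all three terms of the integrand are nonnegative, and finiteness
   of the form controls each of them. Moreover [alpha_exp] is m. *)
have lamE (t : R) : lam * t = - m ^+ 2 * t by rewrite m_sq -h0; ring.
have sf : sm (hardy_integrand u).
  apply: summable_ge0; first exact: hardy_integrand_measurable hu.
    move=> x Dx; rewrite /hardy_integrand.
    rewrite lamE -mulNr opprK !addr_ge0//.
    - by apply: sumr_ge0 => i _; exact: sqr_ge0.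
    - by rewrite mulr_ge0 ?sqr_ge0// divr_ge0 ?sqr_ge0 ?sqn_ge0.
    - by rewrite mulr_ge0 ?sqr_ge0// divr_ge0 ?sqn_ge0.
  by rewrite -(hardy_formE hu).
have [m0|m0] := eqVneq m 0.
  apply: (eq_summable mD (f := fun=> 0)); last exact: summable0.
  by move=> x _; rewrite /alpha_exp -h0 m0 subrr mul0r.
apply: (eq_summable mD (f := fun x => m^-1 * (m ^+ 2 * (u x ^+ 2 / sqn x)))).
  by move=> x _; rewrite /alpha_exp -h0 subr0 expr2 !mulrA mulVf// mul1r.
apply: summableZ; first exact: mD.
apply: (summable_le mD _ _ sf).
  apply: measurable_funM; first exact: measurable_cst.
  apply: measurable_funM; last exact: measurable_inv_sqn.
  by apply: measurable_funX; exact: C1_compact_measurable hu.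
move=> x Dx; rewrite ger0_norm; last first.
  by rewrite mulr_ge0 ?sqr_ge0// divr_ge0 ?sqr_ge0 ?sqn_ge0.
rewrite /hardy_integrand lamE -mulNr opprK addrAC lerDr addr_ge0//.
- by apply: sumr_ge0 => i _; exact: sqr_ge0.
- by rewrite mulr_ge0 ?sqr_ge0// divr_ge0 ?sqn_ge0.
Qed.

Local Notation G u := (twist_sq k alpha_exp 0 u).

Lemma form_identity K u : C1_compact k K u ->
  sm (fun x => alpha_exp * (u x ^+ 2 / sqn x)) ->
  [/\ sm (G u), sm (hardy_integrand u) & 
    hardy_form k lam u = ((1 + m) / 2 * I (fun x => u x ^+ 2) + I (G u))%:E].
Proof.
move=> hu sa; have [sG s1 E1] := ground_state_representation hN hk hu sa.
have su := C1_compact_summable_sq hu.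
have E x : D x -> hardy_integrand u x = (1 + m) / 2 * u x ^+ 2 + (grad_sq u x + potential k alpha_exp 0 x * u x ^+ 2).
  by move=> Dx; rewrite potential_alpha_exp// /hardy_integrand; ring.
have s2 : sm (fun x => (1 + m) / 2 * u x ^+ 2) by apply: summableZ => //; exact: mD.
have s3 : sm (hardy_integrand u).
  apply: (eq_summable mD _ (summableD mD s2 s1)) => x Dx; by rewrite E.
split => //; rewrite (hardy_formE hu) -(EFin_int mD s3) (eq_int _ E).
by rewrite (intD mD s2 s1) (intZ mD _ su) E1.
Qed.

Lemma form_identity_fin K u : C1_compact k K u -> (hardy_form k lam u < +oo)%E ->
  [/\ sm (fun x => alpha_exp * (u x ^+ 2 / sqn x)), sm (G u), sm (hardy_integrand u) & 
    hardy_form k lam u = ((1 + m) / 2 * I (fun x => u x ^+ 2) + I (G u))%:E].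
Proof. by move=> hu /(form_finite hu) sa; have [] := form_identity hu sa. Qed.

Lemma hardy_ineq K u : C1_compact k K u ->
  (((1 + m) / 2)%:E * L2normsq k u <= hardy_form k lam u)%E.
Proof.
move=> hu; have [Qoo|] := ltP (hardy_form k lam u) +oo%E; last first.
  by rewrite leye_eq => /eqP ->; exact: leey.
have [_ _ _ ->] := form_identity_fin hu Qoo.
rewrite (L2normsq_C1_compact hu) -EFinM lee_fin lerDl.
by apply: int_ge0 => x _; apply: sumr_ge0 => i _; exact: sqr_ge0.
Qed.

End hardy_form_theory.

(** * Closability of the form *)

Section weak.
Variables (R : realType) (N k : nat).
Hypotheses (hN : (2 <= N)%N) (hk : (k <= N)%N).
Implicit Types (u v w f g : 'rV[R]_N -> R) (x : 'rV[R]_N) (i j : 'I_N) (a e : R).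
Local Notation mu := (lebesgue_rV R N).
Local Notation Om := (@orthant R N k).
Local Notation D := (@punctured R N k).
Local Notation sm := (summable_on mu D).
Local Notation I f := (\int[mu]_(x in D) f x).
Local Notation mD := (@measurable_punctured R N k).

Definition twist a i u x : R := partial i u x - drift k a 0 i x * u x.

Lemma twist_sqE a u x : twist_sq k a 0 u x = \sum_(i < N) twist a i u x ^+ 2.
Proof. by []. Qed.

(** Vanishes to second order at the origin, lies between 0 and 1, and tends to 1 elsewhere as e
    tends to 0. *)
Definition cutoff e x : R := sqn x * (sqn x + e)^-1.

(** The product of [cutoff] and [drift], with |x|^2 cancelled against |x|^-2, so that it is C^1 also
    at the origin when k = 0. *)
Definition cut_drift a e i x : R :=
  - (4^-1 * x ord0 i) * cutoff e x + a * (x ord0 i * (sqn x + e)^-1) +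
  edge R k i * (x ord0 i)^-1 * cutoff e x.

Lemma cut_driftE a e i x : D x -> cut_drift a e i x = cutoff e x * drift k a 0 i x.
Proof.
move=> /punctured_sqn_gt0 s0; rewrite /cut_drift /drift /cutoff addr0.
set t := edge _ _ _ * _; set q := (_ + e)^-1; clearbody t q.
by field; rewrite gt_eqF.
Qed.

Section C1_along.
Variables (a e : R) (i : 'I_N).
Hypothesis e0 : 0 < e.

Lemma C1_along_cutoff : exists dc, C1_along Om i (cutoff e) dc.
Proof.
have se0 x : sqn x + e != 0 by rewrite gt_eqF// ltr_wpDl// sqn_ge0.
eexists; exact: (C1_along_mul (@C1_along_sqn R N Om i)
  (C1_along_inv (C1_along_add (@C1_along_sqn R N Om i) (@C1_along_cst R N Om i e)) (fun x _ => se0 x))).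
Qed.

Lemma C1_along_edge : exists dt, C1_along Om i (fun x => edge R k i * (x ord0 i)^-1) dt.
Proof.
have [h|h] := eqVneq (edge R k i) 0.
  exists (fun=> 0); have := @C1_along_cst R N Om i 0.
  by congr C1_along; apply/funext => x; rewrite h mul0r.
eexists; exact: (C1_along_mul (@C1_along_cst R N Om i (edge R k i))
  (C1_along_inv (@C1_along_coord R N Om i i) (fun x Ox => edge_neq0 Ox h))).
Qed.

Lemma C1_along_cut_drift : exists dP, C1_along Om i (cut_drift a e i) dP.
Proof.
have se0 x : sqn x + e != 0 by rewrite gt_eqF// ltr_wpDl// sqn_ge0.
have [dc c1] := C1_along_cutoff; have [dt t1] := C1_along_edge.
have h2 := C1_along_inv (C1_along_add (@C1_along_sqn R N Om i) (@C1_along_cst R N Om i e)) (fun x _ => se0 x).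
have h1 := @C1_along_coord R N Om i i.
eexists; apply: (C1_along_add (C1_along_add (C1_along_mul _ c1)
  (C1_along_mul (@C1_along_cst R N Om i a) (C1_along_mul h1 h2))) (C1_along_mul t1 c1)).
have := C1_along_mul (@C1_along_cst R N Om i (- 4^-1)) h1.
by congr C1_along; apply/funext => x; rewrite mulNr.
Qed.

End C1_along.

(** Only pure second derivatives: in [weak_gradient] the i-th component of the field is
    differentiated along the i-th axis. *)
Definition C2_compact K u := C1_compact k K u /\ forall i, C1_along setT i (partial i u) (partial i (partial i u)).

Lemma test_C2_compact u : test_fun Om u -> C2_compact (closure [set x | u x != 0]) u.
Proof.
move=> hu; split; first exact: test_C1_compact.
case: hu => su _ _ i x _; split; first exact: (su [:: i]).1.
- by apply: DeriveDef; [exact: (su [:: i]).2|].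
- exact: (su [:: i; i]).1.
Qed.

(* The square of [cutoff] compensates the 1/|x| singularity of the drift at the
   origin, which is in the orthant if k = 0, and thus makes [Y] bounded. *)
Lemma weak_gradient a e K v : 0 < e -> C2_compact K v -> exists2 Y,
  sm (fun x => Y x ^+ 2) &
  forall K' w, C1_compact k K' w ->
   [/\ sm (fun x => \sum_(i < N) (cutoff e x * twist a i v x) * (cutoff e x * twist a i w x)),
      sm (fun x => w x * Y x) &
   I (fun x => \sum_(i < N) (cutoff e x * twist a i v x) * (cutoff e x * twist a i w x)) =
   I (fun x => w x * Y x)].
Proof.
move=> e0 [hv v2]; have [cK KO v0 v1] := hv.
have pv0 i x : ~ K x -> partial i v x = 0 by exact: C1_compact_partial_off hv.
have ppv0 i x : ~ K x -> partial i (partial i v) x = 0 by apply: (partial_off cK) => y; exact: pv0.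
have vOm i : C1_along Om i v (partial i v) by move=> x _; exact: v1.
have vvOm i : C1_along Om i (partial i v) (partial i (partial i v)) by move=> x _; exact: v2.
(* Off the origin, X = c^2 (grad v - F v) with c the cut-off, and the integrand is X . (grad w - F
   w). Integrating X . grad w by parts leaves w times Y = - div X - F . X; below, [Z] is F . X in a
   form that is continuous at the origin. *)
pose X i x := cutoff e x * (cutoff e x * partial i v x) - cutoff e x * (cut_drift a e i x * v x).
have /choice[dX dXP] : forall i, exists dX, C1_along Om i (X i) dX /\ forall x, ~ K x -> dX x = 0.
  move=> i; have [dc c1] := C1_along_cutoff i e0; have [dP P1] := C1_along_cut_drift a i e0.
  have h1 := C1_along_mul c1 (C1_along_mul c1 (vvOm i)).
  have h2 := C1_along_mul (@C1_along_cst R N Om i (-1)) (C1_along_mul c1 (C1_along_mul P1 (vOm i))).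
  eexists; split.
    have := C1_along_add h1 h2; congr C1_along; apply/funext => x; by rewrite /X mulN1r.
  by move=> x Kx /=; rewrite ppv0// pv0// v0// !(mulr0, addr0, mul0r).
pose Z x := \sum_(i < N) (cutoff e x * cut_drift a e i x * partial i v x - cut_drift a e i x ^+ 2 * v x).
have cc : cont_on Om (cutoff e).
  by have [dc c1] := C1_along_cutoff (Ordinal (ltnW hN)) e0; move=> x Ox; have [] := c1 x Ox.
have cP i : cont_on Om (cut_drift a e i) by have [dP P1] := C1_along_cut_drift a i e0; move=> x Ox; have [] := P1 x Ox.
have cv := cont_on_C1_compact hN hv.
have cpv i : cont_on Om (partial i v) by exact: cont_on_partial hv.
have cX i : cont_on Om (X i) by move=> x Ox; have [] := (dXP i).1 x Ox.
have cdX i : cont_on Om (dX i) by move=> x Ox; have [] := (dXP i).1 x Ox.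
have cZ : cont_on Om Z.
  apply: cont_on_sum => i; apply: cont_onD; first by apply: cont_onM => //; exact: cont_onM.
  by apply: cont_onN; apply: cont_onM => //; exact: cont_onX.
have Z0 x : ~ K x -> Z x = 0.
  by move=> Kx; rewrite /Z big1// => i _; rewrite pv0// v0// !mulr0 subr0.
pose Y x := - (\sum_(i < N) dX i x) - Z x.
have cY : cont_on Om Y by apply: cont_onD; apply: cont_onN => //; exact: cont_on_sum.
have Y0 x : ~ K x -> Y x = 0.
  by move=> Kx; rewrite /Y Z0// big1 ?oppr0 ?addr0// => i _; exact: (dXP i).2.
exists Y.
  apply: (summable_compact_support cK KO); first exact: cont_onX.
  by move=> x /Y0 ->; rewrite expr0n.
move=> K' w hw; have [_ _ _ w1] := hw.
have cw := cont_on_C1_compact hN hw.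
have cpw i : cont_on Om (partial i w) by exact: cont_on_partial hw.
have wOm i : C1_along Om i w (partial i w) by move=> x _; exact: w1.
have s1 : sm (fun x => w x * Y x).
  apply: (summable_compact_support cK KO); first exact: cont_onM.
  by move=> x /Y0 ->; rewrite mulr0.
pose dXw i x := dX i x * w x + X i x * partial i w x.
have X0 i x : ~ K x -> X i x = 0.
  by move=> Kx; rewrite /X pv0// v0// !mulr0 subr0.
have cdXw i : cont_on Om (dXw i) by apply: cont_onD; exact: cont_onM.
have dXw0 i x : ~ K x -> dXw i x = 0.
  by move=> Kx; rewrite /dXw (dXP i).2// X0// !mul0r addr0.
have s2 i : sm (dXw i) := summable_compact_support cK KO (@cdXw i) (@dXw0 i).
have E x : D x -> \sum_(i < N) (cutoff e x * twist a i v x) * (cutoff e x * twist a i w x) =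
    w x * Y x + \sum_(i < N) dXw i x.
  move=> Dx; rewrite /Y /Z mulrBr mulrN !mulr_sumr -!sumrN -!big_split/=.
  apply: eq_bigr => i _; rewrite /dXw /X /twist cut_driftE//; ring.
have s3 := summable_sum mD s2.
split => //.
  by apply: (eq_summable mD _ (summableD mD s1 s3)) => x Dx; rewrite E.
rewrite (eq_int _ E) (intD mD s1 s3) (int_sum mD s2) big1 ?addr0// => i _.
apply: (int_derivative0 hN cK KO (C1_along_mul (dXP i).1 (wOm i))) => x Kx.
  by rewrite X0// mul0r.
by rewrite (dXP i).2// X0// !mul0r addr0.
Qed.

End weak.

Section triangle.
Variable R : realType.

(** Splits p as q + (p - q); the defect is (t q - (p - q))^2 / t. *)
Lemma young (t p q : R) : 0 < t -> p ^+ 2 <= (1 + t) * q ^+ 2 + (1 + t^-1) * (p - q) ^+ 2.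
Proof.
move=> t0; rewrite -subr_ge0.
have -> : (1 + t) * q ^+ 2 + (1 + t^-1) * (p - q) ^+ 2 - p ^+ 2 = t^-1 * (t * q - (p - q)) ^+ 2.
  by field; rewrite gt_eqF.
by rewrite mulr_ge0 ?sqr_ge0// invr_ge0 ltW.
Qed.

Lemma young_mul (t p q : R) : 0 < t -> p * q <= t / 2 * p ^+ 2 + (2 * t)^-1 * q ^+ 2.
Proof.
move=> t0; rewrite -subr_ge0.
have -> : t / 2 * p ^+ 2 + (2 * t)^-1 * q ^+ 2 - p * q = (2 * t)^-1 * (t * p - q) ^+ 2.
  by field; rewrite gt_eqF.
by rewrite mulr_ge0 ?sqr_ge0// invr_ge0; lra.
Qed.

Lemma sqr_contract (s y : R) : 0 <= s -> s <= 1 -> (s * y) ^+ 2 <= y ^+ 2.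
Proof. by move=> s0 s1; rewrite exprMn ler_piMl ?sqr_ge0// expr2 mulr_ile1. Qed.

(** The infimum over t of the right-hand side is the square of sqrt b + sqrt r. So [young],
    integrated for each t, yields Minkowski's inequality for any sum of integrals of squares,
    without a scalar product. *)
Lemma sqrt_triangle (a b r : R) : 0 <= b -> 0 <= r ->
  (forall t, 0 < t -> a <= (1 + t) * b + (1 + t^-1) * r) ->
  Num.sqrt a <= Num.sqrt b + Num.sqrt r.
Proof.
move=> b0 r0 H.
have [b1|b1] := ltP 0 b; have [r1|r1] := ltP 0 r.
- have [sb sr] : 0 < Num.sqrt b /\ 0 < Num.sqrt r by rewrite !sqrtr_gt0.
  rewrite -[leRHS]ger0_norm ?addr_ge0// -sqrtr_sqr ler_sqrt ?sqr_ge0//.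
  (* The minimizing t. If b or r is 0 the infimum is only approached, as t tends to infinity or to
     0; this explains r / e and e / b below. *)
  have := H (Num.sqrt r / Num.sqrt b) (divr_gt0 sr sb) => /le_trans; apply.
  rewrite -{2}(sqr_sqrtr b0) -{3}(sqr_sqrtr r0) le_eqVlt; apply/orP; left; apply/eqP.
  by field; rewrite !gt_eqF.
- have -> : r = 0 by apply/le_anti/andP.
  rewrite sqrtr0 addr0 ler_sqrt//; apply/ler_addgt0Pr => e e0.
  have := H (e / b) (divr_gt0 e0 b1); have -> : r = 0 by apply/le_anti/andP.
  by rewrite mulr0 addr0 mulrDl mul1r divfK// gt_eqF.
- have -> : b = 0 by apply/le_anti/andP.
  rewrite sqrtr0 add0r ler_sqrt//; apply/ler_addgt0Pr => e e0.
  have := H (r / e) (divr_gt0 r1 e0); have -> : b = 0 by apply/le_anti/andP.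
  by rewrite mulr0 add0r mulrDl mul1r invf_div divfK// gt_eqF.
- have -> : b = 0 by apply/le_anti/andP.
  have -> : r = 0 by apply/le_anti/andP.
  have := H 1 ltr01; have -> : b = 0 by apply/le_anti/andP.
  have -> : r = 0 by apply/le_anti/andP.
  by rewrite !mulr0 addr0 sqrtr0 addr0 => /ler0_sqrtr ->.
Qed.

Lemma cauchy_seq_cvg (u : nat -> R) :
  (forall e, 0 < e -> exists n0, forall m n, (n0 <= m)%N -> (n0 <= n)%N -> `|u m - u n| <= e) ->
  cvgn u.
Proof.
move=> H; apply: cauchy_cvg; apply/cauchy_exP => e e0.
have [n0 n0P] := H (e / 2) (divr_gt0 e0 (ltr0Sn _ 1)).
exists (u n0); exists n0 => // n /= n0n; apply: (le_lt_trans (n0P _ _ _ _)) => //.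
by rewrite ltr_pdivrMr// ltr_pMr// ltr1n.
Qed.

End triangle.

Section energy.
Variables (R : realType) (N k : nat) (lam : R).
Hypotheses (hN : (2 <= N)%N) (hk : (k <= N)%N) (hlam : lam <= hardy_const R N k).
Implicit Types (u v f g : 'rV[R]_N -> R) (x : 'rV[R]_N) (i j : 'I_N).
Local Notation mu := (lebesgue_rV R N).
Local Notation Om := (@orthant R N k).
Local Notation D := (@punctured R N k).
Local Notation sm := (summable_on mu D).
Local Notation I f := (\int[mu]_(x in D) f x).
Local Notation mD := (@measurable_punctured R N k).
Local Notation m := (m_lam N k lam).
Local Notation a := (alpha_exp N k lam).
Local Notation G u := (twist_sq k a 0 u).
Local Notation hardy_fin u := (sm (fun x => a * (u x ^+ 2 / sqn x))).

Lemma summable_sqB f g : measurable_fun D f -> measurable_fun D g ->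
  sm (fun x => f x ^+ 2) -> sm (fun x => g x ^+ 2) -> sm (fun x => (f x - g x) ^+ 2).
Proof.
move=> mf mg sf sg; apply: (summable_le mD (g := fun x => 2 * f x ^+ 2 + 2 * g x ^+ 2)).
- by apply: measurable_funX; exact: measurable_funB.
- move=> x _; rewrite ger0_norm ?sqr_ge0//.
  by have := young (f x - g x) (- g x) ltr01; rewrite invr1 sqrrN opprK subrK; lra.
- by apply: (summableD mD); exact: (summableZ mD).
Qed.

Lemma sqrt_int_triangle f g : sm (fun x => f x ^+ 2) -> sm (fun x => g x ^+ 2) ->
  sm (fun x => (f x - g x) ^+ 2) ->
  Num.sqrt (I (fun x => f x ^+ 2)) <=
  Num.sqrt (I (fun x => g x ^+ 2)) + Num.sqrt (I (fun x => (f x - g x) ^+ 2)).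
Proof.
move=> sf sg sfg.
have I0 h : 0 <= I (fun x => h x ^+ 2) by apply: int_ge0 => x _; exact: sqr_ge0.
apply: sqrt_triangle => [||t t0]; [exact: I0|exact: I0|].
have s1 := summableZ mD (1 + t) sg; have s2 := summableZ mD (1 + t^-1) sfg.
rewrite -(intZ mD _ sg) -(intZ mD _ sfg) -(intD mD s1 s2).
by apply: (le_int mD sf (summableD mD s1 s2)) => x _; exact: young.
Qed.

Section difference.
Variables (K K' : set 'rV[R]_N) (u v : 'rV[R]_N -> R).
Hypotheses (hu : C1_compact k K u) (hv : C1_compact k K' v).

Lemma partialB i : partial i (fun x => u x - v x) = (fun x => partial i u x - partial i v x).
Proof.
apply/funext => x; have [_ _ _ u1] := hu; have [_ _ _ v1] := hv.
have [_ du _] := u1 i x Logic.I; have [_ dv _] := v1 i x Logic.I.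
by have /@derive_val := is_deriveB du dv.
Qed.

Lemma C1_compactB : C1_compact k (K `|` K') (fun x => u x - v x).
Proof.
have [cK KO u0 u1] := hu; have [cK' KO' v0 v1] := hv; split.
- exact: compactU.
- by rewrite subUset.
- by move=> x /not_orP[Kx Kx']; rewrite u0// v0// subrr.
- move=> i; rewrite partialB => x Ox.
  have [cu du cdu] := u1 i x Ox; have [cv dv cdv] := v1 i x Ox.
  by split; [exact: continuousB|exact: is_deriveB|exact: continuousB].
Qed.

Lemma twistB i x : twist k a i (fun x => u x - v x) x = twist k a i u x - twist k a i v x.
Proof. by rewrite /twist partialB; ring. Qed.

Lemma hardy_finB : hardy_fin u -> hardy_fin v -> hardy_fin (fun x => u x - v x).
Proof.
move=> su sv; have su' := summable_norml su; have sv' := summable_norml sv.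
apply: (summable_le mD (g := fun x => 2 * (`|a| * (u x ^+ 2 / sqn x)) + 2 * (`|a| * (v x ^+ 2 / sqn x)))).
- apply: measurable_funM; first exact: measurable_cst.
  apply: measurable_funM; last exact: measurable_inv_sqn.
  by apply: measurable_funX; apply: measurable_funB; [exact: C1_compact_measurable hu|exact: C1_compact_measurable hv].
- move=> x Dx; have s0 : 0 <= (sqn x)^-1 by rewrite invr_ge0 sqn_ge0.
  have s1 : 0 <= (u x - v x) ^+ 2 / sqn x by rewrite mulr_ge0 ?sqr_ge0.
  rewrite normrM (ger0_norm s1).
  rewrite (_ : _ + _ = `|a| * ((2 * u x ^+ 2 + 2 * v x ^+ 2) / sqn x)); last by ring.
  apply: ler_wpM2l => //; apply: ler_wpM2r => //.
  by have := young (u x - v x) (- v x) ltr01; rewrite invr1 sqrrN opprK subrK; lra.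
- by apply: (summableD mD); exact: (summableZ mD).
Qed.

(** The value that [form_identity] gives to the form. Both coefficients are nonnegative and both
    integrands are squares, so its square root obeys the triangle inequality although the form
    itself may contain a negative term. *)
Definition energy w := (1 + m) / 2 * I (fun x => w x ^+ 2) + I (G w).

Lemma energy_triangle : hardy_fin u -> hardy_fin v ->
  Num.sqrt (energy u) <= Num.sqrt (energy v) + Num.sqrt (energy (fun x => u x - v x)).
Proof.
move=> su sv; have huv := C1_compactB; have suv := hardy_finB su sv.
have c0 : 0 <= (1 + m) / 2 by rewrite divr_ge0// addr_ge0// m_ge0.
have E0 w : 0 <= energy w.
  apply: addr_ge0; first by apply: mulr_ge0 => //; apply: int_ge0 => x _; exact: sqr_ge0.
  by apply: int_ge0 => x _; apply: sumr_ge0 => i _; exact: sqr_ge0.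
apply: sqrt_triangle => // t t0.
have [sGu _ _] := form_identity hN hk hlam hu su.
have [sGv _ _] := form_identity hN hk hlam hv sv.
have [sGuv _ _] := form_identity hN hk hlam huv suv.
have squ := C1_compact_summable_sq hN hu; have sqv := C1_compact_summable_sq hN hv.
have squv := C1_compact_summable_sq hN huv.
have h1 : I (fun x => u x ^+ 2) <= (1 + t) * I (fun x => v x ^+ 2) +
    (1 + t^-1) * I (fun x => (u x - v x) ^+ 2).
  have s1 := summableZ mD (1 + t) sqv; have s2 := summableZ mD (1 + t^-1) squv.
  rewrite -(intZ mD _ sqv) -(intZ mD _ squv) -(intD mD s1 s2).
  by apply: (le_int mD squ (summableD mD s1 s2)) => x _; exact: young.
have h2 : I (G u) <= (1 + t) * I (G v) + (1 + t^-1) * I (G (fun x => u x - v x)).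
  have s1 := summableZ mD (1 + t) sGv; have s2 := summableZ mD (1 + t^-1) sGuv.
  rewrite -(intZ mD _ sGv) -(intZ mD _ sGuv) -(intD mD s1 s2).
  apply: (le_int mD sGu (summableD mD s1 s2)) => x _.
  rewrite !twist_sqE !mulr_sumr -big_split/=; apply: ler_sum => i _.
  by rewrite twistB; exact: young.
rewrite /energy; have := ler_wpM2l c0 h1; lra.
Qed.

End difference.

(* For fixed n, pairing the twisted gradient of [w n] with that of [w p] only
   depends on [w p] through an L^2 pairing, where [w p] can be replaced by
   [w' p]; so it tends to 0 as p grows, and the Cauchy condition concludes. *)
Lemma gradient_vanishing (w w' : nat -> 'rV[R]_N -> R) u :
  (forall n, exists K, C2_compact k K (w n)) -> (forall n, hardy_fin (w n)) ->
  (forall n, exists K, C1_compact k K (w' n)) -> (forall n, hardy_fin (w' n)) ->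
  measurable_fun D u -> sm (fun x => u x ^+ 2) ->
  I (fun x => (w n x - u x) ^+ 2) @[n --> \oo] --> 0 ->
  I (fun x => (w' n x - u x) ^+ 2) @[n --> \oo] --> 0 ->
  I (G (w' n)) @[n --> \oo] --> 0 ->
  (forall e, 0 < e -> exists n0, forall m n, (n0 <= m)%N -> (n0 <= n)%N ->
     I (G (fun x => w n x - w m x)) <= e) ->
  I (G (w n)) @[n --> \oo] --> 0.
Proof.
move=> w2 hw w'1 hw' mu_ su wu w'u gw' cau.
have G0 f : 0 <= I (G f) by apply: int_ge0 => x _; apply: sumr_ge0 => i _; exact: sqr_ge0.
apply/cvgrPdist_le => e e0; have [n0 n0P] := cau e e0.
exists n0 => // n /= n0n; rewrite sub0r normrN ger0_norm//.
have [K hwn] := w2 n; have [sGn _ _] := form_identity hN hk hlam hwn.1 (hw n).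
(* [weak_gradient] applies only in the presence of the cut-off; a bound independent of eps survives
   its removal by Fatou. *)
suff H eps : 0 < eps -> I (fun x => \sum_(i < N) (cutoff eps x * twist k a i (w n) x) ^+ 2) <= e.
  have e0' (j : nat) : 0 < harmonic j :> R by rewrite invr_gt0.
  have cut1 (j : nat) x : D x -> 0 <= cutoff (harmonic j) x <= 1.
    by move=> Dx; have [q0 _ q1] := inv_sqn_bounds (e0' j) Dx; rewrite mulr_ge0 ?sqn_ge0.
  suff [] : sm (G (w n)) /\ I (G (w n)) <= e by [].
  apply: (fatou_int mD (f_ := fun (j : nat) x =>
     \sum_(i < N) (cutoff (harmonic j) x * twist k a i (w n) x) ^+ 2)).
  - move=> j; have [Y _ /(_ K (w n) hwn.1)[+ _ _]] := weak_gradient hN a (e0' j) hwn.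
    by apply: (eq_summable mD) => x _; apply: eq_bigr => i _; rewrite expr2.
  - move=> x Dx.
    pose P (t : R) := \sum_(i < N) (sqn x * t * twist k a i (w n) x) ^+ 2.
    have cP : cont_on setT P.
      have cc := @cont_on_cst R _ [set: R].
      by apply: cont_on_sum => i; apply: cont_onX; apply: cont_onM => //; apply: cont_onM => //; exact: cont_on_id.
    have <- : P (sqn x + 0)^-1 = G (w n) x.
      rewrite twist_sqE /P addr0 mulfV; last by rewrite (gt_eqF (punctured_sqn_gt0 Dx)).
      by under eq_bigr do rewrite mul1r.
    by apply: (@continuous_cvg _ _ _ _ _ _ P _ (cP _ Logic.I) (cvg_inv_sqn Dx)).
  - by move=> j x _; apply: sumr_ge0 => i _; exact: sqr_ge0.
  - by move=> j; exact: H.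
move=> eps0; have [Y sY YP] := weak_gradient hN a eps0 hwn.
have cut1 x : D x -> 0 <= cutoff eps x <= 1.
  by move=> Dx; have [q0 _ q1] := inv_sqn_bounds eps0 Dx; rewrite mulr_ge0 ?sqn_ge0.
apply/ler_addgt0Pr => t t0.
(* The three summands collect the errors of [b1], [b2] and [b4], of sizes eta / 2 times |Y|^2, the
   energy of [w n], and 1; [b3] doubles them, so the total is eta C = t. *)
pose C := I (fun x => Y x ^+ 2) + I (G (w n)) + 1.
have C0 : 0 < C by rewrite ltr_wpDl// addr_ge0//; apply: int_ge0 => x _; exact: sqr_ge0.
pose eta := t / C; have eta0 : 0 < eta by rewrite divr_gt0.
have : (2 * I (fun x => (w m x - u x) ^+ 2) + 2 * I (fun x => (w' m x - u x) ^+ 2)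
    + I (G (w' m))) @[m --> \oo] --> (2 * 0 + 2 * 0 + 0 : R).
  by apply: cvgD => //; apply: cvgD; apply: cvgM => //; exact: cvg_cst.
rewrite mulr0 !addr0 => /cvgrPdist_le/(_ (eta ^+ 2)).
rewrite exprn_gt0// => /(_ isT)[m0 _ /(_ (maxn m0 n0) (leq_maxl _ _))].
have /= := n0P (maxn m0 n0) n (leq_maxr _ _) n0n.
move: (maxn m0 n0) => p Gp; rewrite sub0r normrN => /(le_trans (ler_norm _)) tp.
have [Kp hwp] := w2 p; have [Kp' hwp'] := w'1 p.
have [sn _ _] := YP K (w n) hwn.1; have [sp spY EpY] := YP Kp (w p) hwp.1.
have [sp' spY' EpY'] := YP Kp' (w' p) hwp'.
have [sGp' _ _] := form_identity hN hk hlam hwp' (hw' p).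
have hnp := C1_compactB hwn.1 hwp.1.
have [sGnp _ _] := form_identity hN hk hlam hnp (hardy_finB hwn.1 hwp.1 (hw n) (hw p)).
have mw := C1_compact_measurable (A := D) hN hwp.1; have mw' := C1_compact_measurable (A := D) hN hwp'.
have sqw := summable_sqB mw mu_ (C1_compact_summable_sq hN hwp.1) su.
have sqw' := summable_sqB mw' mu_ (C1_compact_summable_sq hN hwp') su.
(* Replaces [w p] by [w' p] in the pairing with Y: both are close to u in L^2. *)
have b1 : I (fun x => w p x * Y x) <= I (fun x => w' p x * Y x) +
    eta / 2 * I (fun x => Y x ^+ 2) + (2 * eta)^-1 *
    (2 * I (fun x => (w p x - u x) ^+ 2) + 2 * I (fun x => (w' p x - u x) ^+ 2)).
  have z1 := summableZ mD (eta / 2) sY; have z2 := summableZ mD 2 sqw.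
  have z3 := summableZ mD 2 sqw'; have z4 := summableD mD z2 z3.
  have z5 := summableZ mD (2 * eta)^-1 z4; have z6 := summableD mD spY' z1.
  rewrite -(intZ mD _ sqw) -(intZ mD _ sqw') -(intD mD z2 z3) -(intZ mD _ sY) -(intZ mD _ z4).
  rewrite -(intD mD spY' z1) -(intD mD z6 z5).
  apply: (le_int mD spY (summableD mD z6 z5)) => x _.
  have := young_mul (Y x) (w p x - w' p x) eta0.
  have : (2 * eta)^-1 * (w p x - w' p x) ^+ 2 <=
     (2 * eta)^-1 * (2 * (w p x - u x) ^+ 2 + 2 * (w' p x - u x) ^+ 2).
    apply: ler_wpM2l; first by rewrite invr_ge0; lra.
    by have := sqr_ge0 ((w p x - u x) + (w' p x - u x)); lra.
  lra.
(* The pairing is turned back into one of twisted gradients, and that of [w' p] is small. *)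
have b2 : I (fun x => w' p x * Y x) <= eta / 2 * I (G (w n)) + (2 * eta)^-1 * I (G (w' p)).
  rewrite -EpY'; have z1 := summableZ mD (eta / 2) sGn.
  have z2 := summableZ mD (2 * eta)^-1 sGp'.
  rewrite -(intZ mD _ sGn) -(intZ mD _ sGp') -(intD mD z1 z2).
  apply: (le_int mD sp' (summableD mD z1 z2)) => x /cut1/andP[c0 c1].
  rewrite !twist_sqE !mulr_sumr -big_split/=; apply: ler_sum => i _.
  have sq1 (y : R) : (cutoff eps x * y) ^+ 2 <= y ^+ 2 by apply: sqr_contract.
  apply: (le_trans (young_mul _ _ eta0)); apply: lerD; apply: ler_wpM2l => //.
    by rewrite divr_ge0// ltW.
  by rewrite invr_ge0; lra.
have sn' : sm (fun x => \sum_(i < N) (cutoff eps x * twist k a i (w n) x) ^+ 2).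
  by apply: (eq_summable mD _ sn) => x _; apply: eq_bigr => i _; rewrite expr2.
(* From |y|^2 = |y - z|^2 + 2 y . z - |z|^2, with the Cauchy condition for the first term. *)
have b3 : I (fun x => \sum_(i < N) (cutoff eps x * twist k a i (w n) x) ^+ 2) <=
    I (G (fun x => w n x - w p x)) + 2 * I (fun x => w p x * Y x).
  rewrite -EpY; have z1 := summableZ mD 2 sp.
  rewrite -(intZ mD _ sp) -(intD mD sGnp z1).
  apply: (le_int mD sn' (summableD mD sGnp z1)) => x /cut1/andP[c0 c1].
  rewrite !twist_sqE !mulr_sumr -big_split/=; apply: ler_sum => i _.
  rewrite (twistB hwn.1 hwp.1); set s := cutoff eps x in c0 c1 *.
  set y := twist _ _ _ (w n) x; set z := twist _ _ _ (w p) x.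
  apply: (@le_trans _ _ ((s * (y - z)) ^+ 2 + 2 * (s * y * (s * z)))).
    by have := sqr_ge0 (s * z); lra.
  by rewrite lerD2r; exact: sqr_contract.
have b4 : (2 * eta)^-1 * (2 * I (fun x => (w p x - u x) ^+ 2) + 2 * I (fun x => (w' p x - u x) ^+ 2)
    + I (G (w' p))) <= eta / 2.
  rewrite mulrC ler_pdivrMr; last by lra.
  by rewrite (le_trans tp)// (_ : _ * (2 * _) = eta ^+ 2)//; field.
have b5 : eta * C = t by rewrite /eta divfK// gt_eqF.
rewrite /C in b5; move: b1 b2 b3 b4 b5 Gp; lra.
Qed.

End energy.

(** * A smooth bump function *)

Section smooth1.
Variable R : realType.
Implicit Types (F G : R -> R) (x y h t : R).

Fixpoint diffn (n : nat) F : Prop :=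
  if n is n'.+1 then (forall x, derivable F x 1) /\ diffn n' (derive1 F) else True.

Definition smooth1 F := forall n, diffn n F.

Lemma diffn_step n F F' : (forall x : R, is_derive (x : R) 1 F (F' x)) -> diffn n F' -> diffn n.+1 F.
Proof.
move=> dF nF'; split; first by move=> x; have [] := dF x.
by rewrite (_ : (derive1 F) = F')//; apply/funext => x; rewrite derive1E; have [_ ->] := dF x.
Qed.

Lemma is_derive_diffn n F x : diffn n.+1 F -> is_derive (x : R) 1 F ((derive1 F) x).
Proof. by move=> [dF _]; apply: DeriveDef => //; rewrite derive1E. Qed.

Lemma diffnW n F : diffn n.+1 F -> diffn n F.
Proof. by elim: n F => //= n IH F [dF nF]; split => //; exact: IH. Qed.

Lemma diffn_cst n c : diffn n (fun=> c).
Proof.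
elim: n c => // n IH c; apply: (@diffn_step _ _ (fun=> 0)) => // x.
Qed.

Lemma diffn_id n : diffn n (fun x => x).
Proof.
case: n => // n; apply: (@diffn_step _ _ (fun=> 1)); last exact: diffn_cst.
Qed.

Lemma diffnD n F G : diffn n F -> diffn n G -> diffn n (fun x => F x + G x).
Proof.
elim: n F G => // n IH F G nF nG.
apply: (@diffn_step _ _ (fun x => (derive1 F) x + (derive1 G) x)); last exact: IH nF.2 nG.2.
by move=> x; exact: (is_deriveD (is_derive_diffn x nF) (is_derive_diffn x nG)).
Qed.

Lemma diffnM n F G : diffn n F -> diffn n G -> diffn n (fun x => F x * G x).
Proof.
elim: n F G => // n IH F G nF nG.
apply: (@diffn_step _ _ (fun x => F x * (derive1 G) x + G x * (derive1 F) x)).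
  move=> x; have := is_deriveM (is_derive_diffn x nF) (is_derive_diffn x nG).
  exact.
by apply: diffnD; apply: IH; [exact: diffnW|exact: nG.2|exact: diffnW|exact: nF.2].
Qed.

Lemma diffn_comp n F G : diffn n F -> diffn n G -> diffn n (fun x => F (G x)).
Proof.
elim: n F G => // n IH F G nF nG.
apply: (@diffn_step _ _ (fun x => (derive1 F) (G x) * (derive1 G) x)).
  move=> x; have := is_derive1_comp (is_derive_diffn (G x) nF) (is_derive_diffn x nG).
  exact.
by apply: diffnM; [apply: IH; [exact: nF.2|exact: diffnW]|exact: nG.2].
Qed.

Lemma smooth1_cst c : smooth1 (fun=> c). Proof. by move=> n; exact: diffn_cst. Qed.
Lemma smooth1_id : smooth1 (fun x => x). Proof. by move=> n; exact: diffn_id. Qed.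
Lemma smooth1D F G : smooth1 F -> smooth1 G -> smooth1 (fun x => F x + G x).
Proof. by move=> sF sG n; exact: diffnD. Qed.
Lemma smooth1M F G : smooth1 F -> smooth1 G -> smooth1 (fun x => F x * G x).
Proof. by move=> sF sG n; exact: diffnM. Qed.
Lemma smooth1_comp F G : smooth1 F -> smooth1 G -> smooth1 (fun x => F (G x)).
Proof. by move=> sF sG n; exact: diffn_comp. Qed.

Lemma smooth1N F : smooth1 F -> smooth1 (fun x => - F x).
Proof.
move=> /(smooth1M (smooth1_cst (-1))); congr smooth1.
by apply/funext => x; rewrite mulN1r.
Qed.

Lemma smooth1_derive F : smooth1 F -> smooth1 (derive1 F).
Proof. by move=> sF n; exact: (sF n.+1).2. Qed.

Lemma smooth1_is_derive F x : smooth1 F -> is_derive (x : R) 1 F ((derive1 F) x).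
Proof. by move=> sF; exact: is_derive_diffn (sF 1%N). Qed.

Lemma smooth1_continuous F : smooth1 F -> continuous F.
Proof.
move=> sF x; apply: differentiable_continuous; apply/derivable1_diffP.
by have [] := smooth1_is_derive x sF.
Qed.

Lemma smooth1_expR : smooth1 (@expR R).
Proof.
move=> n; elim: n => // n IH; apply: (@diffn_step _ _ (@expR R)) => // x.
Qed.

Lemma is_derive_sq_bound F (C : R) : (forall h, `|F h| <= C * h ^+ 2) -> is_derive (0 : R) 1 F 0.
Proof.
move=> FC; have F0 : F 0 = 0.
  by apply/eqP; rewrite -normr_le0 (le_trans (FC 0))// expr0n mulr0.
suff H : h^-1 *: ((F \o shift 0) (h *: 1) - F 0) @[h --> 0^'] --> (0 : R).
  by apply: DeriveDef; [apply/cvg_ex; exists 0|exact: cvg_lim].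
rewrite F0; apply/cvgrPdist_le => e e0; near=> h.
have h0 : h != 0 by near: h; exact: nbhs_dnbhs_neq.
have hC : `|h| <= e / (`|C| + 1).
  near: h; apply: dnbhs0_le; rewrite divr_gt0// ltr_wpDl//.
rewrite sub0r normrN /= subr0 addr0 [h *: 1]mulr1 normrM normfV.
rewrite ler_pdivrMl ?normr_gt0//; apply: (le_trans (FC h)).
have -> : h ^+ 2 = `|h| ^+ 2 by rewrite real_normK// num_real.
rewrite expr2 mulrCA; apply: ler_wpM2l => //.
apply: (@le_trans _ _ ((`|C| + 1) * `|h|)).
  by apply: ler_wpM2r => //; rewrite (le_trans (ler_norm _))// lerDl.
by rewrite mulrC -ler_pdivlMr// ltr_wpDl.
Unshelve. all: by end_near. Qed.

(** The functions x^-k e^(-1/x), extended by 0. Differentiation maps this family to its own linear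
    combinations, so all of them are shown smooth in one induction. *)
Definition flat (k : nat) x : R := if 0 < x then x^-1 ^+ k * expR (- x^-1) else 0.

(** With y = 1 / h, the exponential series gives e^y >= y^(k+2) / (k+2)!. The quadratic bound makes
    the derivative at 0 exist and vanish. *)
Lemma flat_bound k h : `|flat k h| <= (k.+2)`!%:R * h ^+ 2.
Proof.
rewrite /flat; case: ifPn => [h0|_]; last by rewrite normr0 mulr_ge0 ?sqr_ge0.
rewrite ger0_norm; last by rewrite mulr_ge0 ?expR_ge0// exprn_ge0// invr_ge0 ltW.
have y0 : 0 < h^-1 by rewrite invr_gt0.
have -> : h ^+ 2 = h^-1^-1 ^+ 2 by rewrite invrK.
have := expR_ge1Dxn k.+1 (ltW y0); move: h^-1 y0 => y y0 yE.
have H : y ^+ k.+2 <= expR y * (k.+2)`!%:R.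
  by rewrite -ler_pdivrMr ?ltr0n ?fact_gt0// (le_trans _ yE)// lerDr.
rewrite expRN ler_pdivrMr ?expR_gt0//.
have -> : y ^+ k = y ^+ k.+2 * y^-1 ^+ 2.
  by rewrite -addn2 exprD -mulrA -exprMn mulfV ?expr1n ?mulr1// gt_eqF.
by rewrite [leRHS]mulrAC; apply: ler_wpM2r; [exact: sqr_ge0|rewrite mulrC].
Qed.

Lemma is_derive_flat k x : is_derive (x : R) 1 (flat k) (- k%:R * flat k.+1 x + flat k.+2 x).
Proof.
have [x0|x0|->] := ltgtP x 0.
- rewrite /flat ltNge (ltW x0)/= mulr0 addr0.
  apply: (near_eq_is_derive _ (is_derive_cst (0 : R) x (1 : R))).
  near=> y; rewrite ifF//; apply/negbTE; rewrite -leNgt ltW//.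
  by near: y; exact: lt_nbhsl.
- have xn0 : x != 0 by rewrite gt_eqF.
  rewrite /flat x0.
  have dV : is_derive (x : R) 1 (fun y : R => y^-1) (- (x ^+ 2)^-1).
    by have := @is_deriveV R id x 1 1 xn0 (is_derive_id _ _); rewrite [_ *: 1]mulr1.
  have dX := is_deriveX k dV; rewrite exprfctE in dX.
  have dE : is_derive (x : R) 1 (fun y : R => expR (- y^-1)) (expR (- x^-1) * (x ^+ 2)^-1).
    have dN := is_deriveN dV; rewrite opprK in dN.
    have := @is_derive1_comp _ (@expR R) (fun y : R => - y^-1) x _ _ (is_derive_expR _) dN; exact.
  have dM := is_deriveM dX dE.
  apply: (@near_eq_is_derive _ _ _ (fun y : R => y^-1 ^+ k * expR (- y^-1))).
    near=> y; rewrite ifT//; near: y; exact: lt_nbhsr.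
  apply: (is_derive_eq dM) => /=; rewrite /GRing.scale/=.
  rewrite -exprVn; set E := expR _; set q := x^-1; clearbody E q.
  by case: k {dX dM} => [|k] /=; [rewrite expr0 expr1|rewrite !exprS]; ring.
- rewrite /flat ltxx mulr0 addr0; exact: is_derive_sq_bound (flat_bound k).
Unshelve. all: by end_near. Qed.

Lemma smooth1_flat k : smooth1 (flat k).
Proof.
move=> n; elim: n k => // n IH k; apply: (diffn_step (is_derive_flat k)).
by apply: diffnD => //; apply: diffnM => //; exact: diffn_cst.
Qed.

(* equal to 1 at 0, with values in [0, 1] and support [-1, 1] *)
Definition bump y : R := expR 1 * flat 0 (1 - y ^+ 2).

Lemma smooth1_bump : smooth1 bump.
Proof.
apply: smooth1M; first exact: smooth1_cst.
apply: smooth1_comp; first exact: smooth1_flat.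
apply: smooth1D; first exact: smooth1_cst.
exact: (smooth1N (smooth1M smooth1_id smooth1_id)).
Qed.

Lemma bump0 : bump 0 = 1.
Proof. by rewrite /bump /flat expr0n subr0 ltr01 expr0 mul1r invr1 -expRD subrr expR0. Qed.

Lemma bump_ge0 y : 0 <= bump y.
Proof.
rewrite /bump mulr_ge0 ?expR_ge0// /flat; case: ifP => // h.
by rewrite expr0 mul1r expR_ge0.
Qed.

Lemma bump_le1 y : bump y <= 1.
Proof.
rewrite /bump /flat; case: ifP => h; last by rewrite mulr0.
rewrite expr0 mul1r -expRD; apply: (@le_trans _ _ (expR 0)); last by rewrite expR0.
rewrite ler_expR subr_le0 invf_ge1//.
by rewrite lerBlDr lerDl sqr_ge0.
Qed.

Lemma bump_off y : 1 < `|y| -> bump y = 0.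
Proof.
move=> y1; rewrite /bump /flat ifF ?mulr0//; apply/negbTE; rewrite -leNgt subr_le0.
by rewrite -real_normK ?num_real// exprn_ege1// ltW.
Qed.

Lemma derive_off F (A : set R) : open A -> (forall y, A y -> F y = 0) ->
  forall y, A y -> (derive1 F) y = 0.
Proof.
move=> oA F0 y Ay; rewrite derive1E.
have : is_derive (y : R) 1 F 0.
  apply: (near_eq_is_derive _ (is_derive_cst (0 : R) y (1 : R))).
  by apply: filterS (open_nbhs_nbhs (conj oA Ay)) => z /F0 ->.
by move=> /@derive_val.
Qed.

Lemma dbump_off y : 1 < `|y| -> (derive1 bump) y = 0.
Proof.
apply: (@derive_off bump [set y | 1 < `|y|]); last exact: bump_off.
by apply: open_comp (@open_gt _ 1) => z _; exact: norm_continuous.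
Qed.

Lemma dbump_bounded : exists2 C, 0 <= C & forall y, `|(derive1 bump) y| <= C.
Proof.
have cb : continuous (derive1 bump) by apply: smooth1_continuous; apply: smooth1_derive; exact: smooth1_bump.
have [M [_ MP]] := compact_bounded (continuous_compact (continuous_subspaceT cb) (@segment_compact R (-1) 1)).
exists (`|M| + 1); first by rewrite addr_ge0.
move=> y; have [y1|y1] := ltP 1 `|y|; first by rewrite dbump_off// normr0 addr_ge0.
apply: (MP (`|M| + 1)); first by rewrite (le_lt_trans (ler_norm _))// ltrDl.
by exists y => //=; rewrite in_itv/= -ler_norml.
Qed.

Definition log_ext (K : R -> R) t : R := if 0 < t then K (ln t) else 0.

Lemma log_ext_near (K : R -> R) A t : (forall y, y < A -> K y = 0) -> t <= 0 ->
  \forall s \near t, cst 0 s = log_ext K s.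
Proof.
move=> KA t0; near=> s; rewrite /log_ext; case: ifPn => // s0.
rewrite KA// -(expRK A) ltr_ln ?posrE ?expR_gt0//.
by near: s; apply: lt_nbhsl; exact: le_lt_trans t0 (expR_gt0 _).
Unshelve. all: by end_near. Qed.

(** As 1 / t = e^(- ln t), the derivative is again of the form [log_ext], for a function that is
    smooth and vanishes on the same half-line; smoothness follows by induction. *)
Lemma is_derive_log_ext (K : R -> R) A t : smooth1 K -> (forall y, y < A -> K y = 0) ->
  is_derive (t : R) 1 (log_ext K) (log_ext (fun y => (derive1 K) y * expR (- y)) t).
Proof.
move=> sK KA; have [t0|t0] := leP t 0.
  rewrite [log_ext _ t]/log_ext ltNge t0/=.
  exact: (near_eq_is_derive (log_ext_near KA t0) (is_derive_cst (0 : R) t (1 : R))).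
rewrite [log_ext _ t]/log_ext t0 expRN lnK ?posrE//.
apply: (@near_eq_is_derive _ _ _ (K \o @ln R)).
  by near=> s; rewrite /log_ext ifT//; near: s; exact: lt_nbhsr.
exact: (is_derive1_comp (smooth1_is_derive _ sK) (is_derive1_ln t0)).
Unshelve. all: by end_near. Qed.

Lemma smooth1_log_ext (K : R -> R) A : smooth1 K -> (forall y, y < A -> K y = 0) ->
  smooth1 (log_ext K).
Proof.
move=> sK KA n; elim: n K sK KA => // n IH K sK KA.
apply: (diffn_step (fun t => is_derive_log_ext t sK KA)); apply: IH.
  apply: smooth1M; first exact: smooth1_derive.
  exact: (smooth1_comp smooth1_expR (smooth1N smooth1_id)).
move=> y yA; rewrite (@derive_off K [set y | y < A])// ?mul0r//.
Qed.

End smooth1.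

Section smooth_rV.
Variables (R : realType) (N : nat).
Implicit Types (u v : 'rV[R]_N -> R) (i j : 'I_N).

(** A class stable under partial derivatives, so that smoothness reduces to one continuous
    derivative along each axis. *)
Inductive elementary : ('rV[R]_N -> R) -> Prop :=
| elementary_cst c : elementary (fun=> c)
| elementary_coord j : elementary (fun x => x ord0 j)
| elementaryD u v : elementary u -> elementary v -> elementary (fun x => u x + v x)
| elementaryM u v : elementary u -> elementary v -> elementary (fun x => u x * v x)
| elementary_comp (F : R -> R) u : smooth1 F -> elementary u -> elementary (fun x => F (u x)).

Lemma elementary_C1_along i u : elementary u -> exists2 du, elementary du & C1_along setT i u du.
Proof.
elim => {u} [c|j|u v eu [du edu u1] ev [dv edv v1]|u v eu [du edu u1] ev [dv edv v1]|F u sF eu [du edu u1]].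
- by exists (fun=> 0); [exact: elementary_cst|exact: C1_along_cst].
- by exists (fun=> (i == j)%:R); [exact: elementary_cst|exact: C1_along_coord].
- by exists (fun x => du x + dv x); [exact: elementaryD|exact: C1_along_add].
- exists (fun x => du x * v x + u x * dv x); last exact: C1_along_mul.
  by apply: elementaryD; exact: elementaryM.
- exists (fun x => derive1 F (u x) * du x).
    apply: elementaryM => //; apply: elementary_comp => //; exact: smooth1_derive.
  apply: C1_along_comp => // x _; split; first exact: smooth1_is_derive.
  by apply: smooth1_continuous; exact: smooth1_derive.
Qed.

Lemma C1_along_partial Om i u du : C1_along Om i u du -> forall x, Om x -> partial i u x = du x.
Proof. by move=> u1 x Ox; have [_ du' _] := u1 x Ox; exact: derive_val. Qed.

Lemma elementary_partial i u : elementary u -> elementary (partial i u).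
Proof.
move=> /(elementary_C1_along i)[du edu u1]; rewrite (_ : partial i u = du)//.
by apply/funext => x; exact: C1_along_partial u1 x Logic.I.
Qed.

Lemma elementary_smooth u : (0 < N)%N -> elementary u -> smooth u.
Proof.
move=> N0 eu s; have {eu} : elementary (foldr (@partial R N) u s).
  by elim: s => //= i s; exact: elementary_partial.
move: (foldr _ _ _) => {s}v ev; split => [x|i x].
  by have [dv _ v1] := elementary_C1_along (Ordinal N0) ev; have [] := v1 x Logic.I.
by have [dv _ v1] := elementary_C1_along i ev; have [_ []] := v1 x Logic.I.
Qed.

Lemma elementary_sum (J : Type) (r : seq J) (f : J -> 'rV[R]_N -> R) :
  (forall l, elementary (f l)) -> elementary (fun x => \sum_(l <- r) f l x).
Proof.
move=> ef; elim: r => [|l r IH].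
  by under eq_fun do rewrite big_nil; exact: elementary_cst.
by under eq_fun do rewrite big_cons; exact: elementaryD.
Qed.

Lemma elementary_prod (J : Type) (r : seq J) (f : J -> 'rV[R]_N -> R) :
  (forall l, elementary (f l)) -> elementary (fun x => \prod_(l <- r) f l x).
Proof.
move=> ef; elim: r => [|l r IH].
  by under eq_fun do rewrite big_nil; exact: elementary_cst.
by under eq_fun do rewrite big_cons; exact: elementaryM.
Qed.

Lemma elementary_sqn : elementary (@sqn R N).
Proof. by apply: elementary_sum => j; apply: elementaryM; exact: elementary_coord. Qed.

End smooth_rV.

Section profile.
Variables (R : realType).
Implicit Types (q t y : R) (n : nat).

Definition logbump q n y : R := expR (q * y) * bump (n.+1%:R^-1 * y).
(** For t > 0 this is t^q times a cut-off of ln t at scale n + 1; it is smooth on the line for every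
    real q. *)
Definition profile q n : R -> R := log_ext (logbump q n).

Lemma smooth1_logbump q n : smooth1 (logbump q n).
Proof.
apply: smooth1M.
  by apply: (smooth1_comp (@smooth1_expR R)); apply: smooth1M; [exact: smooth1_cst|exact: smooth1_id].
by apply: (smooth1_comp (@smooth1_bump R)); apply: smooth1M; [exact: smooth1_cst|exact: smooth1_id].
Qed.

Lemma logbump_off q n y : n.+1%:R < `|y| -> logbump q n y = 0.
Proof.
move=> ny; rewrite /logbump bump_off ?mulr0// normrM ger0_norm ?invr_ge0//.
by rewrite ltr_pdivlMl ?mulr1.
Qed.

Lemma smooth1_profile q n : smooth1 (profile q n).
Proof.
apply: (@smooth1_log_ext _ _ (- n.+1%:R)); first exact: smooth1_logbump.
move=> y yn; apply: logbump_off.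
have y0 : y < 0 by apply: lt_trans yn _; rewrite oppr_lt0 ltr0n.
by rewrite (ltr0_norm y0) ltrNr.
Qed.

Lemma profile_gt0 q n t : 0 < t -> profile q n t = expR (q * ln t) * bump (n.+1%:R^-1 * ln t).
Proof. by move=> t0; rewrite /profile /log_ext t0. Qed.

Lemma profile_neq0 q n t : profile q n t != 0 -> 0 < t /\ `|ln t| <= n.+1%:R.
Proof.
rewrite /profile /log_ext; case: ifPn => [t0 h|]; last by rewrite eqxx.
by split => //; rewrite leNgt; apply: contraNN h => /logbump_off ->.
Qed.

Lemma profile_ge0 q n t : 0 <= profile q n t.
Proof.
rewrite /profile /log_ext; case: ifP => // _.
by rewrite mulr_ge0 ?expR_ge0 ?bump_ge0.
Qed.

Lemma profile_le q n t : 0 < t -> profile q n t <= expR (q * ln t).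
Proof. by move=> t0; rewrite profile_gt0// ler_piMr ?expR_ge0 ?bump_le1. Qed.

(** The contribution of the cut-off to t times the derivative of [profile]. After twisting, nothing
    else is left. *)
Definition dprofile q n t : R := n.+1%:R^-1 * expR (q * ln t) * derive1 (@bump R) (n.+1%:R^-1 * ln t).

Lemma is_derive_profile q n t : 0 < t ->
  is_derive t 1 (profile q n) ((q * profile q n t + dprofile q n t) / t).
Proof.
move=> t0.
have dK y : is_derive y 1 (logbump q n) (q * logbump q n y +
    n.+1%:R^-1 * expR (q * y) * derive1 (@bump R) (n.+1%:R^-1 * y)).
  have d1 : is_derive y 1 (fun y => q * y) q.
    by have := is_deriveZ q (is_derive_id y (1 : R)); rewrite [_ *: 1]mulr1.
  have d2 : is_derive y 1 (fun y => n.+1%:R^-1 * y) n.+1%:R^-1.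
    by have := is_deriveZ n.+1%:R^-1 (is_derive_id y (1 : R)); rewrite [_ *: 1]mulr1.
  have d3 := is_derive1_comp (is_derive_expR (q * y)) d1.
  have d4 := is_derive1_comp (smooth1_is_derive (n.+1%:R^-1 * y) (@smooth1_bump R)) d2.
  have := is_deriveM d3 d4; rewrite [X in is_derive _ _ _ X -> _](_ : _ = (q * logbump q n y +
    n.+1%:R^-1 * expR (q * y) * derive1 (@bump R) (n.+1%:R^-1 * y)))//.
  by rewrite /logbump /GRing.scale/=; ring.
apply: (@near_eq_is_derive _ _ _ (logbump q n \o @ln R)).
  by near=> s; rewrite /profile /log_ext ifT//; near: s; exact: lt_nbhsr.
rewrite /profile /log_ext t0.
exact: (is_derive1_comp (dK (ln t)) (is_derive1_ln t0)).
Unshelve. all: by end_near. Qed.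

End profile.

(** * Approximation of alpha by test functions *)

Section approximants.
Variables (R : realType) (N k : nat) (lam : R).
Hypotheses (hN : (2 <= N)%N) (hk : (k <= N)%N) (hlam : lam <= hardy_const R N k).
Implicit Types (u v f g : 'rV[R]_N -> R) (x : 'rV[R]_N) (i j : 'I_N) (n : nat).
Local Notation mu := (lebesgue_rV R N).
Local Notation Om := (@orthant R N k).
Local Notation D := (@punctured R N k).
Local Notation sm := (summable_on mu D).
Local Notation I f := (\int[mu]_(x in D) f x).
Local Notation mD := (@measurable_punctured R N k).
Local Notation m := (m_lam N k lam).
Local Notation a := (alpha_exp N k lam).
Local Notation G u := (twist_sq k a 0 u).
Local Notation hardy_fin u := (sm (fun x => a * (u x ^+ 2 / sqn x))).

Definition is_edge j := (N - k <= j)%N.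

(** A cut-off of x_j that stays away from the face x_j = 0, as a test function on the orthant
    must. *)
Definition wall n j (t : R) : R := if is_edge j then profile 1 n t else 1.

Definition walls n x : R := \prod_(j < N) wall n j (x ord0 j).

(* The cut-offs act on the logarithms of |x|^2 and of the x_j, at scale n. Hence
   the squared twisted gradient is O(n^-2 |x|^-N) and supported in
   e^-n <= |x|^2 <= e^n, where |x|^-N has integral O(n): this handles the
   critical case m = 0 as well. *)
Definition approximant n x : R :=
  expR (- 8^-1 * sqn x) * profile (a / 2) n (sqn x) * walls n x.

Lemma approximant_smooth n : smooth (approximant n).
Proof.
apply: elementary_smooth; first exact: ltnW.
have es := elementary_sqn R N.
apply: elementaryM; first apply: elementaryM.
- apply: (elementary_comp (F := @expR R)); first exact: smooth1_expR.
  by apply: elementaryM => //; exact: elementary_cst.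
- by apply: elementary_comp => //; exact: smooth1_profile.
apply: elementary_prod => j; rewrite /wall; case: (is_edge j); last exact: elementary_cst.
by apply: elementary_comp; [exact: smooth1_profile|exact: elementary_coord].
Qed.

Lemma approximant_neq0 n x : approximant n x != 0 ->
  [/\ 0 < sqn x, `|ln (sqn x)| <= n.+1%:R &
   forall j, is_edge j -> 0 < x ord0 j /\ `|ln (x ord0 j)| <= n.+1%:R].
Proof.
rewrite /approximant !mulf_eq0 !negb_or => /andP[/andP[_ /profile_neq0[s0 sn]] h].
split => // j ej; apply: (@profile_neq0 _ 1 n).
by move: h; rewrite /walls => /prodf_neq0/(_ j isT); rewrite /wall ej.
Qed.

(** A compact box inside the orthant. The crude bound 1 + e^(n+1) on |x_j| follows from x_j^2 <=
    e^(n+1) without square roots. *)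
Definition box n j : set R :=
  if is_edge j then `[expR (- n.+1%:R), 1 + expR n.+1%:R]%classic
  else `[- (1 + expR n.+1%:R), 1 + expR n.+1%:R]%classic.

Lemma approximant_box n x : approximant n x != 0 -> forall j, box n j (x ord0 j).
Proof.
move=> /approximant_neq0[s0 sn xj] j.
have xs : `|x ord0 j| <= 1 + expR n.+1%:R.
  have : x ord0 j ^+ 2 <= expR n.+1%:R.
    apply: (@le_trans _ _ (sqn x)).
      by rewrite /sqn (bigD1 j)//= lerDl sumr_ge0// => i _; exact: sqr_ge0.
    rewrite -[leLHS]lnK ?posrE// ler_expR.
    by move: sn; rewrite ler_norml => /andP[].
  rewrite -(real_normK (num_real _)) => h; have := sqr_ge0 (`|x ord0 j| - 1).
  have := normr_ge0 (x ord0 j); have := expR_gt0 (n.+1%:R : R); nra.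
rewrite /box; case: ifPn => ej; rewrite /= in_itv/=; last by rewrite -ler_norml.
have [x0 lx] := xj j ej; apply/andP; split; last by rewrite (le_trans (ler_norm _)).
rewrite -[leRHS]lnK ?posrE// ler_expR.
by move: lx; rewrite ler_norml => /andP[].
Qed.

Lemma approximant_test n : test_fun Om (approximant n).
Proof.
have cB : compact [set x : 'rV[R]_N | forall j, box n j (x ord0 j)].
  apply: rV_compact => j; rewrite /box; case: ifP => _; exact: segment_compact.
have sB : closure [set x | approximant n x != 0] `<=` [set x : 'rV[R]_N | forall j, box n j (x ord0 j)].
  have -> : [set x : 'rV[R]_N | forall j, box n j (x ord0 j)] = closure [set x : 'rV[R]_N | forall j, box n j (x ord0 j)].
    by apply/closure_id; apply: compact_closed => //; exact: norm_hausdorff.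
  by apply: closure_subset => x; exact: approximant_box.
split; first exact: approximant_smooth.
  by apply: subclosed_compact cB sB; exact: closed_closure.
move=> x /sB xB j ej; have := xB j; rewrite /box /is_edge ej/= in_itv/= => /andP[+ _].
by apply: lt_le_trans; exact: expR_gt0.
Qed.

Lemma approximant_hardy_fin n : hardy_fin (approximant n).
Proof.
have hw := test_C1_compact (approximant_test n).
apply: (summable_le mD (g := fun x => `|a| * (expR n.+1%:R * approximant n x ^+ 2))).
- apply: measurable_funM; first exact: measurable_cst.
  apply: measurable_funM; last exact: measurable_inv_sqn.
  by apply: measurable_funX; exact: C1_compact_measurable hw.
- move=> x Dx; have s0 := punctured_sqn_gt0 Dx.
  rewrite normrM; apply: ler_wpM2l => //.
  rewrite ger0_norm ?divr_ge0 ?sqr_ge0 ?(ltW s0)// mulrC.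
  have [->|/approximant_neq0[_ sn _]] := eqVneq (approximant n x) 0; first by rewrite expr0n !mulr0.
  apply: ler_wpM2r; first exact: sqr_ge0.
  have -> : (sqn x)^-1 = expR (- ln (sqn x)) by rewrite expRN lnK.
  by rewrite ler_expR (le_trans (ler_norm _))// normrN.
- by apply: (summableZ mD); apply: (summableZ mD); exact: C1_compact_summable_sq hw.
Qed.

Lemma is_derive_walls n i x : Om x ->
  is_derive x (delta_mx ord0 i) (walls n)
    ((if is_edge i then (profile 1 n (x ord0 i) + dprofile 1 n (x ord0 i)) / x ord0 i else 0)
     * \prod_(j < N | j != i) wall n j (x ord0 j)).
Proof.
move=> Ox; set C := \prod_(j < N | j != i) _; apply/is_derive_lineP.
have -> : (fun t : R => walls n (x + t *: delta_mx ord0 i)) =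
    (fun t => wall n i (x ord0 i + t *: 1) * C).
  apply/funext => t; rewrite /walls (bigD1 i)//=; congr (_ * _).
    by rewrite !mxE !eqxx.
  by apply: eq_bigr => j ji; rewrite !mxE (negbTE ji) andbF mulr0 addr0.
have dw : is_derive (0 : R) 1 (fun t => wall n i (x ord0 i + t *: 1))
   (if is_edge i then (profile 1 n (x ord0 i) + dprofile 1 n (x ord0 i)) / x ord0 i else 0).
  apply/is_derive_lineP; rewrite /wall; case: ifPn => ei; last exact: is_derive_cst.
  by have := is_derive_profile 1 n (Ox i ei); rewrite mul1r.
apply: (is_derive_eq (is_deriveM dw (is_derive_cst C (0 : R) (1 : R)))).
by rewrite scaler0 add0r [LHS]mulrC.
Qed.

(** If w is alpha times a cut-off phi, then grad w - F w = alpha grad phi: the terms that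
    differentiate alpha cancel and only those with [dprofile] remain. *)
Lemma twist_approximant n i x : D x ->
  twist k a i (approximant n) x = expR (- 8^-1 * sqn x) *
   (2 * x ord0 i / sqn x * dprofile (a / 2) n (sqn x) * walls n x +
    edge R k i * (profile (a / 2) n (sqn x) *
       ((dprofile 1 n (x ord0 i)) / x ord0 i * \prod_(j < N | j != i) wall n j (x ord0 j)))).
Proof.
move=> Dx; have [Ox _] := Dx; have s0 := punctured_sqn_gt0 Dx.
have ds : is_derive x (delta_mx ord0 i) (@sqn R N) (2 * x ord0 i).
  by have [] := @C1_along_sqn R N setT i x Logic.I.
have d1 := is_derive_comp_line ds (is_derive_profile (a / 2) n s0).
have dE : is_derive (sqn x) 1 (fun t : R => expR (- 8^-1 * t)) (expR (- 8^-1 * sqn x) * - 8^-1).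
  have d1' : is_derive (sqn x) 1 (fun t : R => - 8^-1 * t) (- 8^-1).
    by have := is_deriveZ (- 8^-1) (is_derive_id (sqn x) (1 : R)); rewrite [_ *: 1]mulr1.
  exact: (is_derive1_comp (is_derive_expR _) d1').
have d2 := is_derive_comp_line ds dE.
have dw := is_deriveM (is_deriveM d2 d1) (is_derive_walls n i Ox).
set E := expR _; set p := profile (a / 2) n (sqn x) in d1 dw *.
set dp := dprofile (a / 2) n (sqn x) in d1 dw *; set C := \prod_(j < N | j != i) _ in dw *.
have {}dw : is_derive x (delta_mx ord0 i) (approximant n)
   (E * p * ((if is_edge i then (profile 1 n (x ord0 i) + dprofile 1 n (x ord0 i)) / x ord0 i else 0) * C) +
    walls n x * (E * ((a / 2 * p + dp) / sqn x * (2 * x ord0 i)) + p * (E * - 8^-1 * (2 * x ord0 i)))).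
  exact: dw.
rewrite /twist /partial (derive_val (is_derive := dw)) /drift addr0 /edge /approximant.
rewrite -/E -/p {dw d1 d2 dE ds}.
rewrite /walls (bigD1 i)//= -/C /wall /is_edge.
move: (sqn x) s0 (Ox i) => s s0.
have [ei /(_ isT) x0|_ _] := leqP (N - k) i.
  set P1 := profile 1 n _; set D1 := dprofile 1 n _; clearbody P1 D1 E C dp p.
  by rewrite -[(nat_of_bool true)%:R]/(1 : R); field; rewrite !gt_eqF.
clearbody E C dp p.
by rewrite -[(nat_of_bool false)%:R]/(0 : R) !mul0r; field; rewrite gt_eqF.
Qed.

End approximants.

(** * Integrals of |x|^-N over logarithmic shells *)

Section estimates.
Variables (R : realType) (N k : nat) (lam : R).
Hypotheses (hN : (2 <= N)%N) (hk : (k <= N)%N) (hlam : lam <= hardy_const R N k).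
Implicit Types (u v f g : 'rV[R]_N -> R) (x : 'rV[R]_N) (i j : 'I_N) (n : nat).
Local Notation mu := (lebesgue_rV R N).
Local Notation Om := (@orthant R N k).
Local Notation D := (@punctured R N k).
Local Notation sm := (summable_on mu D).
Local Notation I f := (\int[mu]_(x in D) f x).
Local Notation mD := (@measurable_punctured R N k).
Local Notation m := (m_lam N k lam).
Local Notation a := (alpha_exp N k lam).
Local Notation G u := (twist_sq k a 0 u).

(** |x|^-N off the origin, the borderline power at both 0 and infinity: shells of equal logarithmic
    width have equal integrals. *)
Definition rho x : R := expR (- (N%:R / 2) * ln (sqn x)).

Section shells.
Implicit Types l : nat.

(* Dominates |x|^-N on l <= |ln |x|^2| < l + 1, by inscribing the two shells in
   cubes; its integral does not depend on l. *)
Definition shell_bound l x : R :=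
  expR (N%:R / 2 * l.+1%:R) * \1_(@cube R N (expR (- (l%:R / 2)))) x +
  expR (- (N%:R / 2) * l%:R) * \1_(@cube R N (expR (l.+1%:R / 2))) x.

(** Each of the two cubes contributes 2^N e^(N/2): its weight times its volume no longer involves
    l. *)
Definition shell_const : R := 2 * 2 ^+ N * expR (N%:R / 2).

Lemma shell_const_ge0 : 0 <= shell_const.
Proof. by rewrite mulr_ge0 ?expR_ge0// mulr_ge0// exprn_ge0. Qed.

Lemma shell_bound_ge0 l x : 0 <= shell_bound l x.
Proof. by rewrite addr_ge0// mulr_ge0 ?expR_ge0// indicE ler0n. Qed.

Lemma indic_cube M : 0 <= M -> sm (\1_(@cube R N M)) /\ I (\1_(@cube R N M)) <= (2 * M) ^+ N.
Proof.
move=> M0; have mC := @measurable_cube R N M.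
have s1 : sm (\1_(@cube R N M)).
  apply: (@integrableS _ _ _ mu setT) => //; first exact: mD.
  apply: (@integrable_bounded_support R N _ M 1).
  - exact: measurable_indic.
  - by move=> x; rewrite indicE; case: (_ \in _); rewrite ?normr1 ?normr0.
  - move=> x i xi; rewrite indicE memNset//= => /(_ i); rewrite in_itv/= -ler_norml.
    by rewrite leNgt xi.
split => //; rewrite -lee_fin (EFin_int mD s1) integral_indic//; last exact: mD.
by rewrite -(lebesgue_rV_cube _ M0); apply: le_measure; rewrite ?inE//; exact: measurableI mC mD.
Qed.

Lemma int_shell_bound l : sm (shell_bound l) /\ I (shell_bound l) <= shell_const.
Proof.
have [s1 I1] := indic_cube (expR_ge0 (- (l%:R / 2))).
have [s2 I2] := indic_cube (expR_ge0 (l.+1%:R / 2)).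
have z1 := summableZ mD (expR (N%:R / 2 * l.+1%:R)) s1.
have z2 := summableZ mD (expR (- (N%:R / 2) * l%:R)) s2.
split; first exact: (summableD mD z1 z2).
rewrite (intD mD z1 z2) (intZ mD _ s1) (intZ mD _ s2).
have -> : shell_const = expR (N%:R / 2 * l.+1%:R) * (2 * expR (- (l%:R / 2))) ^+ N +
   expR (- (N%:R / 2) * l%:R) * (2 * expR (l.+1%:R / 2)) ^+ N.
  rewrite !exprMn -!expRM_natl !(mulrCA (expR _)) -!expRD /shell_const.
  have -> : N%:R / 2 * l.+1%:R + N%:R * - (l%:R / 2) = N%:R / 2 :> R.
    by rewrite -natr1; field.
  have -> : - (N%:R / 2) * l%:R + N%:R * (l.+1%:R / 2) = N%:R / 2 :> R.
    by rewrite -natr1; field.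
  ring.
by apply: lerD; apply: ler_wpM2l => //; exact: expR_ge0.
Qed.

Lemma coord_le x i : 0 < sqn x -> `|x ord0 i| <= expR (ln (sqn x) / 2).
Proof.
move=> s0; rewrite -(@ler_pXn2r _ 2)// ?nnegrE ?expR_ge0//.
rewrite real_normK ?num_real// -expRM_natl mulrCA mulfV// mulr1 lnK//.
by rewrite /sqn (bigD1 i)//= lerDl sumr_ge0// => j _; exact: sqr_ge0.
Qed.

Lemma cube_ln x M : 0 < sqn x -> ln (sqn x) <= M -> x \in @cube R N (expR (M / 2)).
Proof.
move=> s0 sM; rewrite inE => i; rewrite in_itv/= -ler_norml.
by apply: (le_trans (coord_le i s0)); rewrite ler_expR; lra.
Qed.

Lemma rho_shell l x : D x -> l%:R <= `|ln (sqn x)| < l.+1%:R -> rho x <= shell_bound l x.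
Proof.
move=> /punctured_sqn_gt0 s0 /andP[l1 l2]; rewrite /rho /shell_bound.
have N0 : 0 <= N%:R / 2 :> R by rewrite divr_ge0.
have [y0|y0] := leP (ln (sqn x)) 0.
  rewrite ler0_norm// in l1 l2; apply: ler_wpDr.
    by rewrite mulr_ge0 ?expR_ge0// indicE ler0n.
  have -> : - (l%:R / 2) = - l%:R / 2 :> R by rewrite mulNr.
  rewrite indicE (@cube_ln x (- l%:R))//; last by lra.
  by rewrite mulr1 ler_expR mulNr -mulrN; apply: ler_wpM2l => //; exact: ltW.
rewrite gtr0_norm// in l1 l2; apply: ler_wpDl.
  by rewrite mulr_ge0 ?expR_ge0// indicE ler0n.
rewrite indicE (@cube_ln x l.+1%:R)//; last exact: ltW.
by rewrite mulr1 ler_expR !mulNr lerN2; exact: ler_wpM2l.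
Qed.

Lemma rho_shells n x : D x -> `|ln (sqn x)| < n%:R ->
  rho x <= \sum_(l < n) shell_bound l x.
Proof.
move=> Dx xn; have := truncn_itv (normr_ge0 (ln (sqn x))); set l := Num.truncn _ => lP.
have ln_ : (l < n)%N by rewrite -(ltr_nat R); have /andP[+ _] := lP; move/le_lt_trans; apply.
rewrite (bigD1 (Ordinal ln_))//=; apply: ler_wpDr; last exact: rho_shell.
by apply: sumr_ge0 => ? _; exact: shell_bound_ge0.
Qed.

Lemma measurable_ln_sqn A : measurable_fun A (fun x => ln (sqn x)).
Proof. by apply: measurableT_comp; [exact: measurable_ln|exact: measurable_sqn]. Qed.

Lemma measurable_rho A : measurable_fun A rho.
Proof.
apply: measurableT_comp; first exact: measurable_expR.
by apply: measurable_funM; [exact: measurable_cst|exact: measurable_ln_sqn].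
Qed.

Lemma geometric_sum_le (z : R) n : 0 <= z -> z < 1 -> \sum_(l < n) z ^+ l <= (1 - z)^-1.
Proof.
move=> z0 z1; have z2 : 0 < 1 - z by rewrite subr_gt0.
rewrite -[leRHS]mul1r ler_pdivlMr//.
have -> : (\sum_(l < n) z ^+ l) * (1 - z) = 1 - z ^+ n.
  elim: n => [|n IH]; first by rewrite big_ord0 mul0r expr0 subrr.
  by rewrite big_ord_recr/= mulrDl IH exprS; ring.
by rewrite gerBl exprn_ge0.
Qed.

(** On the l-th shell the exponential factor is at most e^-l, so the integral is dominated by a
    geometric series. This is the integrable majorant used for alpha^2. *)
Lemma summable_rho : sm (fun x => expR (- `|ln (sqn x)|) * rho x).
Proof.
have mY : measurable_fun D (fun x => `|ln (sqn x)|).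
  by apply: measurableT_comp; [exact: normr_measurable|exact: measurable_ln_sqn].
have mE : measurable_fun D (fun x => expR (- `|ln (sqn x)|) * rho x).
  apply: measurable_funM; last exact: measurable_rho.
  apply: measurableT_comp; first exact: measurable_expR.
  by apply: measurableT_comp.
(* Truncation to the first n shells, increasing to the integrand; Fatou applies to it. *)
pose f n x := ((`|ln (sqn x)| < n%:R)%R : nat)%:R * (expR (- `|ln (sqn x)|) * rho x).
pose F n x := \sum_(l < n) expR (-1) ^+ l * shell_bound l x.
have z1 : expR (-1) < 1 :> R by rewrite expR_lt1; lra.
have E0 x : 0 <= expR (- `|ln (sqn x)|) * rho x by rewrite mulr_ge0 ?expR_ge0.
have fF n x : D x -> f n x <= F n x.
  move=> Dx; rewrite /f; case: ltP => [xn|_]; last first.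
    rewrite mul0r; apply: sumr_ge0 => l _.
    by rewrite mulr_ge0 ?exprn_ge0 ?expR_ge0 ?shell_bound_ge0.
  rewrite mul1r; have := truncn_itv (normr_ge0 (ln (sqn x))); set l := Num.truncn _ => lP.
  have ln_ : (l < n)%N by rewrite -(ltr_nat R); have /andP[+ _] := lP; move/le_lt_trans; apply.
  rewrite /F (bigD1 (Ordinal ln_))//=; apply: ler_wpDr.
    apply: sumr_ge0 => ? _.
    by rewrite mulr_ge0 ?exprn_ge0 ?expR_ge0 ?shell_bound_ge0.
  apply: ler_pM; rewrite ?expR_ge0//; last exact: rho_shell.
  by rewrite -expRM_natl mulrN1 ler_expR lerN2; case/andP: lP.
have sF n : sm (F n).
  apply: (summable_sum mD) => l; apply: (summableZ mD); exact: (int_shell_bound l).1.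
have mf n : measurable_fun D (f n).
  apply: measurable_funM => //.
  rewrite (_ : (fun x => _) = (fun b : bool => (b : nat)%:R : R) \o (fun x => `|ln (sqn x)| < n%:R))//.
  apply: measurableT_comp => //; apply: measurable_fun_ltr => //.
have f0 n x : 0 <= f n x by rewrite /f mulr_ge0.
have sf n : sm (f n).
  by apply: (summable_le mD (mf n) _ (sF n)) => x Dx; rewrite ger0_norm// fF.
suff [] : sm (fun x => expR (- `|ln (sqn x)|) * rho x) /\
  I (fun x => expR (- `|ln (sqn x)|) * rho x) <= shell_const / (1 - expR (-1)) by [].
apply: (fatou_int mD sf).
- move=> x Dx; apply: cvg_near_cst.
  exists (Num.truncn `|ln (sqn x)|).+1 => // n /= hn; rewrite /f.
  have /andP[_ h] := truncn_itv (normr_ge0 (ln (sqn x))).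
  have -> : `|ln (sqn x)| < n%:R by apply: (lt_le_trans h); rewrite ler_nat.
  by rewrite mul1r.
- by move=> n x _.
move=> n; apply: (le_trans (le_int mD (sf n) (sF n) (fF n))).
rewrite (int_sum mD); last first.
  by move=> l; apply: (summableZ mD); exact: (int_shell_bound l).1.
apply: (@le_trans _ _ (\sum_(l < n) expR (-1) ^+ l * shell_const)).
  apply: ler_sum => l _; rewrite (intZ mD _ (int_shell_bound l).1).
  by apply: ler_wpM2l; [rewrite exprn_ge0// expR_ge0|exact: (int_shell_bound l).2].
rewrite -mulr_suml mulrC; apply: ler_wpM2l; first exact: shell_const_ge0.
by apply: geometric_sum_le => //; exact: expR_ge0.
Qed.

End shells.

Lemma gauss_pow (p : R) : 0 <= p ->
  exists2 C, 1 <= C & forall s, 0 < s -> expR (- 4^-1 * s) * expR (p * ln s) <= C.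
Proof.
rewrite le_eqVlt => /predU1P[<-|p0].
  exists 1 => // s s0; rewrite mul0r expR0 mulr1 -expR0 ler_expR mulNr oppr_le0.
  by rewrite mulr_ge0// ltW.
(* With this d, ln (d s) <= d s multiplied by p reads p ln d + p ln s <= s / 4. The summand 1 in the
   constant below secures 1 <= C. *)
pose d := (4 * p)^-1; have d0 : 0 < d by rewrite invr_gt0 mulr_gt0.
exists (1 + expR (- (p * ln d))); first by rewrite lerDl expR_ge0.
move=> s s0; rewrite -expRD; apply: ler_wpDl => //; rewrite ler_expR.
have ds : 0 < d * s by rewrite mulr_gt0.
have := ln_sublinear ds; rewrite lnM ?posrE// => h.
have := ler_wpM2l (ltW p0) (ltW h).
have -> : p * (d * s) = 4^-1 * s by rewrite /d; field; rewrite gt_eqF.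
by rewrite mulrDr; lra.
Qed.

End estimates.

(** * Convergence of the approximants to alpha *)

Section convergence.
Variables (R : realType) (N k : nat) (lam : R).
Hypotheses (hN : (2 <= N)%N) (hk : (k <= N)%N) (hlam : lam <= hardy_const R N k).
Implicit Types (u v f g : 'rV[R]_N -> R) (x : 'rV[R]_N) (i j : 'I_N) (n : nat).
Local Notation mu := (lebesgue_rV R N).
Local Notation Om := (@orthant R N k).
Local Notation D := (@punctured R N k).
Local Notation sm := (summable_on mu D).
Local Notation I f := (\int[mu]_(x in D) f x).
Local Notation mD := (@measurable_punctured R N k).
Local Notation m := (m_lam N k lam).
Local Notation a := (alpha_exp N k lam).
Local Notation G u := (twist_sq k a 0 u).
Local Notation w := (@approximant R N k lam).
Local Notation y x := (ln (sqn x)).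

(** The degree of homogeneity of alpha without its Gaussian. *)
Lemma alpha_expE : a + k%:R = m - N%:R / 2 + 1.
Proof. by rewrite /alpha_exp /hardy_root; field. Qed.

Lemma wall_bounds n j x : D x ->
  0 <= wall k n j (x ord0 j) <= expR (edge R k j * (y x / 2)).
Proof.
move=> Dx; have s0 := punctured_sqn_gt0 Dx; rewrite /wall /edge /is_edge.
have [ej|ej] := leqP (N - k) j; last by rewrite mul0r expR0 ler01 lexx.
have x0 : 0 < x ord0 j by case: Dx => + _; exact.
rewrite profile_ge0 mul1r; apply: (le_trans (profile_le _ _ x0)).
rewrite mul1r lnK ?posrE//; apply: le_trans (coord_le j s0); exact: ler_norm.
Qed.

Lemma walls_bounds n x : D x -> 0 <= walls k n x <= expR (k%:R * (y x / 2)).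
Proof.
move=> Dx; apply/andP; split.
  by apply: prodr_ge0 => j _; have /andP[] := wall_bounds n j Dx.
rewrite -(sum_edge R hk) mulr_suml expR_sum.
by apply: ler_prod => j _; exact: wall_bounds.
Qed.

Lemma walls_but_one n i x : D x -> edge R k i = 1 ->
  0 <= \prod_(j < N | j != i) wall k n j (x ord0 j) <= expR ((k%:R - 1) * (y x / 2)).
Proof.
move=> Dx ei; apply/andP; split.
  by apply: prodr_ge0 => j _; have /andP[] := wall_bounds n j Dx.
have -> : k%:R - 1 = \sum_(j < N | j != i) edge R k j.
  by rewrite -(sum_edge R hk) (bigD1 i)//= ei addrAC subrr add0r.
rewrite mulr_suml expR_sum.
by apply: ler_prod => j _; exact: wall_bounds.
Qed.

Lemma dprofile_bound (C q : R) n t : (forall z, `|derive1 (@bump R) z| <= C) ->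
  `|dprofile q n t| <= n.+1%:R^-1 * C * expR (q * ln t).
Proof.
move=> hC; rewrite /dprofile !normrM ger0_norm ?invr_ge0// (ger0_norm (expR_ge0 _)).
rewrite -!mulrA; apply: ler_wpM2l; rewrite ?invr_ge0//.
by rewrite mulrC; apply: ler_wpM2r; [exact: expR_ge0|exact: hC].
Qed.

Lemma dprofile_off (q : R) n t : n.+1%:R < `|ln t| -> dprofile q n t = 0.
Proof.
move=> nt; rewrite /dprofile dbump_off ?mulr0// normrM ger0_norm ?invr_ge0//.
by rewrite ltr_pdivlMl ?mulr1.
Qed.

(** Without its Gaussian alpha has degree a + k, and differentiating a logarithmic cut-off costs a
    factor 1 / ((n + 1) |x|): the exponent is a + k - 1 = m - N / 2. Of the 3, a 2 comes from the
    derivative 2 x_i of |x|^2 and a 1 from the wall in x_i. *)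
Lemma twist_bound C n i x : 0 <= C -> (forall z, `|derive1 (@bump R) z| <= C) -> D x ->
  `|twist k a i (w n) x| <=
    3 * C * n.+1%:R^-1 * (expR (- 8^-1 * sqn x) * expR ((m - N%:R / 2) * (y x / 2))).
Proof.
move=> C0 hC Dx; have s0 := punctured_sqn_gt0 Dx; rewrite twist_approximant//.
set E := expR (- 8^-1 * _); set nu := n.+1%:R^-1.
have nu0 : 0 <= nu by rewrite invr_ge0.
have E0 : 0 <= E by exact: expR_ge0.
have -> : m - N%:R / 2 = a + k%:R - 1 by rewrite alpha_expE; ring.
have sE : sqn x = expR (y x) by rewrite lnK.
have b1 : `|2 * x ord0 i / sqn x * dprofile (a / 2) n (sqn x) * walls k n x| <=
    2 * C * nu * expR ((a + k%:R - 1) * (y x / 2)).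
  have [W0 W1] := andP (walls_bounds n Dx).
  have -> : 2 * C * nu * expR ((a + k%:R - 1) * (y x / 2)) =
     2 * expR (y x / 2) / expR (y x) * (nu * C * expR (a / 2 * y x)) * expR (k%:R * (y x / 2)).
    rewrite -(expRN (y x)).
    have -> : (a + k%:R - 1) * (y x / 2) = y x / 2 + (- y x + (a / 2 * y x + k%:R * (y x / 2))).
      by field.
    by rewrite !expRD; ring.
  rewrite 2!normrM (ger0_norm W0); apply: ler_pM => //.
  apply: ler_pM => //; last exact: dprofile_bound.
  rewrite -sE normrM [`|_^-1|]ger0_norm ?invr_ge0 ?(ltW s0)//.
  apply: ler_wpM2r; first by rewrite invr_ge0 ltW.
  by rewrite normrM ger0_norm//; apply: ler_wpM2l => //; exact: coord_le.
(* No singularity at the face x_i = 0: [dprofile 1] carries a factor x_i, which absorbs 1 / x_i. *)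
have b2 : `|edge R k i * (profile (a / 2) n (sqn x) *
      (dprofile 1 n (x ord0 i) / x ord0 i * \prod_(j < N | j != i) wall k n j (x ord0 j)))| <=
    C * nu * expR ((a + k%:R - 1) * (y x / 2)).
  have [ei|ei] := leqP (N - k) i; last first.
    by rewrite /edge leqNgt ei/= mul0r normr0 mulr_ge0 ?expR_ge0// mulr_ge0.
  have e1 : edge R k i = 1 by rewrite /edge ei.
  have x0 : 0 < x ord0 i by case: Dx => + _; exact.
  have [W0 W1] := andP (walls_but_one n Dx e1).
  rewrite e1 mul1r normrM [`|profile _ _ _|]ger0_norm ?profile_ge0//.
  have -> : C * nu * expR ((a + k%:R - 1) * (y x / 2)) =
     expR (a / 2 * y x) * (nu * C * expR ((k%:R - 1) * (y x / 2))).
    have -> : (a + k%:R - 1) * (y x / 2) = a / 2 * y x + (k%:R - 1) * (y x / 2) by field.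
    by rewrite expRD; ring.
  apply: ler_pM => //; [exact: profile_ge0|exact: profile_le|].
  rewrite normrM (ger0_norm W0); apply: ler_pM => //.
  rewrite normrM [`|_^-1|]ger0_norm ?invr_ge0 ?(ltW x0)// ler_pdivrMr//.
  apply: (le_trans (dprofile_bound _ _ _ hC)).
  by rewrite mul1r lnK.
rewrite normrM (ger0_norm E0) [leRHS]mulrCA; apply: ler_wpM2l => //.
apply: (le_trans (ler_normD _ _)); lra.
Qed.

Lemma twist_off n i x : D x -> n.+1%:R < `|y x| -> twist k a i (w n) x = 0.
Proof.
move=> Dx nx; rewrite twist_approximant// dprofile_off//.
have -> : profile (a / 2) n (sqn x) = 0.
  by apply/eqP; apply: contraTT nx => /profile_neq0[_]; rewrite -leNgt.
by rewrite !(mulr0, mul0r) addr0 mulr0.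
Qed.

(** Squaring [twist_bound] gives e^(-|x|^2/4) |x|^(2m) |x|^-N; by [gauss_pow] the Gaussian absorbs
    |x|^(2m), leaving [rho]. As the support allows |ln |x|^2| = n + 1, the half-open shells are
    taken up to [n.+2]. *)
Lemma twist_sq_approximant_bound : exists2 M, 0 <= M & forall n x, D x ->
  G (w n) x <= M * n.+1%:R^-1 ^+ 2 * \sum_(l < n.+2) shell_bound l x.
Proof.
have [C C0 hC] := dbump_bounded R.
have [C1 C11 hC1] := gauss_pow (m_ge0 N k lam).
have C10 : 0 <= C1 by exact: le_trans C11.
exists (N%:R * (9 * C ^+ 2 * C1)).
  by rewrite mulr_ge0// mulr_ge0// mulr_ge0// sqr_ge0.
move=> n x Dx; have s0 := punctured_sqn_gt0 Dx.
have S0 : 0 <= \sum_(l < n.+2) shell_bound l x.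
  by apply: sumr_ge0 => l _; exact: shell_bound_ge0.
have nu0 : 0 <= n.+1%:R^-1 :> R by rewrite invr_ge0.
have [xn|xn] := ltP n.+1%:R `|y x|.
  rewrite twist_sqE big1 => [|i _]; last by rewrite twist_off// expr0n.
  by rewrite mulr_ge0// mulr_ge0 ?sqr_ge0// mulr_ge0// mulr_ge0// mulr_ge0// sqr_ge0.
have xn2 : `|y x| < n.+2%:R by rewrite (le_lt_trans xn)// ltr_nat.
apply: (@le_trans _ _ (\sum_(i < N) (9 * C ^+ 2 * C1 * n.+1%:R^-1 ^+ 2 * rho x))).
  rewrite twist_sqE; apply: ler_sum => i _.
  apply: (@le_trans _ _ ((3 * C * n.+1%:R^-1 *
      (expR (- 8^-1 * sqn x) * expR ((m - N%:R / 2) * (y x / 2)))) ^+ 2)).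
    rewrite -[leLHS]real_normK ?num_real// ler_pXn2r ?nnegrE//; first exact: twist_bound.
    by rewrite mulr_ge0// ?mulr_ge0 ?expR_ge0.
  have -> : (3 * C * n.+1%:R^-1 * (expR (- 8^-1 * sqn x) * expR ((m - N%:R / 2) * (y x / 2)))) ^+ 2 =
     9 * C ^+ 2 * n.+1%:R^-1 ^+ 2 * ((expR (- 4^-1 * sqn x) * expR (m * y x)) * rho x).
    rewrite /rho !exprMn -!expRM_natl.
    have -> : 2%:R * (- 8^-1 * sqn x) = - 4^-1 * sqn x :> R by field.
    have -> : 2%:R * ((m - N%:R / 2) * (y x / 2)) = m * y x + - (N%:R / 2) * y x by field.
    by rewrite expRD; ring.
  rewrite [leRHS](_ : _ = 9 * C ^+ 2 * n.+1%:R^-1 ^+ 2 * (C1 * rho x)); last by ring.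
  apply: ler_wpM2l; first by rewrite mulr_ge0 ?sqr_ge0// mulr_ge0 ?sqr_ge0.
  by apply: ler_wpM2r; [exact: expR_ge0|exact: hC1].
rewrite sumr_const card_ord -[leLHS]mulr_natl.
have -> : N%:R * (9 * C ^+ 2 * C1 * n.+1%:R^-1 ^+ 2 * rho x) =
  N%:R * (9 * C ^+ 2 * C1) * n.+1%:R^-1 ^+ 2 * rho x by ring.
apply: ler_wpM2l; last exact: (rho_shells Dx xn2).
by rewrite mulr_ge0 ?sqr_ge0// mulr_ge0// mulr_ge0// mulr_ge0 ?sqr_ge0.
Qed.

Lemma twist_sq_approximant_cvg : I (G (w n)) @[n --> \oo] --> 0.
Proof.
have [M M0 hM] := twist_sq_approximant_bound.
have S0 := shell_const_ge0 R N.
(* The 2 bounds (n + 2) / (n + 1), the number of shells times one of the two factors 1 / (n + 1). *)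
have lim0 : M * shell_const R N * 2 * harmonic n @[n --> \oo] --> (0 : R).
  rewrite -[X in _ --> X](mulr0 (M * shell_const R N * 2)); apply: cvgM; first exact: cvg_cst.
  exact: cvg_harmonic.
apply: (squeeze_cvgr _ (@cvg_cst _ 0 _ _ _) lim0); near=> n; apply/andP; split.
  by apply: int_ge0 => x _; apply: sumr_ge0 => i _; exact: sqr_ge0.
have [sG _ _] := form_identity hN hk hlam (test_C1_compact (approximant_test k lam hN n)) (approximant_hardy_fin k lam hN n).
have sS : sm (fun x => \sum_(l < n.+2) shell_bound l x).
  by apply: (summable_sum mD) => l; exact: (int_shell_bound R N k l).1.
apply: (le_trans (le_int mD sG (summableZ mD _ sS) (hM n))).
rewrite (intZ mD _ sS) (int_sum mD); last by move=> l; exact: (int_shell_bound R N k l).1.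
apply: (@le_trans _ _ (M * n.+1%:R^-1 ^+ 2 * (n.+2%:R * shell_const R N))).
  apply: ler_wpM2l; first by rewrite mulr_ge0 ?sqr_ge0.
  apply: (@le_trans _ _ (\sum_(l < n.+2) shell_const R N)).
    by apply: ler_sum => l _; exact: (int_shell_bound R N k l).2.
  by rewrite sumr_const card_ord mulr_natl.
have -> : M * n.+1%:R^-1 ^+ 2 * (n.+2%:R * shell_const R N) =
   M * shell_const R N * harmonic n * (n.+2%:R / n.+1%:R).
  by rewrite /harmonic/=; ring.
rewrite [leRHS]mulrAC; apply: ler_wpM2l.
  by rewrite mulr_ge0 ?invr_ge0// mulr_ge0.
rewrite ler_pdivrMr// -natrM ler_nat; lia.
Unshelve. all: by end_near. Qed.

Local Notation al := (@alpha R N k lam).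
Local Notation prof x := (\prod_(j < N) (if is_edge k j then x ord0 j else 1)).

Lemma enormE x : 0 < sqn x -> enorm x = expR (y x / 2).
Proof.
move=> s0; rewrite /enorm -/(sqn x) -[sqn x in LHS]lnK ?posrE//.
rewrite -[expR _](_ : expR (y x / 2) ^+ 2 = _) ?sqrtr_sqr ?ger0_norm ?expR_ge0//.
by rewrite -expRM_natl mulrCA mulfV// mulr1.
Qed.

Lemma alphaE x : D x -> al x = expR (- 8^-1 * sqn x) * expR (a / 2 * y x) * prof x.
Proof.
move=> /punctured_sqn_gt0 s0; rewrite /alpha enorm_sq enormE// -expRM -expRM_natl -expRN.
rewrite big_mkcond/= /is_edge.
have -> : - (sqn x / 8) = - 8^-1 * sqn x by rewrite mulrC mulNr.
rewrite -!mulrA; congr (_ * _); rewrite mulrCA [in RHS]mulrC; congr (_ * _).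
by rewrite -expRD /alpha_exp /hardy_root; congr expR; field.
Qed.

Definition damping n x : R :=
  bump (n.+1%:R^-1 * y x) * \prod_(j < N) (if is_edge k j then bump (n.+1%:R^-1 * ln (x ord0 j)) else 1).

Lemma approximantE n x : D x -> w n x = al x * damping n x.
Proof.
move=> Dx; have s0 := punctured_sqn_gt0 Dx; rewrite alphaE// /approximant profile_gt0// /damping.
have -> : walls k n x = prof x * \prod_(j < N) (if is_edge k j then bump (n.+1%:R^-1 * ln (x ord0 j)) else 1).
  rewrite /walls -big_split/=; apply: eq_bigr => j _; rewrite /wall.
  case: ifPn => ej; last by rewrite mulr1.
  have x0 : 0 < x ord0 j by case: Dx => + _; exact.
  by rewrite profile_gt0// mul1r lnK.
by ring.
Qed.

Lemma damping_itv n x : 0 <= damping n x <= 1.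
Proof.
have h j : 0 <= (if is_edge k j then bump (n.+1%:R^-1 * ln (x ord0 j)) else 1 : R) <= 1.
  by case: ifP => _; rewrite ?bump_ge0 ?bump_le1 ?ler01 ?lexx.
apply/andP; split.
  by rewrite mulr_ge0 ?bump_ge0//; apply: prodr_ge0 => j _; case/andP: (h j).
apply: mulr_ile1; rewrite ?bump_ge0 ?bump_le1//.
  by apply: prodr_ge0 => j _; case/andP: (h j).
by apply: prodr_ile1 => j _; exact: h.
Qed.

Lemma damping_cvg x : damping n x @[n --> \oo] --> (1 : R).
Proof.
pose P (t : R) := bump (t * y x) * \prod_(j <- index_enum 'I_N) (if is_edge k j then bump (t * ln (x ord0 j)) else 1).
have cb (c : R) : continuous (fun t : R => bump (t * c)).
  apply: smooth1_continuous; apply: (smooth1_comp (@smooth1_bump R)).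
  by apply: smooth1M; [exact: smooth1_id|exact: smooth1_cst].
have cP : continuous P.
  move=> t; apply: cvgM; first exact: cb.
  elim: (index_enum _) => [|j r IH].
    by under eq_fun do rewrite big_nil; rewrite big_nil; exact: cvg_cst.
  under eq_fun do rewrite big_cons; rewrite big_cons; apply: cvgM => //.
  by case: (is_edge k j); [exact: cb|exact: cvg_cst].
have -> : 1 = P 0.
  by rewrite /P mul0r bump0 mul1r big1// => j _; rewrite mul0r bump0 if_same.
apply: (@continuous_cvg _ _ _ _ _ _ P _ (cP _)); exact: cvg_harmonic.
Qed.

Lemma alpha_measurable A : measurable_fun A al.
Proof.
have me : measurable_fun A (@enorm R N).
  apply: measurable_funTS; apply: continuous_measurable_rV => x.
  by apply: continuous_comp; [exact: continuous_sqn|exact: sqrt_continuous].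
have mp q : measurable_fun A (fun x => enorm x `^ q).
  by apply: (measurableT_comp (measurable_powR q) me).
apply: measurable_funM; first apply: measurable_funM => //.
- apply: measurableT_comp; first exact: measurable_expR.
  apply: measurableT_comp => //; apply: measurable_funM => //.
  exact: measurable_funX.
- apply: measurable_funM.
    have -> : (fun x => \prod_(i < N | (N - k <= i)%N) x ord0 i) =
        (fun x => \prod_(i <- index_enum 'I_N) (if (N - k <= i)%N then x ord0 i else 1)).
      by apply/funext => x; rewrite big_mkcond.
    apply: measurable_prod => i _; case: (N - k <= i)%N => //.
    by apply: measurable_funTS; exact: measurable_rV_coord.
  rewrite (_ : (fun x => _) = (fun x => enorm x `^ (- k%:R))) //.
  by apply/funext => x; rewrite powR_invn// sqrtr_ge0.
Qed.

Lemma prof_bounds x : D x -> 0 <= prof x <= expR (k%:R * (y x / 2)).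
Proof.
move=> Dx; have s0 := punctured_sqn_gt0 Dx.
have h j : 0 <= (if is_edge k j then x ord0 j else 1) <= expR (edge R k j * (y x / 2)).
  rewrite /edge /is_edge; have [ej|ej] := leqP (N - k) j; last by rewrite mul0r expR0 ler01 lexx.
  have x0 : 0 < x ord0 j by case: Dx => + _; exact.
  by rewrite ltW// mul1r; apply: le_trans (coord_le j s0); exact: ler_norm.
apply/andP; split; first by apply: prodr_ge0 => j _; case/andP: (h j).
rewrite -(sum_edge R hk) mulr_suml expR_sum.
by apply: ler_prod => j _; exact: h.
Qed.

(** alpha^2 is at most e^(-|x|^2/4) |x|^(2m+2) [rho]. Against e^(-|y|) with y = ln |x|^2, the
    remaining factor is at most e^(m y) <= 1 for y <= 0, and for y > 0 it is e^((m+2) y) times the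
    Gaussian; hence [gauss_pow] at m + 2. *)
Lemma alpha_summable : sm (fun x => al x ^+ 2).
Proof.
have m0 := m_ge0 N k lam.
have [C C1 hC] := gauss_pow (addr_ge0 m0 (ler0n R 2)).
apply: (summable_le mD (g := fun x => C * (expR (- `|y x|) * rho x))).
- by apply: measurable_funX; exact: alpha_measurable.
- move=> x Dx; have s0 := punctured_sqn_gt0 Dx; rewrite ger0_norm ?sqr_ge0// alphaE//.
  have [p0 p1] := andP (prof_bounds Dx).
  rewrite !exprMn -!expRM_natl.
  apply: (@le_trans _ _ (expR (2%:R * (- 8^-1 * sqn x)) * expR (2%:R * (a / 2 * y x)) * expR (k%:R * (y x / 2)) ^+ 2)).
    apply: ler_wpM2l; first by rewrite mulr_ge0 ?expR_ge0.
    by rewrite ler_pXn2r ?nnegrE ?expR_ge0.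
  rewrite -expRM_natl -mulrA -expRD.
  have -> : 2%:R * (a / 2 * y x) + 2%:R * (k%:R * (y x / 2)) = (m + 1) * y x + - (N%:R / 2) * y x.
    have -> : 2%:R * (a / 2 * y x) + 2%:R * (k%:R * (y x / 2)) = (a + k%:R) * y x by field.
    by rewrite alpha_expE; ring.
  have -> : 2%:R * (- 8^-1 * sqn x) = - 4^-1 * sqn x :> R by field.
  rewrite expRD !mulrA; apply: ler_wpM2r; first exact: expR_ge0.
  rewrite expRN ler_pdivlMr ?expR_gt0// -mulrA -expRD.
  have [y0|y0] := leP (y x) 0.
    apply: le_trans C1; apply: (@le_trans _ _ (expR 0)); last by rewrite expR0.
    rewrite -expRD ler_expR ler0_norm//.
    have : 0 <= 4^-1 * sqn x by rewrite mulr_ge0// ltW.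
    by have := mulr_ge0_le0 m0 y0; lra.
  rewrite gtr0_norm// (_ : (m + 1) * y x + y x = (m + 2%:R) * y x); first exact: hC.
  by ring.
- by apply: (summableZ mD); exact: summable_rho.
Qed.

Lemma approximant_cvg : I (fun x => (w n x - al x) ^+ 2) @[n --> \oo] --> 0.
Proof.
have i0 : I (fun=> 0) = 0 :> R by rewrite Rintegral_cst; [rewrite mul0r|exact: mD].
rewrite -[X in _ --> X]i0.
apply: (proj2 (dominated_int mD (g := fun x => al x ^+ 2) _ _ alpha_summable _)).
- move=> n; apply: measurable_funX; apply: measurable_funB; last exact: alpha_measurable.
  exact: (C1_compact_measurable (A := D) hN (test_C1_compact (approximant_test k lam hN n))).
- move=> x Dx; under eq_fun do rewrite approximantE//.
  have -> : 0 = (al x * 1 - al x) ^+ 2 by rewrite mulr1 subrr expr0n.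
  apply: (@continuous_cvg _ _ _ _ _ _ (fun z : R => z ^+ 2)); first exact: exprn_continuous.
  apply: cvgB; last exact: cvg_cst.
  by apply: cvgM; [exact: cvg_cst|exact: damping_cvg].
- move=> n x Dx; rewrite ger0_norm ?sqr_ge0// approximantE//.
  have -> : (al x * damping n x - al x) ^+ 2 = ((1 - damping n x) * al x) ^+ 2 by ring.
  by have /andP[e0 e1] := damping_itv n x; apply: sqr_contract; lra.
Qed.

End convergence.

(** * Extension of the form *)

Section extension.
Variables (R : realType) (N k : nat) (lam : R).
Hypotheses (hN : (2 <= N)%N) (hk : (k <= N)%N) (hlam : lam <= hardy_const R N k).
Implicit Types (u v f g : 'rV[R]_N -> R) (x : 'rV[R]_N) (i j : 'I_N) (n : nat).
Local Notation mu := (lebesgue_rV R N).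
Local Notation Om := (@orthant R N k).
Local Notation D := (@punctured R N k).
Local Notation sm := (summable_on mu D).
Local Notation I f := (\int[mu]_(x in D) f x).
Local Notation mD := (@measurable_punctured R N k).
Local Notation m := (m_lam N k lam).
Local Notation a := (alpha_exp N k lam).
Local Notation G u := (twist_sq k a 0 u).
Local Notation hardy_fin u := (sm (fun x => a * (u x ^+ 2 / sqn x))).
Local Notation en u := (energy k lam u).
Local Notation al := (@alpha R N k lam).

Lemma halfm_ge0 : 0 <= (1 + m) / 2.
Proof. by rewrite divr_ge0// addr_ge0// m_ge0. Qed.

Lemma twist_sq_int_ge0 u : 0 <= I (G u).
Proof. by apply: int_ge0 => x _; apply: sumr_ge0 => i _; exact: sqr_ge0. Qed.

Lemma sq_int_ge0 u : 0 <= I (fun x => u x ^+ 2).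
Proof. by apply: int_ge0 => x _; exact: sqr_ge0. Qed.

Lemma energy_ge0 u : 0 <= en u.
Proof. by rewrite addr_ge0 ?twist_sq_int_ge0// mulr_ge0 ?sq_int_ge0// halfm_ge0. Qed.

Lemma form_norm_lty K u : C1_compact k K u -> hardy_fin u <-> (form_norm k lam u < +oo)%E.
Proof.
move=> hu; split => [su|].
  by rewrite /form_norm; have [_ _ ->] := form_identity hN hk hlam hu su; exact: ltry.
move=> uoo; suff : (hardy_form k lam u < +oo)%E by move=> /(form_finite hN hk hlam hu).
by move: uoo; rewrite /form_norm; case: (hardy_form k lam u) => //= r _; exact: ltry.
Qed.

Lemma form_norm_energy K u (e : R) : C1_compact k K u -> 0 < e -> hardy_fin u ->
  (form_norm k lam u < e%:E)%E <-> en u < e ^+ 2.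
Proof.
move=> hu e0 su; rewrite /form_norm; have [_ _ ->] := form_identity hN hk hlam hu su.
rewrite -/(en u) /= lte_fin -{1}(ger0_norm (ltW e0)) -sqrtr_sqr ltr_sqrt//.
by rewrite exprn_gt0.
Qed.

Lemma form_norm_real K u (e : R) : C1_compact k K u -> (form_norm k lam u < e%:E)%E -> hardy_fin u.
Proof.
by move=> hu ue; apply/(form_norm_lty hu); exact: lt_trans ue (ltry _).
Qed.

Lemma in_L2_summable u : in_L2 k u -> measurable_fun D u /\ sm (fun x => u x ^+ 2).
Proof.
move=> [mu_ uoo]; have mD_ : measurable_fun D u.
  by apply: measurable_funS mu_; [exact: measurable_orthant|exact: subDsetl].
split => //; apply: summable_ge0; first exact: measurable_funX.
  by move=> x _; exact: sqr_ge0.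
by rewrite -(L2normsqE hN).
Qed.

Section approximating_sequence.
Variables (w : nat -> 'rV[R]_N -> R) (u : 'rV[R]_N -> R).
Hypotheses (hu : in_L2 k u) (hw : Defs.approx k lam w u).

Lemma approx_C2_compact n : exists K, C2_compact k K (w n).
Proof. by have [/(_ n)[/test_C2_compact ? _] _ _] := hw; eexists; eassumption. Qed.

Lemma approx_C1_compact n : exists K, C1_compact k K (w n).
Proof. by have [K []] := approx_C2_compact n; exists K. Qed.

Lemma approx_hardy_fin n : hardy_fin (w n).
Proof.
by have [K hwn] := approx_C1_compact n; apply/(form_norm_lty hwn); have [/(_ n)[]] := hw.
Qed.

Lemma approx_cauchy e : 0 < e -> exists n0, forall p n, (n0 <= p)%N -> (n0 <= n)%N ->
  en (fun x => w p x - w n x) < e ^+ 2.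
Proof.
move=> e0; have [_ /(_ e e0)[n0 n0P] _] := hw; exists n0 => p n pn nn.
have [K hp] := approx_C1_compact p; have [K' hn] := approx_C1_compact n.
have hpn := C1_compactB hp hn; have pe := n0P p n pn nn.
by apply/(form_norm_energy hpn e0) => //; exact: form_norm_real hpn pe.
Qed.

Lemma approx_L2_int : I (fun x => (w n x - u x) ^+ 2) @[n --> \oo] --> 0.
Proof.
have [_ _ L] := hw; have [muD su] := in_L2_summable hu.
suff E n : L2normsq k (fun x => w n x - u x) = (I (fun x => (w n x - u x) ^+ 2))%:E.
  have := fine_cvg (a := 0) L.
  have <- : fine \o (fun n => L2normsq k (fun x => w n x - u x)) = fun n => I (fun x => (w n x - u x) ^+ 2).
    by apply/funext => n /=; rewrite E.
  exact.
have [K hn] := approx_C1_compact n.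
rewrite (L2normsqE hN); last first.
  by apply: measurable_funB; [exact: C1_compact_measurable hn|exact: hu.1].
apply/esym/EFin_int; first exact: mD.
apply: summable_sqB => //; first exact: (C1_compact_measurable (A := D) hN hn).
exact: C1_compact_summable_sq hn.
Qed.

Lemma sqrt_cvg_sq (f : nat -> R) (l : R) : (forall n, 0 <= f n) ->
  Num.sqrt (f n) @[n --> \oo] --> l -> f n @[n --> \oo] --> l ^+ 2.
Proof.
move=> f0 fl; rewrite (_ : (fun n => f n) = (fun n => Num.sqrt (f n) ^+ 2)).
  by apply: (@continuous_cvg _ _ _ _ _ _ (fun z : R => z ^+ 2)) => //; exact: exprn_continuous.
by apply/funext => n; rewrite sqr_sqrtr.
Qed.

Lemma approx_sq_int : I (fun x => w n x ^+ 2) @[n --> \oo] --> I (fun x => u x ^+ 2).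
Proof.
have [muD su] := in_L2_summable hu.
rewrite -[X in _ --> X](sqr_sqrtr (sq_int_ge0 u)).
apply: sqrt_cvg_sq => [n|]; first exact: sq_int_ge0.
have r0 : Num.sqrt (I (fun x => (w n x - u x) ^+ 2)) @[n --> \oo] --> (0 : R).
  have := approx_L2_int; rewrite -[X in _ -> _ --> X](@sqrtr0 R) => h.
  by apply: (@continuous_cvg _ _ _ _ _ _ (@Num.sqrt R)) => //; exact: sqrt_continuous.
apply/cvgrPdist_le => e e0; move/cvgrPdist_le : r0 => /(_ e e0).
apply: filterS => n; rewrite sub0r normrN ger0_norm ?sqrtr_ge0//.
apply: le_trans; have [K hn] := approx_C1_compact n.
have mw := C1_compact_measurable (A := D) hN hn; have sw := C1_compact_summable_sq hN hn.
have s1 := summable_sqB mw muD sw su; have s2 := summable_sqB muD mw su sw.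
have t1 := sqrt_int_triangle sw su s1; have t2 := sqrt_int_triangle su sw s2.
have E : I (fun x => (u x - w n x) ^+ 2) = I (fun x => (w n x - u x) ^+ 2).
  by apply: eq_int => x _; ring.
by rewrite E in t2; rewrite ler_norml; apply/andP; split; lra.
Qed.

(** The square root of the energy is a seminorm, so it is Cauchy along w and the form has a finite
    limit: [form_ext] selects from a nonempty set. Dropping the nonnegative twisted part in the
    limit gives the inequality on H. *)
Lemma approx_energy : exists2 L, en (w n) @[n --> \oo] --> L &
  hardy_form k lam (w n) @[n --> \oo] --> L%:E /\ (1 + m) / 2 * I (fun x => u x ^+ 2) <= L.
Proof.
have : cvgn (fun n => Num.sqrt (en (w n))).
  apply: cauchy_seq_cvg => e e0; have [n0 n0P] := approx_cauchy e0.
  exists n0 => p n pn nn.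
  have [K hp] := approx_C1_compact p; have [K' hn] := approx_C1_compact n.
  have T q q' : (n0 <= q)%N -> (n0 <= q')%N ->
      Num.sqrt (en (w q)) <= Num.sqrt (en (w q')) + e.
    move=> qn qn'; have [Kq hq] := approx_C1_compact q; have [Kq' hq'] := approx_C1_compact q'.
    apply: (le_trans (energy_triangle hN hk hlam hq hq' (approx_hardy_fin q) (approx_hardy_fin q'))).
    rewrite lerD2l -[leRHS](ger0_norm (ltW e0)) -sqrtr_sqr ler_sqrt ?sqr_ge0//.
    exact: ltW (n0P q q' qn qn').
  have := T p n pn nn; have := T n p nn pn.
  by rewrite ler_norml => *; apply/andP; split; lra.
move=> /cvg_ex[l ll]; have El := sqrt_cvg_sq (fun n => energy_ge0 (w n)) ll.
exists (l ^+ 2) => //; split.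
  have -> : (fun n => hardy_form k lam (w n)) = EFin \o (fun n => en (w n)).
    apply/funext => n; have [K hn] := approx_C1_compact n.
    by have [_ _ ->] := form_identity hN hk hlam hn (approx_hardy_fin n).
  by apply: cvg_EFin => //; near=> n.
have cl : (1 + m) / 2 * I (fun x => w n x ^+ 2) @[n --> \oo] --> (1 + m) / 2 * I (fun x => u x ^+ 2).
  by apply: cvgM; [exact: cvg_cst|exact: approx_sq_int].
apply: (ler_cvg_to cl El); near=> n.
by rewrite lerDl twist_sq_int_ge0.
Unshelve. all: by end_near. Qed.

End approximating_sequence.

Lemma alpha_in_L2 : in_L2 k al.
Proof.
split; first exact: alpha_measurable.
rewrite (L2normsqE hN); last exact: alpha_measurable.
by rewrite -EFin_int; [exact: ltry|exact: mD|exact: alpha_summable].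
Qed.

Lemma half_sum_lt (c A B r1 r2 g1 g2 e : R) : 0 <= c ->
  A <= 2 * r1 + 2 * r2 -> B <= 2 * g1 + 2 * g2 ->
  2 * c * r1 + 2 * g1 < e / 2 -> 2 * c * r2 + 2 * g2 < e / 2 -> c * A + B < e.
Proof. by move=> c0 /(ler_wpM2l c0); lra. Qed.

Lemma sq_int_diff f g h : sm (fun x => (f x - h x) ^+ 2) -> sm (fun x => (g x - h x) ^+ 2) ->
  sm (fun x => (f x - g x) ^+ 2) ->
  I (fun x => (f x - g x) ^+ 2) <=
  2 * I (fun x => (f x - h x) ^+ 2) + 2 * I (fun x => (g x - h x) ^+ 2).
Proof.
move=> sf sg sfg; have s1 := summableZ mD 2 sf; have s2 := summableZ mD 2 sg.
rewrite -(intZ mD _ sf) -(intZ mD _ sg) -(intD mD s1 s2).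
apply: (le_int mD sfg (summableD mD s1 s2)) => x _.
by have := sqr_ge0 ((f x - h x) + (g x - h x)); lra.
Qed.

Lemma twist_sq_int_diff K K' u v : C1_compact k K u -> C1_compact k K' v -> hardy_fin u -> hardy_fin v ->
  I (G (fun x => u x - v x)) <= 2 * I (G u) + 2 * I (G v).
Proof.
move=> hu hv su sv.
have [sGu _ _] := form_identity hN hk hlam hu su.
have [sGv _ _] := form_identity hN hk hlam hv sv.
have [sGuv _ _] := form_identity hN hk hlam (C1_compactB hu hv) (hardy_finB hN hu hv su sv).
have s1 := summableZ mD 2 sGu; have s2 := summableZ mD 2 sGv.
rewrite -(intZ mD _ sGu) -(intZ mD _ sGv) -(intD mD s1 s2).
apply: (le_int mD sGuv (summableD mD s1 s2)) => x _.
rewrite !twist_sqE !mulr_sumr -big_split/=; apply: ler_sum => i _.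
rewrite (twistB lam hu hv).
by have := sqr_ge0 (twist k a i u x + twist k a i v x); lra.
Qed.

Lemma approximant_approx : Defs.approx k lam (@approximant R N k lam) al.
Proof.
have ht n := approximant_test k lam hN n.
have hsn n := approximant_hardy_fin k lam hN n.
have hc n := test_C1_compact (ht n).
split.
- by move=> n; split; [exact: ht|exact/(form_norm_lty (hc n))].
- move=> e e0.
  (* The energy of w p - w n is at most z p + z n, by |s - t|^2 <= 2 |s|^2 + 2 |t|^2; so the
     convergence of each part of z to 0 gives the Cauchy condition. *)
  pose z n := 2 * ((1 + m) / 2) * I (fun x => (approximant k lam n x - al x) ^+ 2) + 2 * I (G (approximant k lam n)).
  have z0 : z n @[n --> \oo] --> (0 : R).
    rewrite -[X in _ --> X](_ : 2 * ((1 + m) / 2) * 0 + 2 * 0 = 0); last by rewrite !mulr0 addr0.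
    apply: cvgD; apply: cvgM; [exact: cvg_cst| |exact: cvg_cst|exact: twist_sq_approximant_cvg].
    exact: approximant_cvg.
  have /cvgrPdist_lt/(_ (e ^+ 2 / 2)) := z0; rewrite divr_gt0 ?exprn_gt0//.
  move=> /(_ isT)[n0 _ n0P]; exists n0 => p n pn nn.
  have hpn := C1_compactB (hc p) (hc n); have hspn := hardy_finB hN (hc p) (hc n) (hsn p) (hsn n).
  apply/(form_norm_energy hpn e0 hspn).
  have zp : z p < e ^+ 2 / 2 by have := n0P p pn; rewrite /= sub0r normrN; apply: le_lt_trans; exact: ler_norm.
  have zn : z n < e ^+ 2 / 2 by have := n0P n nn; rewrite /= sub0r normrN; apply: le_lt_trans; exact: ler_norm.
  have ma := @alpha_measurable R N k lam D; have sa := alpha_summable lam hk.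
  have mw q := C1_compact_measurable (A := D) hN (hc q).
  have sw q := C1_compact_summable_sq hN (hc q).
  have swa q := summable_sqB (mw q) ma (sw q) sa.
  have swpn := summable_sqB (mw p) (mw n) (sw p) (sw n).
  have b1 := sq_int_diff (swa p) (swa n) swpn.
  have b2 := twist_sq_int_diff (hc p) (hc n) (hsn p) (hsn n).
  exact: (half_sum_lt halfm_ge0 b1 b2 zp zn).
have E n : L2normsq k (fun x => approximant k lam n x - al x) =
    (I (fun x => (approximant k lam n x - al x) ^+ 2))%:E.
  rewrite (L2normsqE hN); last first.
    by apply: measurable_funB; [exact: C1_compact_measurable (hc n)|exact: alpha_measurable].
  apply/esym/EFin_int; first exact: mD.
  apply: summable_sqB.
  - exact: (C1_compact_measurable (A := D) hN (hc n)).
  - exact: alpha_measurable.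
  - exact: C1_compact_summable_sq (hc n).
  - exact: alpha_summable.
rewrite (_ : (fun n => _) = EFin \o (fun n => I (fun x => (approximant k lam n x - al x) ^+ 2))).
  by apply: cvg_EFin; [near=> n|exact: approximant_cvg].
by apply/funext => n; rewrite E.
Unshelve. all: by end_near. Qed.

(** Along an arbitrary approximating sequence the L^2 part converges to that of alpha, and
    [gradient_vanishing], by comparison with the explicit approximants, leaves nothing of the
    twisted part. *)
Lemma approx_alpha_energy w : Defs.approx k lam w al ->
  hardy_form k lam (w n) @[n --> \oo] --> ((1 + m) / 2 * I (fun x => al x ^+ 2))%:E.
Proof.
move=> hw; have hL2 := alpha_in_L2; have [L EL [HL _]] := approx_energy hL2 hw.
suff G0 : I (G (w n)) @[n --> \oo] --> 0.
  suff -> : (1 + m) / 2 * I (fun x => al x ^+ 2) = L by [].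
  have EL' : en (w n) @[n --> \oo] --> (1 + m) / 2 * I (fun x => al x ^+ 2) + 0.
    apply: cvgD => //; apply: cvgM; first exact: cvg_cst.
    exact: approx_sq_int hL2 hw.
  by rewrite addr0 in EL'; exact: cvg_unique EL' EL.
apply: (gradient_vanishing hN hk hlam (w' := @approximant R N k lam) (u := al)).
- exact: approx_C2_compact hw.
- exact: approx_hardy_fin hw.
- by move=> n; eexists; exact: test_C1_compact (approximant_test k lam hN n).
- exact: approximant_hardy_fin.
- exact: alpha_measurable.
- exact: alpha_summable.
- exact: approx_L2_int.
- exact: approximant_cvg.
- exact: twist_sq_approximant_cvg.
move=> e e0; have se0 : 0 < Num.sqrt e by rewrite sqrtr_gt0.
have [n0 n0P] := approx_cauchy hw se0; exists n0 => p n pn nn.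
have := n0P n p nn pn; rewrite sqr_sqrtr ?(ltW e0)// => /ltW; apply: le_trans.
by rewrite /energy lerDr mulr_ge0 ?sq_int_ge0// halfm_ge0.
Qed.

Lemma alpha_sq_int_gt0 : 0 < I (fun x => al x ^+ 2).
Proof.
pose B := [set x : 'rV[R]_N | forall j, (fun=> `[1, 2]%classic : set R) j (x ord0 j)].
have mB : measurable B by apply: measurable_rV_rect => j; exact: measurable_itv.
have BD : B `<=` D.
  move=> x Bx; split => [j _|x0].
    by have := Bx j; rewrite /= in_itv/= => /andP[+ _]; apply: lt_le_trans.
  by have := Bx (Ordinal (ltnW hN)); rewrite /= x0 mxE in_itv/= ler10.
have muB : (mu B = 1)%E.
  rewrite [LHS](lebesgue_rV_box (A := fun=> `[1, 2]%classic))//.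
  rewrite big1// => j _; rewrite lebesgue_measure_itv/= lte_fin ltr1n/= -EFinD; congr EFin; lra.
(* On the unit cube [1, 2]^N one has 1 <= |x|^2 <= 4 N, hence e^(-|x|^2/8) >= e^(-N/2) and 0 <= ln
   |x|^2 <= 4 N, while the product of the coordinates is at least 1. *)
pose kap := expR (- (N%:R / 2)) * expR (- (`|a| / 2 * (4 * N%:R))).
have kap0 : 0 < kap by rewrite mulr_gt0 ?expR_gt0.
have kal x : B x -> kap <= al x.
  move=> Bx; have Dx := BD x Bx; rewrite alphaE//.
  have xj j : 1 <= x ord0 j <= 2 by have := Bx j; rewrite /= in_itv.
  have s1 : 1 <= sqn x.
    rewrite /sqn (bigD1 (Ordinal (ltnW hN)))//= ler_wpDr ?sumr_ge0// => [j _|]; first exact: sqr_ge0.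
    by rewrite exprn_ege1//; have /andP[] := xj (Ordinal (ltnW hN)).
  have s4 : sqn x <= 4 * N%:R.
    apply: (@le_trans _ _ (\sum_(j < N) 4)).
      by apply: ler_sum => j _; have /andP[? ?] := xj j; nra.
    by rewrite sumr_const card_ord mulr_natr.
  have y0 : 0 <= ln (sqn x) by exact: ln_ge0.
  have y4 : ln (sqn x) <= 4 * N%:R.
    by rewrite (le_trans _ s4)// ltW// ln_sublinear// (lt_le_trans _ s1).
  apply: (@le_trans _ _ (expR (- 8^-1 * sqn x) * expR (a / 2 * ln (sqn x)))).
    apply: ler_pM; rewrite ?expR_ge0// ler_expR; first lra.
    rewrite -lerN2 opprK.
    have : `|a| / 2 * ln (sqn x) <= `|a| / 2 * (4 * N%:R) by apply: ler_wpM2l.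
    apply: le_trans; rewrite -mulNr; apply: ler_wpM2r => //.
    by have := ler_norm (- a); rewrite normrN; lra.
  rewrite ler_peMr// ?mulr_ge0 ?expR_ge0//.
  elim/big_ind : _ => // [p q p1 q1|j _]; first exact: mulr_ege1.
  by case: ifP => // _; case/andP: (xj j).
have s1 : sm (\1_B).
  apply: (@summable_ge0 _ _ _ mu) => //.
  rewrite integral_indic//; last exact: mD.
  rewrite (_ : B `&` D = B); last by apply/setIidPl.
  by rewrite [X in (X < _)%E]muB ltry.
have I1 : I (\1_B) = 1.
  apply: EFin_inj; rewrite (EFin_int mD s1) integral_indic//; last exact: mD.
  rewrite (_ : B `&` D = B)//; exact/setIidPl.
have : kap ^+ 2 <= I (fun x => al x ^+ 2).
  have s2 := summableZ mD (kap ^+ 2) s1.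
  rewrite -[leLHS]mulr1 -I1 -(intZ mD _ s1).
  apply: (le_int mD s2 (alpha_summable lam hk)) => x Dx.
  rewrite indicE; case: (boolP (x \in B)) => [/set_mem/kal h|_] /=.
    by rewrite mulr1 ler_pXn2r ?nnegrE ?(ltW kap0)// (le_trans _ h)// ltW.
  by rewrite mulr0 sqr_ge0.
by apply: lt_le_trans; rewrite exprn_gt0.
Qed.

End extension.

Theorem theorem1p1 (R : realType) (N k : nat) (lam : R)
    (hN : (2 <= N)%N) (hk : (k <= N)%N) (hlam : lam <= hardy_const R N k) :
  let c : R := (1 + m_lam N k lam) / 2 in
  let a : 'rV[R]_N -> R := alpha k lam in
  [/\ (* the inequality *)
      forall u : 'rV[R]_N -> R, test_fun (orthant k) u ->
        (c%:E * L2normsq k u <= hardy_form k lam u)%E,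
      (* sharpness of the constant *)
      forall c' : R,
        (forall u : 'rV[R]_N -> R, test_fun (orthant k) u ->
          (c'%:E * L2normsq k u <= hardy_form k lam u)%E) ->
        c' <= c,
      (* extension to H *)
      forall u : 'rV[R]_N -> R, in_H k lam u ->
        (c%:E * L2normsq k u <= form_ext k lam u)%E &
      (* equality for alpha *)
      in_H k lam a /\
      form_ext k lam a
        = (c%:E * L2normsq k a)%E].
Proof.
move=> c a.
have ineq (u : 'rV[R]_N -> R) : test_fun (orthant k) u -> (c%:E * L2normsq k u <= hardy_form k lam u)%E.
  by move=> hu; exact: (hardy_ineq hN hk hlam (test_C1_compact hu)).
have aL2 : in_L2 k a by exact: alpha_in_L2.
have aw : Defs.approx k lam (@approximant R N k lam) a by exact: approximant_approx.
have L2E (u : 'rV[R]_N -> R) : in_L2 k u -> L2normsq k u =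
    (\int[lebesgue_rV R N]_(x in @punctured R N k) (u x ^+ 2))%:E.
  move=> hu; have [_ su] := in_L2_summable hN hu.
  by rewrite (L2normsqE hN hu.1) EFin_int//; exact: measurable_punctured.
have extP (u : 'rV[R]_N -> R) : in_H k lam u -> exists w, Defs.approx k lam w u /\
    hardy_form k lam (w n) @[n --> \oo] --> form_ext k lam u.
  move=> [hu [w hw]]; have [L _ [HL _]] := approx_energy hN hk hlam hu hw.
  by apply: (@getPex _ [set l | exists w, Defs.approx k lam w u /\ hardy_form k lam (w n) @[n --> \oo] --> l]);
    exists L%:E, w.
split => //.
- move=> c' hc'.
  (* The inequality with c' is available for test functions only, so it is applied to the
     approximants; in the limit both sides are multiples of the integral of alpha^2, which is
     positive and cancels. *)
  have aI := alpha_sq_int_gt0 lam hN hk.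
  rewrite -(ler_pM2r aI).
  have l1 := approx_alpha_energy hN hk hlam aw.
  have l2 : c' * \int[lebesgue_rV R N]_(x in @punctured R N k) (approximant k lam n x ^+ 2) @[n --> \oo] -->
      c' * \int[lebesgue_rV R N]_(x in @punctured R N k) (alpha k lam x ^+ 2).
    by apply: cvgM; [exact: cvg_cst|exact: (approx_sq_int hN aL2 aw)].
  have l3 : (c' * \int[lebesgue_rV R N]_(x in @punctured R N k) (approximant k lam n x ^+ 2))%:E @[n --> \oo] -->
      (c' * \int[lebesgue_rV R N]_(x in @punctured R N k) (alpha k lam x ^+ 2))%:E.
    by apply: cvg_EFin => //; near=> n.
  rewrite -lee_fin; apply: (lee_cvg_to l3 l1); near=> n => /=.
  have ht := approximant_test k lam hN n.
  by have := hc' _ ht; rewrite (L2normsq_C1_compact hN (test_C1_compact ht)) EFinM.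
- move=> u hu; have [w [hw Hw]] := extP u hu.
  have [L _ [HL cL]] := approx_energy hN hk hlam hu.1 hw.
  rewrite (cvg_unique _ Hw HL)// (L2E u hu.1) -EFinM lee_fin//.
- split; first by split => //; exists (@approximant R N k lam).
  have aH : in_H k lam a by split => //; exists (@approximant R N k lam).
  have [w [hw Hw]] := extP a aH.
  rewrite (cvg_unique _ Hw (approx_alpha_energy hN hk hlam hw))//.
  by rewrite (L2E a aL2) -EFinM.
Unshelve. all: by end_near. Qed.
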